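(* Let $\rho_0,u_0\in C^1(\mathbb{R})$ with $\rho_0(x)>0$ for all $x\in\mathbb{R}$, and suppose there exists $\delta>0$ such that $u_0'$ and $(1+x^2)^{(2+\delta)/2}\rho_0(x)$ are bounded continuous functions on $\mathbb{R}$. Set $M_0=\int_{\mathbb{R}}\rho_0(x)\,dx$. Consider the one-dimensional pressureless damped Euler system $$\rho_t+(\rho u)_x=0,\qquad u_t+uu_x+u=-\partial W\star\rho,\qquad W(x)=-|x|+\frac{|x|^2}{2},$$ with $\rho(x,0)=\rho_0(x)$, $u(x,0)=u_0(x)$. Then there is finite time breakdown if and only if there exists $x\in\mathbb{R}$ such that the following holds. (1) (Subcritical mass) In the case $M_0<1/4$: $$\max\{u_0'(x),\ u_0'(x)+\lambda_2(0.5M_0-\rho_0(x))\}<0$$ and $$\left|\frac{0.5M_0\lambda_2u_0'(x)+M_0-2\rho_0(x)}{2\rho_0(x)}\right|^{\lambda_1}\le\left|\frac{0.5M_0\lambda_1u_0'(x)+M_0-2\rho_0(x)}{2\rho_0(x)}\right|^{\lambda_2},$$ where $\lambda_1=\frac{1-\sqrt{1-4M_0}}{M_0}$ and $\lambda_2=\frac{1+\sqrt{1-4M_0}}{M_0}$. (2) (Critical mass) In the case $M_0=1/4$: $$\max\{u_0'(x),\ M_0u_0'(x)+0.5M_0-\rho_0(x)\}<0$$ and $$\ln\left(-\frac{M_0u_0'(x)+0.5M_0-\rho_0(x)}{\rho_0(x)}\right)\ge\frac{M_0u_0'(x)}{M_0u_0'(x)+0.5M_0-\rho_0(x)}.$$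 (3) (Supercritical mass) In the case $M_0>1/4$: $$\left(u_0'(x)+\frac{0.5M_0-\rho_0(x)}{M_0}\right)^2\ge\left(M_0-\frac14\right)\left[\frac{4\rho_0^2(x)}{M_0^2}\left(\frac{M_0e^{t^*}}{M_0-\frac14}-1\right)+\frac{4\rho_0(x)-M_0}{M_0}\right],$$ where $$t^*=\frac{1}{\sqrt{M_0-\frac14}}\left[\beta+\tan^{-1}\left(\frac{2u_0'(x)\sqrt{M_0-\frac14}}{u_0'(x)+2M_0-4\rho_0(x)}\right)\right],$$ $$\beta=\begin{cases}0,&u_0'(x)<\min\{0,4(\rho_0(x)-0.5M_0)\},\\ \pi,&4(\rho_0(x)-0.5M_0)<u_0'(x),\\ 2\pi,&0<u_0'(x)<4(\rho_0(x)-0.5M_0).\end{cases}$$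
   Context: The solution is sought for $x\in\mathbb{R}$, $t>0$; $u_0'$ is the derivative of $u_0$. The nonlocal term is $(\partial W\star\rho)(x,t)=\int_{\mathbb{R}}[-\mathrm{sgn}(x-y)+(x-y)]\rho(y,t)\,dy$. Solutions are $C^1$ (classical) solutions satisfying, at each time $t$ of existence, $\rho|u|^i\to0$ as $|x|\to\infty$ for $i=1,2$ and $\rho(x,t)\le C/|x|^{2+\delta}$ for a constant $C$; under the stated hypotheses such a solution exists locally in time and is unique. ''Finite time breakdown'' means that the maximal life span $T^*$ of this solution is finite; in that case $\lim_{t\to T^{*-}}\partial_xu=-\infty$ at some point $x^*\in\mathbb{R}$. $\tan^{-1}$ is the principal branch with values in $(-\pi/2,\pi/2)$.
   Formalization: t*, undefined where u0'+2M0-4rho0=0, is given its limit there (beta+arctan = pi/2 if u0'<0, 3pi/2 if u0'>0); undefined points with u0'=0 get a value at which (3) fails. The maximal C^1 solution is taken as given, since for u0 not C^2 none exists. *)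

(* Defs.v *)
From Stdlib Require Import Reals.
From Coquelicot Require Import Coquelicot.

Open Scope R_scope.

Definition class_C1 (f : R -> R) : Prop :=
  (forall x, ex_derive f x) /\ (forall x, continuous (Derive f) x).

Definition integral_line (f : R -> R) : R :=
  RInt_gen f (Rbar_locally m_infty) (Rbar_locally p_infty).

Definition ex_integral_line (f : R -> R) : Prop :=
  ex_RInt_gen f (Rbar_locally m_infty) (Rbar_locally p_infty).

Definition strip (T : Rbar) (p : R * R) : Prop :=
  0 <= snd p /\ Rbar_lt (Finite (snd p)) T.

(* f (x, t) is of class C^1 on R x [0, T), up to the boundary t = 0: it has both
   partial derivatives for 0 < t < T, and f and these derivatives extend
   continuously to t = 0.  Functions are total on R x R; their values outside
   the strip are irrelevant. *)
Definition C1_strip (T : Rbar) (f : R -> R -> R) : Prop :=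
  exists fx ft : R -> R -> R,
    (forall x t, 0 < t -> Rbar_lt (Finite t) T ->
       is_derive (fun y => f y t) x (fx x t) /\
       is_derive (fun s => f x s) t (ft x t)) /\
    continuous_on (strip T) (fun p => f (fst p) (snd p)) /\
    continuous_on (strip T) (fun p => fx (fst p) (snd p)) /\
    continuous_on (strip T) (fun p => ft (fst p) (snd p)).

(* The kernel is the derivative of W(z) = - |z| + |z|^2 / 2, with sgn 0 = 0. *)
Definition dW (z : R) : R := - sign z + z.

Definition dW_conv (rho : R -> R -> R) (x t : R) : R :=
  integral_line (fun y => dW (x - y) * rho y t).

(* The constant C may depend on t.  The point x = 0 is excluded from the decay
   bound because division by 0 is total here.  Convergence of the nonlocal
   integral is required explicitly because RInt_gen is total. *)
Record solution (delta : R) (rho0 u0 : R -> R) (T : Rbar)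
    (rho u : R -> R -> R) : Prop := {
  sol_lifespan_pos : Rbar_lt (Finite 0) T;
  sol_rho_C1 : C1_strip T rho;
  sol_u_C1 : C1_strip T u;
  sol_rho_init : forall x, rho x 0 = rho0 x;
  sol_u_init : forall x, u x 0 = u0 x;
  sol_conv : forall x t, 0 <= t -> Rbar_lt (Finite t) T ->
    ex_integral_line (fun y => dW (x - y) * rho y t);
  sol_mass : forall x t, 0 < t -> Rbar_lt (Finite t) T ->
    Derive (fun s => rho x s) t + Derive (fun y => rho y t * u y t) x = 0;
  sol_momentum : forall x t, 0 < t -> Rbar_lt (Finite t) T ->
    Derive (fun s => u x s) t + u x t * Derive (fun y => u y t) x + u x t
    = - dW_conv rho x t;
  sol_vanish : forall t i, 0 <= t -> Rbar_lt (Finite t) T ->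
    (i = 1%nat \/ i = 2%nat) ->
    is_lim (fun x => rho x t * Rabs (u x t) ^ i) m_infty 0 /\
    is_lim (fun x => rho x t * Rabs (u x t) ^ i) p_infty 0;
  sol_decay : forall t, 0 <= t -> Rbar_lt (Finite t) T ->
    exists C, forall x, x <> 0 -> rho x t <= C / Rpower (Rabs x) (2 + delta)
}.

Definition maximal_solution (delta : R) (rho0 u0 : R -> R) (Tstar : Rbar)
    (rho u : R -> R -> R) : Prop :=
  solution delta rho0 u0 Tstar rho u /\
  forall (T : Rbar) (rho' u' : R -> R -> R),
    Rbar_lt Tstar T ->
    solution delta rho0 u0 T rho' u' ->
    ~ (forall x t, 0 <= t -> Rbar_lt (Finite t) Tstar ->
         rho' x t = rho x t /\ u' x t = u x t).

Definition finite_time_breakdown (Tstar : Rbar) : Prop :=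
  Rbar_lt Tstar p_infty.

(* In the conditions below M stands for M_0, p for u_0'(x), r for rho_0(x). *)

Definition lambda1 (M : R) : R := (1 - sqrt (1 - 4 * M)) / M.
Definition lambda2 (M : R) : R := (1 + sqrt (1 - 4 * M)) / M.

(* Rpower is only meaningful for a positive base.  The first conjunct makes
   both bases nonzero, hence positive. *)
Definition subcritical_condition (M p r : R) : Prop :=
  Rmax p (p + lambda2 M * (M / 2 - r)) < 0 /\
  Rpower (Rabs ((M / 2 * lambda2 M * p + M - 2 * r) / (2 * r))) (lambda1 M)
  <= Rpower (Rabs ((M / 2 * lambda1 M * p + M - 2 * r) / (2 * r))) (lambda2 M).

Definition critical_condition (M p r : R) : Prop :=
  Rmax p (M * p + M / 2 - r) < 0 /\
  ln (- ((M * p + M / 2 - r) / r)) >= (M * p) / (M * p + M / 2 - r).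

(* The last branch is the case 0 < p < 4 (r - M / 2).  It also gives a value at
   p = 0 < 4 (r - M / 2), where the usual formula leaves beta undefined; the
   supercritical inequality fails there whichever of 0 and 2 PI is taken. *)
Definition beta (M p r : R) : R :=
  if Rlt_dec p (Rmin 0 (4 * (r - M / 2))) then 0
  else if Rlt_dec (4 * (r - M / 2)) p then PI
  else 2 * PI.

(* When p + 2 M - 4 r = 0 the quotient under the arctangent is undefined.  For
   p <> 0, beta + atan has the same limit from both sides of that line, PI / 2
   if p < 0 and 3 PI / 2 if p > 0, and this limit is the value taken.  For
   p = 0 the supercritical inequality fails for every nonnegative value. *)
Definition tstar (M p r : R) : R :=
  / sqrt (M - 1 / 4) *
  (if Req_dec_T (p + 2 * M - 4 * r) 0 then
     if Rlt_dec p 0 then PI / 2 else 3 * PI / 2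
   else beta M p r + atan (2 * p * sqrt (M - 1 / 4) / (p + 2 * M - 4 * r))).

Definition supercritical_condition (M p r : R) : Prop :=
  (p + (M / 2 - r) / M) ^ 2 >=
  (M - 1 / 4) *
  (4 * r ^ 2 / M ^ 2 * (M * exp (tstar M p r) / (M - 1 / 4) - 1)
   + (4 * r - M) / M).

(* Main.v *)
Require Import Defs.
From Stdlib Require Import Reals Lra Lia Classical ClassicalEpsilon.
From Coquelicot Require Import Coquelicot.

Open Scope R_scope.

(** Along a characteristic X' = u(X, t) the momentum equation reads
    X'' + X' = - (dW * rho)(X, t).  For two characteristics the difference of the
    forces is twice the mass between them minus M0 times their distance, and the
    mass between them does not change in time.  Hence the gap solves a linear
    equation with known coefficients, and so does its limit, the Jacobian
    J = dX / dx of the flow with respect to the label x: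
      J'' + J' + M0 J = 2 rho0(x),   J(0) = 1,   J'(0) = u0'(x),
    with rho (X) J = rho0.  Breakdown therefore means that J (x, .) reaches zero
    for some x (breakdown_iff_jacobian_vanishes), and each of the three conditions
    says that the minimum of this damped oscillator is not positive.

    The argument uses that the mass is conserved and that characteristics exist as
    long as the solution does.  Neither is immediate, since the decay of a
    solution is not uniform in time: mass could a priori enter from infinity or
    escape to it.  While the characteristic from 0 exists, all the others exist
    too, at bounded distance from it (all_trajectories_exist).  Near infinity,
    where the density cannot stop a collapse, the characteristics keep a distance
    proportional to that of their labels: an oscillator with small forcing
    that stays nonnegative on [0, s] cannot be small before s (oscillator_floor).
    So the characteristics cover the line, the mass is M0, the force grows at most
    linearly, and the characteristic from 0 cannot escape (trajectories_exist).
    The barycentre obeys its own linear equation, which makes the whole motion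
    explicit (flow_follows_motion).

    Conversely, if J stays positive for all labels and times, then oscillator_floor
    also bounds J from below at each time, so that the explicit motion maps the
    labels onto the line at every time.  The fields rho0 / J and dX / dt carried by
    this motion form a solution for all times (global_solution) that
    coincides with any given solution as long as the latter exists, so no maximal
    solution has a finite life span.  This solution is of class C^1 because the
    given one forces u0 to be twice differentiable (velocity_datum_C2).

    In the overdamped and critical regimes J has at most one minimum, at a time that
    solves a linear equation in exponentials (subcritical_iff,
    critical_iff).  In the underdamped regime the deepest minimum is the first
    one, at the time t* of the statement, and its depth follows from the quadratic
    form exp t (y'^2 + y y' + M0 y^2), y = J - 2 rho0 / M0, which is constant
    (supercritical_iff). *)

(** * Increments and damped oscillators *)

Ltac smooth :=
  match goal with
  | |- continuous ?f ?x =>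
      apply (@ex_derive_continuous R_AbsRing R_NormedModule f x); auto_derive; auto
  end.

Ltac ringR := apply Rminus_diag_uniq; ring.

Ltac pose_minmax :=
  repeat match goal with
  | |- context [Rmax ?x ?y] =>
      lazymatch goal with _ : x <= Rmax x y |- _ => fail | _ => pose proof (Rmax_l x y); pose proof (Rmax_r x y) end
  | _ : context [Rmax ?x ?y] |- _ =>
      lazymatch goal with _ : x <= Rmax x y |- _ => fail | _ => pose proof (Rmax_l x y); pose proof (Rmax_r x y) end
  | |- context [Rmin ?x ?y] =>
      lazymatch goal with _ : Rmin x y <= x |- _ => fail | _ => pose proof (Rmin_l x y); pose proof (Rmin_r x y) end
  | _ : context [Rmin ?x ?y] |- _ =>
      lazymatch goal with _ : Rmin x y <= x |- _ => fail | _ => pose proof (Rmin_l x y); pose proof (Rmin_r x y) end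
  end.

Ltac solve_continuous :=
  repeat first
  [ assumption | apply continuous_const | apply continuous_id
  | match goal with
    | |- continuous (fun x => @?f x + @?h x) _ => apply (continuous_plus f h)
    | |- continuous (fun x => @?f x - @?h x) _ => apply (continuous_minus f h)
    | |- continuous (fun x => @?f x * @?h x) _ => apply (continuous_mult f h)
    | |- continuous (fun x => - @?f x) _ => apply (continuous_opp f)
    end
  | solve [auto] ].

Lemma is_derive_continuous (f : R -> R) (x l : R) : is_derive f x l -> continuous f x.
Proof. intros H. apply (@ex_derive_continuous R_AbsRing R_NormedModule). now exists l. Qed.

Lemma exp_le a b : a <= b -> exp a <= exp b.
Proof. intros [H| ->]; [left; now apply exp_increasing|lra]. Qed.

Lemma increment_le (f df : R -> R) (a b k : R) :
  a <= b ->
  (forall t, a <= t <= b -> continuous f t) ->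
  (forall t, a < t < b -> is_derive f t (df t)) ->
  (forall t, a < t < b -> df t <= k) ->
  f b - f a <= k * (b - a).
Proof.
  intros Hab Hc Hd Hk.
  destruct (MVT_gen f a b
    (fun t => if Rlt_dec a t then if Rlt_dec t b then df t else k else k))
    as [c [Hc1 Hc2]].
  - rewrite Rmin_left, Rmax_right by lra; intros t Ht.
    destruct (Rlt_dec a t); [destruct (Rlt_dec t b)|]; try lra.
    now apply Hd.
  - rewrite Rmin_left, Rmax_right by lra; intros t Ht.
    apply continuity_pt_filterlim, Hc, Ht.
  - rewrite Hc2. apply Rmult_le_compat_r; [lra|].
    destruct (Rlt_dec a c); [destruct (Rlt_dec c b)|]; try lra.
    apply Hk; lra.
Qed.

Lemma increment_ge (f df : R -> R) (a b k : R) :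
  a <= b ->
  (forall t, a <= t <= b -> continuous f t) ->
  (forall t, a < t < b -> is_derive f t (df t)) ->
  (forall t, a < t < b -> k <= df t) ->
  k * (b - a) <= f b - f a.
Proof.
  intros Hab Hc Hd Hk.
  pose proof (increment_le (fun t => - f t) (fun t => - df t) a b (- k) Hab) as H.
  cut (- f b - - f a <= - k * (b - a)); [lra|].
  apply H.
  - intros t Ht. apply (continuous_opp f t), Hc, Ht.
  - intros t Ht. apply (is_derive_opp f t (df t)), Hd, Ht.
  - intros t Ht. specialize (Hk t Ht). lra.
Qed.

Lemma increment_dominated (f df G dG : R -> R) (a b : R) :
  a <= b ->
  (forall t, a <= t <= b -> continuous f t) ->
  (forall t, a <= t <= b -> continuous G t) ->
  (forall t, a < t < b -> is_derive f t (df t)) ->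
  (forall t, a < t < b -> is_derive G t (dG t)) ->
  (forall t, a < t < b -> Rabs (df t) <= dG t) ->
  Rabs (f b - f a) <= G b - G a.
Proof.
  intros Hab Cf CG Df DG Hb.
  pose proof (increment_le (fun t => f t - G t) (fun t => df t - dG t) a b 0 Hab) as H1.
  pose proof (increment_ge (fun t => f t + G t) (fun t => df t + dG t) a b 0 Hab) as H2.
  cbv beta in H1, H2. apply Rabs_le. split.
  - cut (0 * (b - a) <= f b + G b - (f a + G a)); [lra|]. apply H2.
    + intros t Ht. solve_continuous.
    + intros t Ht. apply (is_derive_plus f G); auto.
    + intros t Ht. specialize (Hb t Ht). apply Rabs_le_between in Hb. lra.
  - cut (f b - G b - (f a - G a) <= 0 * (b - a)); [lra|]. apply H1.
    + intros t Ht. solve_continuous.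
    + intros t Ht. apply (is_derive_minus f G); auto.
    + intros t Ht. specialize (Hb t Ht). apply Rabs_le_between in Hb. lra.
Qed.

Lemma increment_abs (f df : R -> R) (a b k : R) :
  a <= b ->
  (forall t, a <= t <= b -> continuous f t) ->
  (forall t, a < t < b -> is_derive f t (df t)) ->
  (forall t, a < t < b -> Rabs (df t) <= k) ->
  Rabs (f b - f a) <= k * (b - a).
Proof.
  intros Hab Hc Hd Hk. rewrite Rmult_minus_distr_l.
  apply (increment_dominated f df (fun t => k * t) (fun _ => k)); auto.
  - intros t _. smooth.
  - intros t _. auto_derive; [auto|ring].
Qed.

(** Counting r^2 as part of the energy makes the bound on the force homogeneous, so
    that the energy E satisfies |E'| <= (3 + 2 K) E and changes at most
    exponentially in both time directions. *)
Lemma oscillator_energy (z z1 F : R -> R) (K r a b : R) :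
  a <= b -> 0 <= K ->
  (forall t, a <= t <= b -> continuous z t) ->
  (forall t, a <= t <= b -> continuous z1 t) ->
  (forall t, a < t < b -> is_derive z t (z1 t)) ->
  (forall t, a < t < b -> is_derive z1 t (- z1 t + F t)) ->
  (forall t, a < t < b -> Rabs (F t) <= K * (Rabs (z t) + Rabs r)) ->
  z b ^ 2 + z1 b ^ 2 + r ^ 2
    <= (z a ^ 2 + z1 a ^ 2 + r ^ 2) * exp ((3 + 2 * K) * (b - a)) /\
  z a ^ 2 + z1 a ^ 2 + r ^ 2
    <= (z b ^ 2 + z1 b ^ 2 + r ^ 2) * exp ((3 + 2 * K) * (b - a)).
Proof.
  intros Hab HK Hz Hz1 Dz Dz1 HF.
  set (L := 3 + 2 * K).
  assert (HE : forall t, a < t < b ->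
    Rabs (2 * z t * z1 t + 2 * z1 t * (- z1 t + F t))
      <= L * (z t ^ 2 + z1 t ^ 2 + r ^ 2)).
  { intros t Ht. specialize (HF t Ht).
    assert (H1 : Rabs (z1 t * F t) <= K * (Rabs (z1 t) * (Rabs (z t) + Rabs r))).
    { rewrite Rabs_mult.
      apply Rle_trans with (Rabs (z1 t) * (K * (Rabs (z t) + Rabs r))); [|lra].
      apply Rmult_le_compat_l; [apply Rabs_pos|exact HF]. }
    assert (H2 : Rabs (z1 t) * (Rabs (z t) + Rabs r) <= z t ^ 2 + z1 t ^ 2 + r ^ 2).
    { rewrite <- (pow2_abs (z t)), <- (pow2_abs (z1 t)), <- (pow2_abs r).
      pose proof (pow2_ge_0 (Rabs (z1 t) - Rabs (z t))).
      pose proof (pow2_ge_0 (Rabs (z1 t) - Rabs r)).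
      pose proof (pow2_ge_0 (Rabs (z t))). pose proof (pow2_ge_0 (Rabs r)). nra. }
    apply Rabs_le_between in H1.
    pose proof (Rmult_le_compat_l K _ _ HK H2) as H3.
    pose proof (pow2_ge_0 (z t - z1 t)). pose proof (pow2_ge_0 (z t + z1 t)).
    pose proof (pow2_ge_0 r). pose proof (pow2_ge_0 (z t)).
    pose proof (pow2_ge_0 (z1 t)).
    apply Rabs_le. unfold L. split; nra. }
  assert (Hd : forall c t, a < t < b ->
    is_derive (fun t => (z t ^ 2 + z1 t ^ 2 + r ^ 2) * exp (c * t)) t
      ((2 * z t * z1 t + 2 * z1 t * (- z1 t + F t)
        + c * (z t ^ 2 + z1 t ^ 2 + r ^ 2)) * exp (c * t))).
  { intros c t Ht. specialize (Dz t Ht). specialize (Dz1 t Ht).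
    auto_derive.
    - repeat split; try (eexists; eassumption).
    - replace (Derive (fun x => z x) t) with (z1 t)
        by (symmetry; apply is_derive_unique, Dz).
      replace (Derive (fun x => z1 x) t) with (- z1 t + F t)
        by (symmetry; apply is_derive_unique, Dz1).
      ring. }
  assert (Hcont : forall c t, a <= t <= b ->
    continuous (fun t => (z t ^ 2 + z1 t ^ 2 + r ^ 2) * exp (c * t)) t).
  { intros c t Ht. specialize (Hz t Ht). specialize (Hz1 t Ht).
    assert (Cexp : continuous (fun t => exp (c * t)) t) by smooth.
    simpl. solve_continuous. }
  split.
  - pose proof (increment_le _ _ a b 0 Hab (Hcont (- L)) (Hd (- L))) as H.
    assert (H0 : forall t, a < t < b ->
       (2 * z t * z1 t + 2 * z1 t * (- z1 t + F t)
        + - L * (z t ^ 2 + z1 t ^ 2 + r ^ 2)) * exp (- L * t) <= 0).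
    { intros t Ht. specialize (HE t Ht). apply Rabs_le_between in HE.
      pose proof (exp_pos (- L * t)). nra. }
    specialize (H H0). clear H0.
    replace (exp (L * (b - a))) with (exp (- L * a) * / exp (- L * b)).
    2:{ rewrite <- exp_Ropp, <- exp_plus. f_equal. ring. }
    apply Rmult_le_reg_r with (exp (- L * b)); [apply exp_pos|].
    replace ((z a ^ 2 + z1 a ^ 2 + r ^ 2) * (exp (- L * a) * / exp (- L * b)) * exp (- L * b))
      with ((z a ^ 2 + z1 a ^ 2 + r ^ 2) * exp (- L * a)).
    2:{ field. apply Rgt_not_eq, exp_pos. }
    lra.
  - pose proof (increment_ge _ _ a b 0 Hab (Hcont L) (Hd L)) as H.
    assert (H0 : forall t, a < t < b -> 0 <=
       (2 * z t * z1 t + 2 * z1 t * (- z1 t + F t)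
        + L * (z t ^ 2 + z1 t ^ 2 + r ^ 2)) * exp (L * t)).
    { intros t Ht. specialize (HE t Ht). apply Rabs_le_between in HE.
      pose proof (exp_pos (L * t)). nra. }
    specialize (H H0). clear H0.
    replace (exp (L * (b - a))) with (exp (L * b) * / exp (L * a)).
    2:{ rewrite <- exp_Ropp, <- exp_plus. f_equal. ring. }
    apply Rmult_le_reg_r with (exp (L * a)); [apply exp_pos|].
    replace ((z b ^ 2 + z1 b ^ 2 + r ^ 2) * (exp (L * b) * / exp (L * a)) * exp (L * a))
      with ((z b ^ 2 + z1 b ^ 2 + r ^ 2) * exp (L * b)).
    2:{ field. apply Rgt_not_eq, exp_pos. }
    lra.
Qed.

Lemma oscillator_zero (z z1 F : R -> R) (K a b : R) :
  a <= b -> 0 <= K ->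
  (forall t, a <= t <= b -> continuous z t) ->
  (forall t, a <= t <= b -> continuous z1 t) ->
  (forall t, a < t < b -> is_derive z t (z1 t)) ->
  (forall t, a < t < b -> is_derive z1 t (- z1 t + F t)) ->
  (forall t, a < t < b -> Rabs (F t) <= K * Rabs (z t)) ->
  z a = 0 -> z1 a = 0 -> z b = 0 /\ z1 b = 0.
Proof.
  intros Hab HK Hz Hz1 Dz Dz1 HF Za Z1a.
  destruct (oscillator_energy z z1 F K 0 a b) as [H _]; auto.
  { intros t Ht. rewrite Rabs_R0, Rplus_0_r. auto. }
  rewrite Za, Z1a in H.
  assert (z b ^ 2 + z1 b ^ 2 <= 0) by (simpl in *; lra).
  pose proof (pow2_ge_0 (z b)). pose proof (pow2_ge_0 (z1 b)).
  split; apply Rsqr_eq_0; unfold Rsqr; simpl in *; lra.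
Qed.

(** If q were small at t0 then, since energy is lost at a bounded rate only and the
    forcing is small, the velocity would not be small there, and q would become
    negative shortly before or after t0 according to the sign of the velocity. *)
Lemma oscillator_floor (K B t0 s : R) :
  0 <= K -> 0 < t0 < s ->
  exists eps eta, 0 < eps /\ 0 < eta /\
  forall (q q1 F : R -> R) (r : R),
  (forall t, 0 <= t <= s -> continuous q t) ->
  (forall t, 0 <= t <= s -> continuous q1 t) ->
  (forall t, 0 < t < s -> is_derive q t (q1 t)) ->
  (forall t, 0 < t < s -> is_derive q1 t (- q1 t + F t)) ->
  (forall t, 0 < t < s -> Rabs (F t) <= K * (Rabs (q t) + Rabs r)) ->
  (forall t, 0 <= t <= s -> 0 <= q t) ->
  q 0 = 1 -> Rabs (q1 0) <= B -> Rabs r <= eta ->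
  eps <= q t0.
Proof.
  intros HK Ht0.
  set (L := 3 + 2 * K).
  (* at time t0 the energy is still at least w, and the forcing term r^2 makes up
     at most half of that *)
  set (w := exp (- (L * s))).
  assert (Hw : 0 < w) by apply exp_pos.
  assert (Hw1 : w <= 1).
  { rewrite <- exp_0. apply exp_le. unfold L. nra. }
  set (eta := w / 2).
  set (C2 := (1 + B ^ 2 + 1) * exp (L * s)).
  set (C := 1 + C2).
  assert (HC2 : 0 < C2).
  { apply Rmult_lt_0_compat; [|apply exp_pos]. pose proof (pow2_ge_0 B). lra. }
  set (A := C + K * (C + 1)).
  assert (HA : 0 < A) by (unfold A, C; nra).
  set (k := w / 2).
  assert (Hk : 0 < k <= 1 / 2) by (unfold k; lra).
  (* a velocity of size k at t0 keeps at least the size k / 2 on [t0 - h, t0 + h] *)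
  set (h := Rmin (Rmin t0 (s - t0)) (k / (2 * A)) / 2).
  assert (Hh : 0 < h /\ h < t0 /\ h < s - t0 /\ A * h <= k / 2).
  { assert (0 < k / (2 * A)) by (apply Rdiv_lt_0_compat; lra).
    assert (Hm : 0 < Rmin (Rmin t0 (s - t0)) (k / (2 * A))).
    { repeat apply Rmin_glb_lt; lra. }
    pose_minmax.
    unfold h. repeat split; try lra.
    assert (A * (k / (2 * A)) = k / 2) by (field; lra). nra. }
  destruct Hh as [h1 [h2 [h3 h4]]].
  exists (k * h / 4), eta. split; [nra|]. split; [unfold eta; lra|].
  intros q q1 F r Cq Cq1 Dq Dq1 HF Hq q0 Hq1 Hr.
  destruct (Rle_lt_dec (k * h / 4) (q t0)) as [|Hlt]; [assumption|exfalso].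
  assert (r2 : r ^ 2 <= w / 2).
  { rewrite <- pow2_abs. pose proof (Rabs_pos r). unfold eta in Hr.
    assert (Rabs r <= 1) by lra. simpl. nra. }
  assert (HEb : forall t, 0 <= t <= s -> q t ^ 2 + q1 t ^ 2 <= C2).
  { intros t Ht.
    destruct (oscillator_energy q q1 F K r 0 t) as [H _]; try lra; auto;
      try (intros; (apply Cq || apply Cq1 || apply Dq || apply Dq1 || apply HF); lra).
    rewrite q0 in H. fold L in H.
    assert (Hx : exp (L * (t - 0)) <= exp (L * s)).
    { apply exp_le. unfold L. nra. }
    assert (q1 0 ^ 2 <= B ^ 2) by (apply pow_maj_Rabs; exact Hq1).
    pose proof (exp_pos (L * (t - 0))).
    pose proof (pow2_ge_0 r). pose proof (pow2_ge_0 (q1 0)).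
    apply Rle_trans with ((1 ^ 2 + q1 0 ^ 2 + r ^ 2) * exp (L * (t - 0))); [lra|].
    unfold C2. apply Rmult_le_compat; nra. }
  assert (HE0 : 1 <= (q t0 ^ 2 + q1 t0 ^ 2 + r ^ 2) * exp (L * s)).
  { destruct (oscillator_energy q q1 F K r 0 t0) as [_ H]; try lra; auto;
      try (intros; (apply Cq || apply Cq1 || apply Dq || apply Dq1 || apply HF); lra).
    rewrite q0 in H. fold L in H.
    assert (Hx : exp (L * (t0 - 0)) <= exp (L * s)).
    { apply exp_le. unfold L. nra. }
    pose proof (pow2_ge_0 r). pose proof (pow2_ge_0 (q1 0)).
    pose proof (pow2_ge_0 (q t0)). pose proof (pow2_ge_0 (q1 t0)).
    nra. }
  assert (HE1 : w <= q t0 ^ 2 + q1 t0 ^ 2 + r ^ 2).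
  { assert (Hwe : w * exp (L * s) = 1).
    { unfold w. rewrite <- exp_plus, <- exp_0. f_equal. ring. }
    apply Rmult_le_reg_r with (exp (L * s)); [apply exp_pos|]. lra. }
  assert (Hqt : 0 <= q t0) by (apply Hq; lra).
  assert (HL : 3 <= L) by (unfold L; lra).
  assert (Hhk : h <= 1).
  { assert (1 <= A) by (unfold A, C; nra). nra. }
  assert (Hv : k <= Rabs (q1 t0)).
  { rewrite <- (Rabs_pos_eq k) by lra. apply Rsqr_le_abs_0. unfold Rsqr.
    assert (q t0 <= k / 4) by nra.
    assert (q t0 ^ 2 <= k * k / 16) by nra.
    assert (w = 2 * k) by (unfold k; lra).
    assert (k - k * k / 16 <= q1 t0 ^ 2) by lra. nra. }
  assert (Hacc : forall t, 0 < t < s -> Rabs (- q1 t + F t) <= A).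
  { intros t Ht. specialize (HEb t ltac:(lra)). specialize (HF t Ht).
    pose proof (pow2_ge_0 (q t)). pose proof (pow2_ge_0 (q1 t)).
    assert (Hb : forall x, x ^ 2 <= C2 -> Rabs x <= C).
    { intros x Hx. apply Rabs_le. unfold C. split; nra. }
    assert (Rabs (q t) <= C) by (apply Hb; lra).
    assert (Rabs (q1 t) <= C) by (apply Hb; lra).
    assert (Rabs r <= 1) by (unfold eta in Hr; lra).
    apply Rle_trans with (Rabs (- q1 t) + Rabs (F t)); [apply Rabs_triang|].
    rewrite Rabs_Ropp. unfold A. nra. }
  unfold Rabs in Hv. destruct (Rcase_abs (q1 t0)) as [Hneg|Hpos].
  - assert (Hq1b : forall t, t0 < t < t0 + h -> q1 t <= - k / 2).
    { intros t Ht.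
      pose proof (increment_le q1 (fun t => - q1 t + F t) t0 t A) as H.
      assert (q1 t - q1 t0 <= A * (t - t0)).
      { apply H; try lra; intros u Hu; [apply Cq1|apply Dq1|]; try lra.
        specialize (Hacc u ltac:(lra)). apply Rabs_le_between in Hacc. lra. }
      nra. }
    pose proof (increment_le q q1 t0 (t0 + h) (- k / 2)) as H.
    assert (q (t0 + h) - q t0 <= - k / 2 * (t0 + h - t0)).
    { apply H; try lra; intros u Hu; [apply Cq|apply Dq|apply Hq1b]; lra. }
    specialize (Hq (t0 + h) ltac:(lra)). nra.
  - assert (Hq1b : forall t, t0 - h < t < t0 -> k / 2 <= q1 t).
    { intros t Ht.
      pose proof (increment_le q1 (fun t => - q1 t + F t) t t0 A) as H.
      assert (q1 t0 - q1 t <= A * (t0 - t)).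
      { apply H; try lra; intros u Hu; [apply Cq1|apply Dq1|]; try lra.
        specialize (Hacc u ltac:(lra)). apply Rabs_le_between in Hacc. lra. }
      nra. }
    pose proof (increment_ge q q1 (t0 - h) t0 (k / 2)) as H.
    assert (k / 2 * (t0 - (t0 - h)) <= q t0 - q (t0 - h)).
    { apply H; try lra; intros u Hu; [apply Cq|apply Dq|apply Hq1b]; lra. }
    specialize (Hq (t0 - h) ltac:(lra)). nra.
Qed.

(** The times up to which phi <= k + 1 form a closed set, which is also open because
    the bound improves itself to k. *)
Lemma bootstrap_bound (phi : R -> R) (k S : R) :
  0 <= S -> (forall t, continuous phi t) -> phi 0 <= k ->
  (forall s, 0 <= s <= S -> (forall t, 0 <= t <= s -> phi t <= k + 1) ->
     phi s <= k) ->
  forall t, 0 <= t <= S -> phi t <= k.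
Proof.
  intros HS Hc H0 Hb.
  set (E := fun s => 0 <= s <= S /\ forall t, 0 <= t <= s -> phi t <= k + 1).
  destruct (completeness E) as [m [Hub Hlub]].
  { exists S. intros s [Hs _]. lra. }
  { exists 0. split; [lra|]. intros t Ht. replace t with 0 by lra. lra. }
  assert (Hm0 : 0 <= m).
  { apply Hub. split; [lra|]. intros t Ht. replace t with 0 by lra. lra. }
  assert (HmS : m <= S) by (apply Hlub; intros s [Hs _]; lra).
  assert (Hlt : forall t, 0 <= t < m -> phi t <= k + 1).
  { intros t Ht. destruct (classic (exists s, E s /\ t < s)) as [[s [[Hs1 Hs2] Hts]]|N].
    - apply Hs2; lra.
    - exfalso. assert (m <= t); [|lra]. apply Hlub. intros s Hs.
      destruct (Rle_lt_dec s t); [lra|]. exfalso. apply N. exists s. auto. }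
  assert (Hltk : forall t, 0 <= t < m -> phi t <= k).
  { intros t Ht. apply Hb; [lra|]. intros u Hu. apply Hlt. lra. }
  assert (Hnear : forall t0 e, 0 < e -> exists d, 0 < d /\
     forall t, Rabs (t - t0) < d -> Rabs (phi t - phi t0) < e).
  { intros t0 e He.
    destruct (proj1 (filterlim_locally phi (phi t0)) (Hc t0) (mkposreal e He)) as [d Hd].
    exists d. split; [apply cond_pos|]. intros t Ht. exact (Hd t Ht). }
  assert (Hm : phi m <= k).
  { destruct (Req_dec m 0) as [->|Hm]; [exact H0|].
    destruct (Rle_lt_dec (phi m) k) as [|Hgt]; [assumption|exfalso].
    destruct (Hnear m (phi m - k)) as [d [Hd1 Hd2]]; [lra|].
    set (t := Rmax 0 (m - d / 2)).
    assert (Ht : 0 <= t < m /\ m - d / 2 <= t).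
    { unfold t. split; [split; [apply Rmax_l|apply Rmax_lub_lt; lra]|apply Rmax_r]. }
    specialize (Hd2 t). rewrite Rabs_left1 in Hd2 by lra.
    specialize (Hd2 ltac:(lra)). apply Rabs_def2 in Hd2.
    specialize (Hltk t ltac:(lra)). lra. }
  assert (m = S) as ->.
  { apply Rle_antisym; [exact HmS|]. apply Rnot_lt_le. intros HmS'.
    destruct (Hnear m 1 Rlt_0_1) as [d [Hd1 Hd2]].
    set (s := Rmin S (m + d / 2)).
    assert (Hs : m < s <= S /\ s <= m + d / 2).
    { unfold s. split; [split; [apply Rmin_glb_lt; lra|apply Rmin_l]|apply Rmin_r]. }
    assert (E s); [|assert (s <= m) by (now apply Hub); lra].
    split; [lra|]. intros t Ht. destruct (Rlt_le_dec t m) as [Hl|Hg].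
    - apply Hlt; lra.
    - specialize (Hd2 t). rewrite Rabs_pos_eq in Hd2 by lra.
      specialize (Hd2 ltac:(lra)). apply Rabs_def2 in Hd2. lra. }
  intros t Ht. destruct (Req_dec t S) as [->|]; [exact Hm|]. apply Hltk. lra.
Qed.

(** * Functions of space and time *)

Definition cts2 (f : R -> R -> R) : Prop :=
  forall x t, continuous (fun p : R * R => f (fst p) (snd p)) (x, t).

Lemma continuous_along (f : R -> R -> R) (a b : R -> R) (t : R) :
  continuous (fun p : R * R => f (fst p) (snd p)) (a t, b t) ->
  continuous a t -> continuous b t -> continuous (fun s => f (a s) (b s)) t.
Proof. intros Hf Ha Hb. exact (continuous_comp_2 a b f t Ha Hb Hf). Qed.

Lemma cts2_l (f : R -> R -> R) (t x : R) : cts2 f -> continuous (fun y => f y t) x.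
Proof.
  intros Hf. apply (continuous_along f (fun y => y) (fun _ => t)); auto.
  - apply continuous_id.
  - apply continuous_const.
Qed.

Lemma cts2_r (f : R -> R -> R) (x t : R) : cts2 f -> continuous (fun s => f x s) t.
Proof.
  intros Hf. apply (continuous_along f (fun _ => x) (fun y => y)); auto.
  - apply continuous_const.
  - apply continuous_id.
Qed.

Lemma cts2_fst f : (forall x, continuous f x) -> cts2 (fun x _ => f x).
Proof. intros Hf x t. apply (continuous_comp fst f); [apply continuous_fst|apply Hf]. Qed.

Lemma cts2_snd f : (forall x, continuous f x) -> cts2 (fun _ t => f t).
Proof. intros Hf x t. apply (continuous_comp snd f); [apply continuous_snd|apply Hf]. Qed.

Lemma cts2_const k : cts2 (fun _ _ => k).
Proof. intros x t. apply continuous_const. Qed.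

Lemma cts2_plus f h : cts2 f -> cts2 h -> cts2 (fun x t => f x t + h x t).
Proof.
  intros Hf Hh x t.
  apply (continuous_plus (fun p : R * R => f (fst p) (snd p)) (fun p : R * R => h (fst p) (snd p))); auto.
Qed.

Lemma cts2_minus f h : cts2 f -> cts2 h -> cts2 (fun x t => f x t - h x t).
Proof.
  intros Hf Hh x t.
  apply (continuous_minus (fun p : R * R => f (fst p) (snd p)) (fun p : R * R => h (fst p) (snd p))); auto.
Qed.

Lemma cts2_opp f : cts2 f -> cts2 (fun x t => - f x t).
Proof.
  intros Hf x t. apply (continuous_opp (fun p : R * R => f (fst p) (snd p))); auto.
Qed.

Lemma cts2_mult f h : cts2 f -> cts2 h -> cts2 (fun x t => f x t * h x t).
Proof.
  intros Hf Hh x t.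
  apply (continuous_mult (fun p : R * R => f (fst p) (snd p)) (fun p : R * R => h (fst p) (snd p))); auto.
Qed.

Ltac solve_cts2 :=
  repeat first
  [ assumption | apply cts2_const
  | match goal with
    | |- cts2 (fun x _ => @?f x) => apply (cts2_fst f); intros; solve [solve_continuous | smooth]
    | |- cts2 (fun _ t => @?f t) => apply (cts2_snd f); intros; solve [solve_continuous | smooth]
    | |- cts2 (fun x t => @?f x t + @?h x t) => apply (cts2_plus f h)
    | |- cts2 (fun x t => @?f x t - @?h x t) => apply (cts2_minus f h)
    | |- cts2 (fun x t => @?f x t * @?h x t) => apply (cts2_mult f h)
    | |- cts2 (fun x t => - @?f x t) => apply (cts2_opp f)
    end
  | solve [auto] ].

Lemma cts2_uniform (f : R -> R -> R) (N e : R) : cts2 f -> 0 < e ->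
  exists d, 0 < d /\ forall x t y s, Rabs x <= N -> Rabs t <= N ->
    Rabs y <= N -> Rabs s <= N -> Rabs (y - x) < d -> Rabs (s - t) < d ->
    Rabs (f y s - f x t) < e.
Proof.
  intros Hf He.
  destruct (uniform_continuity_2d f (- N) N (- N) N) with (eps := mkposreal e He)
    as [d Hd].
  { intros x t _ _. apply continuity_2d_pt_filterlim. exact (Hf x t). }
  exists d. split; [apply cond_pos|].
  intros x t y s H1 H2 H3 H4 H5 H6.
  apply Rabs_le_between in H1, H2, H3, H4. now apply Hd.
Qed.

Lemma cts2_bounded (f : R -> R -> R) (N : R) : cts2 f ->
  exists B, 0 <= B /\ forall x t, Rabs x <= N -> Rabs t <= N -> Rabs (f x t) <= B.
Proof.
  intros Hf. destruct (cts2_uniform f N 1 Hf Rlt_0_1) as [d [Hd1 Hd2]].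
  destruct (nfloor_ex (Rmax 0 (N / d))) as [n Hn]; [apply Rmax_l|].
  set (m := INR (S n)).
  assert (Hm : 0 < m) by (unfold m; apply lt_0_INR; lia).
  assert (HNm : N < d * m).
  { assert (N / d < m) by (unfold m; rewrite S_INR; pose proof (Rmax_r 0 (N / d)); lra).
    replace N with (d * (N / d)) by (field; lra). apply Rmult_lt_compat_l; lra. }
  exists (Rabs (f 0 0) + m). split; [pose proof (Rabs_pos (f 0 0)); lra|].
  intros x t Hx Ht.
  (* a chain of n + 1 short steps along the segment from the origin *)
  assert (Hk : forall k, (k <= S n)%nat ->
    Rabs (f (INR k / m * x) (INR k / m * t)) <= Rabs (f 0 0) + INR k).
  { induction k as [|k IH]; intros Hk.
    - simpl. unfold Rdiv. rewrite !Rmult_0_l. lra.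
    - specialize (IH ltac:(lia)).
      assert (Hle : forall j, (j <= S n)%nat -> 0 <= INR j / m <= 1).
      { intros j Hj. split.
        - apply Rdiv_le_0_compat; [apply pos_INR|exact Hm].
        - apply Rmult_le_reg_r with m; [exact Hm|]. unfold Rdiv.
          rewrite Rmult_assoc, Rinv_l, Rmult_1_r, Rmult_1_l by lra.
          apply le_INR, Hj. }
      assert (Hin : forall j z, (j <= S n)%nat -> Rabs z <= N -> Rabs (INR j / m * z) <= N).
      { intros j z Hj Hz. specialize (Hle j Hj). rewrite Rabs_mult, (Rabs_pos_eq (INR j / m)) by lra.
        pose proof (Rabs_pos z). nra. }
      assert (Hst : forall z, Rabs z <= N -> Rabs (INR (S k) / m * z - INR k / m * z) < d).
      { intros z Hz. rewrite S_INR. replace ((INR k + 1) / m * z - INR k / m * z) with (z / m) by (field; lra).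
        unfold Rdiv. rewrite Rabs_mult, (Rabs_pos_eq (/ m)) by (left; now apply Rinv_0_lt_compat).
        apply Rmult_lt_reg_r with m; [exact Hm|]. rewrite Rmult_assoc, Rinv_l; lra. }
      specialize (Hd2 (INR k / m * x) (INR k / m * t) (INR (S k) / m * x) (INR (S k) / m * t)
        (Hin k x ltac:(lia) Hx) (Hin k t ltac:(lia) Ht) (Hin (S k) x Hk Hx) (Hin (S k) t Hk Ht)
        (Hst x Hx) (Hst t Ht)).
      pose proof (Rabs_triang_inv (f (INR (S k) / m * x) (INR (S k) / m * t))
         (f (INR k / m * x) (INR k / m * t))).
      rewrite (S_INR k) at 3. lra. }
  specialize (Hk (S n) (le_n _)). fold m in Hk.
  replace (m / m) with 1 in Hk by (field; lra). now rewrite !Rmult_1_l in Hk.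
Qed.

(** One continuous partial derivative and the existence of the other make f
    differentiable at the point. *)
Lemma is_derive_along (f fx : R -> R -> R) (X : R -> R) (lo hi t ft dX : R) :
  lo < t < hi ->
  (forall y s, lo < s < hi -> is_derive (fun z => f z s) y (fx y s)) ->
  continuous (fun p : R * R => fx (fst p) (snd p)) (X t, t) ->
  is_derive (fun s => f (X t) s) t ft ->
  is_derive X t dX ->
  is_derive (fun s => f (X s) s) t (fx (X t) t * dX + ft).
Proof.
  intros Ht Hx Hc Hft HX.
  assert (Hd : 0 < Rmin (t - lo) (hi - t)) by (apply Rmin_glb_lt; lra).
  assert (Hdiff : differentiable_pt_lim f (X t) t (fx (X t) t) ft).
  { apply filterdiff_differentiable_pt_lim.
    eapply filterdiff_ext_lin.
    - apply (is_derive_filterdiff f (X t) t fx ft).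
      + exists (mkposreal _ Hd). intros [y s] [_ Hs]. simpl.
        apply Hx. change (Rabs (s - t) < Rmin (t - lo) (hi - t)) in Hs.
        pose_minmax.
        apply Rabs_def2 in Hs. lra.
      + exact Hft.
      + exact Hc.
    - intros [y s]. simpl. unfold plus, scal, mult; simpl. unfold mult; simpl. ring. }
  apply is_derive_Reals in HX. apply is_derive_Reals.
  replace (fx (X t) t * dX + ft) with (fx (X t) t * dX + ft * 1) by ring.
  apply (derivable_pt_lim_comp_2d f X (fun s => s)); [exact Hdiff|exact HX|].
  apply derivable_pt_lim_id.
Qed.

Lemma cts2_ex_RInt (f : R -> R -> R) (t a b : R) : cts2 f -> ex_RInt (fun y => f y t) a b.
Proof. intros Hf. apply (@ex_RInt_continuous R_CompleteNormedModule). intros. now apply cts2_l. Qed.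

Lemma abs_RInt_le_bound (f : R -> R) (a b k : R) :
  (forall x, continuous f x) ->
  (forall x, Rmin a b <= x <= Rmax a b -> Rabs (f x) <= k) ->
  Rabs (RInt f a b) <= k * Rabs (b - a).
Proof.
  intros Hf Hk.
  assert (Hex : forall a b, ex_RInt f a b).
  { intros. apply (@ex_RInt_continuous R_CompleteNormedModule). auto. }
  destruct (Rle_dec a b) as [H|H].
  - rewrite Rmin_left, Rmax_right in Hk by lra.
    rewrite (Rabs_pos_eq (b - a)), Rmult_comm by lra. now apply abs_RInt_le_const.
  - rewrite Rmin_right, Rmax_left in Hk by lra.
    replace (Rabs (RInt f a b)) with (Rabs (RInt f b a)).
    2:{ rewrite <- (opp_RInt_swap f) by auto. apply Rabs_Ropp. }
    rewrite (Rabs_left1 (b - a)), Rmult_comm by lra.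
    replace (- (b - a)) with (a - b) by ring. apply abs_RInt_le_const; auto; lra.
Qed.

Lemma cts2_RInt (f : R -> R -> R) : cts2 f -> cts2 (fun x t => RInt (fun y => f y t) 0 x).
Proof.
  intros Hf x t. apply filterlim_locally. intros e. simpl.
  set (N := Rabs x + Rabs t + 1).
  destruct (cts2_bounded f N Hf) as [B [HB0 HB]].
  assert (He1 : 0 < e / 2 / (Rabs x + 1)).
  { pose proof (Rabs_pos x). pose proof (cond_pos e). apply Rdiv_lt_0_compat; lra. }
  destruct (cts2_uniform f N _ Hf He1) as [d [Hd1 Hd2]].
  assert (Hd : 0 < Rmin (Rmin 1 d) (e / 2 / (B + 1))).
  { pose proof (cond_pos e). repeat apply Rmin_glb_lt; try lra. apply Rdiv_lt_0_compat; lra. }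
  exists (mkposreal _ Hd). intros [y s] [H1 H2]. simpl in H1, H2 |- *.
  change (Rabs (y - x) < Rmin (Rmin 1 d) (e / 2 / (B + 1))) in H1.
  change (Rabs (s - t) < Rmin (Rmin 1 d) (e / 2 / (B + 1))) in H2.
  pose_minmax.
  change (Rabs (RInt (fun y => f y s) 0 y - RInt (fun y => f y t) 0 x) < e).
  assert (Hs : Rabs s <= N) by (unfold N; pose proof (Rabs_triang_inv s t); pose proof (Rabs_pos x); lra).
  assert (Ht : Rabs t <= N) by (unfold N; pose proof (Rabs_pos x); lra).
  assert (Hy : Rabs y <= N) by (unfold N; pose proof (Rabs_triang_inv y x); pose proof (Rabs_pos t); lra).
  assert (Hx : Rabs x <= N) by (unfold N; pose proof (Rabs_pos t); lra).
  assert (Hbtw : forall a b z, Rmin a b <= z <= Rmax a b -> Rabs a <= N -> Rabs b <= N -> Rabs z <= N).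
  { intros a b z Hz Ha Hb. apply Rabs_le. apply Rabs_le_between in Ha, Hb.
    revert Hz. unfold Rmin, Rmax. destruct (Rle_dec a b); lra. }
  assert (HN0 : Rabs 0 <= N) by (rewrite Rabs_R0; pose proof (Rabs_pos t); lra).
  assert (Hdec : RInt (fun y => f y s) 0 y - RInt (fun y => f y t) 0 x
     = RInt (fun z => f z s) x y + RInt (fun z => f z s - f z t) 0 x).
  { rewrite <- (RInt_Chasles (fun z => f z s) 0 x y) by now apply cts2_ex_RInt.
    rewrite (RInt_minus (fun z => f z s) (fun z => f z t)) by now apply cts2_ex_RInt.
    unfold plus, minus, plus, opp; simpl. ring. }
  rewrite Hdec.
  assert (G1 : Rabs (RInt (fun z => f z s) x y) <= B * Rabs (y - x)).
  { apply abs_RInt_le_bound; [intros; now apply cts2_l|]. intros z Hz. apply HB; [|assumption].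
    now apply (Hbtw x y). }
  assert (G2 : Rabs (RInt (fun z => f z s - f z t) 0 x) <= e / 2 / (Rabs x + 1) * Rabs (x - 0)).
  { apply abs_RInt_le_bound.
    - intros z. apply (continuous_minus (fun z => f z s) (fun z => f z t)); now apply cts2_l.
    - intros z Hz. left. apply Hd2; auto; try (now apply (Hbtw 0 x)); try lra.
      rewrite Rminus_diag. now rewrite Rabs_R0. }
  rewrite Rminus_0_r in G2.
  assert (G3 : B * Rabs (y - x) <= (e / 2 / (B + 1)) * B).
  { rewrite Rmult_comm. apply Rmult_le_compat_r; lra. }
  assert (G4 : (e / 2 / (B + 1)) * B < e / 2).
  { assert (e / 2 / (B + 1) * (B + 1) = e / 2) by (field; lra).
    assert (0 < e / 2 / (B + 1)) by (pose proof (cond_pos e); apply Rdiv_lt_0_compat; lra). nra. }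
  assert (G5 : e / 2 / (Rabs x + 1) * Rabs x < e / 2).
  { assert (e / 2 / (Rabs x + 1) * (Rabs x + 1) = e / 2) by (field; pose proof (Rabs_pos x); lra). nra. }
  pose proof (Rabs_triang (RInt (fun z => f z s) x y) (RInt (fun z => f z s - f z t) 0 x)).
  lra.
Qed.

Lemma is_derive_RInt_time (f ft : R -> R -> R) (lo hi t x : R) :
  cts2 f -> cts2 ft -> lo < t < hi ->
  (forall y s, lo < s < hi -> is_derive (fun s => f y s) s (ft y s)) ->
  is_derive (fun s => RInt (fun y => f y s) 0 x) t (RInt (fun y => ft y t) 0 x).
Proof.
  intros Hf Hft Ht Hd.
  assert (He : 0 < Rmin (t - lo) (hi - t)) by (apply Rmin_glb_lt; lra).
  assert (Hnear : forall s, Rabs (s - t) < Rmin (t - lo) (hi - t) -> lo < s < hi).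
  { intros s Hs. pose_minmax.
    apply Rabs_def2 in Hs. lra. }
  replace (RInt (fun y => ft y t) 0 x)
    with (RInt (fun y => Derive (fun s => f y s) t) 0 x).
  2:{ apply RInt_ext. intros y _. apply is_derive_unique, Hd, Ht. }
  apply (is_derive_RInt_param (fun s y => f y s)).
  - exists (mkposreal _ He). intros s Hs y _. exists (ft y s). apply Hd, Hnear, Hs.
  - intros y _. apply continuity_2d_pt_ext_loc with (f := fun u v => ft v u).
    + exists (mkposreal _ He). intros u v Hu _. symmetry. apply is_derive_unique, Hd, Hnear, Hu.
    + apply continuity_2d_pt_filterlim.
      apply (continuous_comp_2 (fun p : R * R => snd p) (fun p : R * R => fst p) ft (t, y)).
      * apply continuous_snd.
      * apply continuous_fst.
      * apply Hft.
  - exists (mkposreal _ He). intros s _. now apply cts2_ex_RInt.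
Qed.

(** * Trajectories of a velocity field *)

Definition clamp (a b t : R) : R := Rmax a (Rmin b t).

Lemma clamp_in (a b t : R) : a <= b -> a <= clamp a b t <= b.
Proof.
  intros H. unfold clamp. split; [apply Rmax_l|]. apply Rmax_lub; [exact H|apply Rmin_l].
Qed.

Lemma clamp_id (a b t : R) : a <= t <= b -> clamp a b t = t.
Proof. intros H. unfold clamp. rewrite Rmin_right, Rmax_right; lra. Qed.

Lemma clamp_lipschitz (a b s t : R) : Rabs (clamp a b s - clamp a b t) <= Rabs (s - t).
Proof.
  unfold clamp, Rmax, Rmin, Rabs.
  destruct (Rle_dec b s), (Rle_dec b t);
  repeat match goal with |- context [Rle_dec ?x ?y] => destruct (Rle_dec x y) end;
  repeat match goal with |- context [Rcase_abs ?x] => destruct (Rcase_abs x) end; lra.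
Qed.

Lemma clamp_continuous (a b t : R) : continuous (clamp a b) t.
Proof.
  apply filterlim_locally. intros e. exists e. intros s Hs.
  change (Rabs (clamp a b s - clamp a b t) < e).
  eapply Rle_lt_trans; [apply clamp_lipschitz|exact Hs].
Qed.

Lemma is_derive_primitive (f : R -> R) (a t : R) :
  (forall s, continuous f s) -> is_derive (fun t => RInt f a t) t (f t).
Proof.
  intros Hf. apply (is_derive_RInt f _ a); [|apply Hf].
  exists (mkposreal 1 Rlt_0_1). intros s _.
  apply (@RInt_correct R_CompleteNormedModule), (@ex_RInt_continuous R_CompleteNormedModule). auto.
Qed.

Lemma primitive_continuous (f : R -> R) (a t : R) :
  (forall s, continuous f s) -> continuous (fun t => RInt f a t) t.
Proof.
  intros Hf. apply (@ex_derive_continuous R_AbsRing R_NormedModule).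
  exists (f t). now apply is_derive_primitive.
Qed.

(** Freezing time outside [0, S] makes every iterate a continuous function on the
    whole line. *)
Definition picard_step (v : R -> R -> R) (S x0 : R) (X : R -> R) (t : R) : R :=
  x0 + RInt (fun s => v (X s) s) 0 (clamp 0 S t).

Lemma picard_step_continuous v S x0 X t : cts2 v -> (forall s, continuous X s) ->
  continuous (picard_step v S x0 X) t.
Proof.
  intros Hv HX. unfold picard_step.
  solve_continuous.
  apply (continuous_comp (clamp 0 S) (fun t => RInt (fun s => v (X s) s) 0 t)).
  - apply clamp_continuous.
  - apply primitive_continuous. intros s. apply continuous_along; auto. apply continuous_id.
Qed.

Lemma picard_step_derive v S x0 X t : cts2 v -> (forall s, continuous X s) -> 0 < t < S ->
  is_derive (picard_step v S x0 X) t (v (X t) t).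
Proof.
  intros Hv HX Ht. unfold picard_step.
  apply (is_derive_ext_loc (fun t => x0 + RInt (fun s => v (X s) s) 0 t)).
  - assert (He : 0 < Rmin t (S - t)) by (apply Rmin_glb_lt; lra).
    exists (mkposreal _ He). intros s Hs. change (Rabs (s - t) < Rmin t (S - t)) in Hs.
    pose_minmax. apply Rabs_def2 in Hs.
    rewrite clamp_id; [reflexivity|lra].
  - replace (v (X t) t) with (0 + v (X t) t) by ring.
    apply (is_derive_plus (fun _ => x0)); [apply @is_derive_const|].
    apply (is_derive_primitive (fun s => v (X s) s)).
    intros s. apply continuous_along; auto. apply continuous_id.
Qed.

Lemma picard_step_clamp v S x0 X t : 0 <= S ->
  picard_step v S x0 X (clamp 0 S t) = picard_step v S x0 X t.
Proof.
  intros HS. unfold picard_step. rewrite (clamp_id 0 S (clamp 0 S t)); [reflexivity|].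
  now apply clamp_in.
Qed.

(** The factor 1/2 comes from the weight exp (2 L t), whose primitive gains 1 / (2 L). *)
Lemma picard_step_contracts (v : R -> R -> R) (L S x0 c : R) (X Y : R -> R) :
  cts2 v -> 0 <= c ->
  (forall x y t, 0 < t < S -> Rabs (v x t - v y t) <= L * Rabs (x - y)) ->
  (forall t, continuous X t) -> (forall t, continuous Y t) -> 0 <= L ->
  (forall t, 0 <= t <= S -> Rabs (X t - Y t) <= c * exp (2 * L * t)) ->
  forall t, 0 <= t <= S ->
    Rabs (picard_step v S x0 X t - picard_step v S x0 Y t) <= c / 2 * exp (2 * L * t).
Proof.
  intros Hv Hc Hlip CX CY HL HXY t Ht.
  set (d := fun t => picard_step v S x0 X t - picard_step v S x0 Y t).
  set (G := fun t => c / 2 * exp (2 * L * t)).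
  assert (DG : forall s, is_derive G s (c * L * exp (2 * L * s))).
  { intros s. unfold G. auto_derive; [auto|]. field. }
  assert (d0 : d 0 = 0).
  { unfold d, picard_step. rewrite clamp_id, !RInt_point by lra. ring. }
  assert (G0 : 0 <= G 0) by (unfold G; pose proof (exp_pos (2 * L * 0)); nra).
  assert (H : Rabs (d t - d 0) <= G t - G 0).
  { apply (increment_dominated d (fun s => v (X s) s - v (Y s) s) G
      (fun s => c * L * exp (2 * L * s))); [lra| | | | |].
    - intros s _. apply (continuous_minus (picard_step v S x0 X) (picard_step v S x0 Y));
        now apply picard_step_continuous.
    - intros s _. eapply is_derive_continuous, DG.
    - intros s Hs. apply (is_derive_minus (picard_step v S x0 X) (picard_step v S x0 Y));
        apply picard_step_derive; auto; lra.
    - intros s _. apply DG.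
    - intros s Hs. eapply Rle_trans; [apply Hlip; lra|].
      specialize (HXY s ltac:(lra)). nra. }
  rewrite d0, Rminus_0_r in H. change (Rabs (d t) <= G t). lra.
Qed.

(** Successive approximations converge geometrically, at the rate 1/2, in the norm
    weighted by exp (2 L t). *)
Lemma picard_lindelof (v : R -> R -> R) (V L S x0 : R) :
  cts2 v -> 1 <= L -> 0 < S ->
  (forall x t, 0 < t < S -> Rabs (v x t) <= V) ->
  (forall x y t, 0 < t < S -> Rabs (v x t - v y t) <= L * Rabs (x - y)) ->
  exists X : R -> R, X 0 = x0 /\ (forall t, continuous X t) /\
    forall t, 0 < t < S -> is_derive X t (v (X t) t).
Proof.
  intros Hv HL HS HV Hlip.
  assert (HV0 : 0 <= V).
  { eapply Rle_trans; [apply Rabs_pos|apply (HV 0 (S / 2))]; lra. }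
  assert (p2 : forall n, 0 < 2 ^ n) by (intros; apply pow_lt; lra).
  set (P := picard_step v S x0).
  set (X := fix X n := match n with O => fun _ => x0 | Datatypes.S n => P (X n) end : R -> R).
  assert (XS : forall n, X (Datatypes.S n) = P (X n)) by reflexivity.
  assert (Cx : forall n t, continuous (X n) t).
  { induction n as [|n IH]; intros t; [apply continuous_const|].
    rewrite XS. now apply picard_step_continuous. }
  assert (P0 : forall Y, P Y 0 = x0).
  { intros Y. unfold P, picard_step. rewrite clamp_id by lra. rewrite RInt_point. apply Rplus_0_r. }
  assert (Hstep : forall n t, 0 <= t <= S ->
    Rabs (X (Datatypes.S n) t - X n t) <= V / 2 ^ n * exp (2 * L * t)).
  { induction n as [|n IH]; intros t Ht.
    - rewrite XS. replace (X 0%nat t) with (P (X 0%nat) 0) by apply P0.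
      assert (H : Rabs (P (X 0%nat) t - P (X 0%nat) 0) <= V * (t - 0)).
      { apply (increment_abs _ (fun t => v (X 0%nat t) t)); try lra.
        - intros s _. now apply picard_step_continuous.
        - intros s Hs. apply picard_step_derive; auto. lra.
        - intros s Hs. apply HV. lra. }
      replace (V / 2 ^ 0) with V by (simpl; field).
      assert (t <= exp (2 * L * t)) by (pose proof (exp_ineq1_le (2 * L * t)); nra).
      nra.
    - replace (V / 2 ^ Datatypes.S n) with (V / 2 ^ n / 2) by (simpl; field; apply Rgt_not_eq, p2).
      rewrite !XS. apply (picard_step_contracts v L S x0 (V / 2 ^ n)); auto; try lra.
      + now apply Rdiv_le_0_compat.
      + intros s. now apply picard_step_continuous. }
  set (K := 2 * (V * exp (2 * L * S))).
  assert (HK : 0 <= K) by (unfold K; pose proof (exp_pos (2 * L * S)); nra).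
  assert (Xcl : forall n t, X n t = X n (clamp 0 S t)).
  { intros [|n] t; [reflexivity|]. rewrite XS. unfold P. rewrite picard_step_clamp; [auto|lra]. }
  assert (Hcau : forall p n t, Rabs (X (n + p)%nat t - X n t) <= K / 2 ^ n - K / 2 ^ (n + p)).
  { induction p as [|p IH]; intros n t.
    - rewrite Nat.add_0_r, Rminus_diag, Rabs_R0. lra.
    - specialize (IH n t). rewrite Nat.add_succ_r.
      assert (H : Rabs (X (Datatypes.S (n + p)) t - X (n + p)%nat t) <= K / 2 / 2 ^ (n + p)).
      { rewrite (Xcl (Datatypes.S (n + p))), (Xcl (n + p)%nat).
        pose proof (clamp_in 0 S t ltac:(lra)) as Hc.
        eapply Rle_trans; [apply Hstep, Hc|]. unfold K.
        assert (exp (2 * L * clamp 0 S t) <= exp (2 * L * S)).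
        { apply exp_le. nra. }
        assert (0 <= V / 2 ^ (n + p)) by (apply Rdiv_le_0_compat; auto).
        replace (2 * (V * exp (2 * L * S)) / 2 / 2 ^ (n + p))
          with (V / 2 ^ (n + p) * exp (2 * L * S)) by (field; apply Rgt_not_eq, p2).
        apply Rmult_le_compat_l; assumption. }
      replace (X (Datatypes.S (n + p)) t - X n t)
        with ((X (Datatypes.S (n + p)) t - X (n + p)%nat t) + (X (n + p)%nat t - X n t)) by ring.
      eapply Rle_trans; [apply Rabs_triang|].
      replace (K / 2 ^ Datatypes.S (n + p)) with (K / 2 / 2 ^ (n + p))
        by (simpl; field; apply Rgt_not_eq, p2).
      replace (K / 2 / 2 ^ (n + p)) with (K / 2 ^ (n + p) - K / 2 / 2 ^ (n + p)) at 2
        by (field; apply Rgt_not_eq, p2).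
      lra. }
  assert (Hcau' : forall p n t, (n <= p)%nat -> Rabs (X p t - X n t) <= K / 2 ^ n).
  { intros p n t Hn. replace p with (n + (p - n))%nat by lia.
    eapply Rle_trans; [apply Hcau|].
    assert (0 <= K / 2 ^ (n + (p - n))) by (apply Rdiv_le_0_compat; auto). lra. }
  assert (Hsmall : forall C e, 0 < e -> exists n, C / 2 ^ n < e).
  { intros C e He.
    pose proof (is_lim_seq_geom (/ 2)) as Hg.
    rewrite Rabs_pos_eq in Hg by lra. specialize (Hg ltac:(lra)).
    assert (He' : 0 < e / (Rabs C + 1)) by (pose proof (Rabs_pos C); apply Rdiv_lt_0_compat; lra).
    apply is_lim_seq_spec in Hg. destruct (Hg (mkposreal _ He')) as [n Hn].
    specialize (Hn n (le_n n)). simpl in Hn.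
    assert (0 < (/ 2) ^ n) by (apply pow_lt; lra).
    rewrite Rminus_0_r, Rabs_pos_eq in Hn by lra.
    exists n. unfold Rdiv at 1. rewrite <- pow_inv.
    pose proof (Rle_abs C). pose proof (Rabs_pos C).
    assert (e / (Rabs C + 1) * (Rabs C + 1) = e) by (field; lra). nra. }
  assert (Hlim : forall t, ex_finite_lim_seq (fun n => X n t)).
  { intros t. apply ex_lim_seq_cauchy_corr. intros e.
    destruct (Hsmall (2 * K) e (cond_pos e)) as [N HN].
    exists N. intros n m Hn Hm.
    pose proof (Hcau' n N t Hn) as H1. pose proof (Hcau' m N t Hm) as H2.
    replace (X n t - X m t) with ((X n t - X N t) - (X m t - X N t)) by ring.
    eapply Rle_lt_trans; [apply Rabs_triang|]. rewrite Rabs_Ropp.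
    replace (2 * K / 2 ^ N) with (K / 2 ^ N + K / 2 ^ N) in HN by (field; apply Rgt_not_eq, p2).
    lra. }
  set (Y := fun t => real (Lim_seq (fun n => X n t))).
  assert (HY : forall n t, Rabs (Y t - X n t) <= K / 2 ^ n).
  { intros n t. pose proof (Lim_seq_correct' _ (Hlim t)) as Hl. fold (Y t) in Hl.
    assert (Hl2 : is_lim_seq (fun m => Rabs (X m t - X n t)) (Rabs (Y t - X n t))).
    { apply (is_lim_seq_abs _ (Finite (Y t - X n t))).
      apply is_lim_seq_minus'; [exact Hl|apply is_lim_seq_const]. }
    apply (is_lim_seq_le_loc (fun m => Rabs (X m t - X n t)) (fun _ => K / 2 ^ n)
             (Rabs (Y t - X n t)) (K / 2 ^ n));
      [|exact Hl2|apply is_lim_seq_const].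
    exists n. intros m Hm. now apply Hcau'. }
  assert (CY : forall t, continuous Y t).
  { intros t. apply filterlim_locally. intros e.
    destruct (Hsmall (3 * K) e (cond_pos e)) as [n Hn].
    assert (He3 : 0 < e / 3) by (pose proof (cond_pos e); lra).
    destruct (proj1 (filterlim_locally (X n) (X n t)) (Cx n t) (mkposreal _ He3)) as [d Hd].
    exists d. intros s Hs. specialize (Hd s Hs).
    change (Rabs (X n s - X n t) < e / 3) in Hd. change (Rabs (Y s - Y t) < e).
    pose proof (HY n s) as H1. pose proof (HY n t) as H2.
    replace (3 * K / 2 ^ n) with (3 * (K / 2 ^ n)) in Hn by (field; apply Rgt_not_eq, p2).
    apply Rabs_le_between in H1, H2. apply Rabs_def2 in Hd. apply Rabs_def1; lra. }
  assert (HYP : forall t, Y t = P Y t).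
  { intros t. apply Rminus_diag_uniq, Rabs_eq_0, Rle_antisym; [|apply Rabs_pos].
    apply Rnot_lt_le. intros Hpos.
    set (e := exp (2 * L * S)) in *.
    destruct (Hsmall (K + K * e) _ Hpos) as [n Hn].
    assert (Hkn : 0 <= K / 2 ^ n) by (apply Rdiv_le_0_compat; auto).
    assert (H1 : Rabs (P Y t - P (X n) t) <= K / 2 ^ n / 2 * e).
    { unfold P. rewrite <- (picard_step_clamp v S x0 Y), <- (picard_step_clamp v S x0 (X n)) by lra.
      pose proof (clamp_in 0 S t ltac:(lra)) as Hc.
      eapply Rle_trans; [apply (picard_step_contracts v L S x0 (K / 2 ^ n)); auto; try lra|].
      - intros s Hs. eapply Rle_trans; [apply HY|].
        rewrite <- (Rmult_1_r (K / 2 ^ n)) at 1. apply Rmult_le_compat_l; [exact Hkn|].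
        rewrite <- exp_0. apply exp_le. nra.
      - apply Rmult_le_compat_l; [lra|]. apply exp_le. nra. }
    pose proof (HY (Datatypes.S n) t) as H2. rewrite XS in H2.
    replace (K / 2 ^ Datatypes.S n) with (K / 2 ^ n / 2) in H2 by (simpl; field; apply Rgt_not_eq, p2).
    replace ((K + K * e) / 2 ^ n) with (K / 2 ^ n + K / 2 ^ n * e) in Hn
      by (field; apply Rgt_not_eq, p2).
    assert (0 < e) by apply exp_pos.
    apply Rabs_le_between in H1, H2.
    assert (0 <= K / 2 ^ n * e) by nra.
    assert (Rabs (Y t - P Y t) <= K / 2 ^ n + K / 2 ^ n * e) by (apply Rabs_le; lra).
    lra. }
  exists Y. split; [rewrite HYP; apply P0|]. split; [exact CY|].
  intros t Ht. apply (is_derive_ext (P Y)); [intros; symmetry; apply HYP|].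
  now apply picard_step_derive.
Qed.

Set Implicit Arguments.

(** The derivative is prescribed at interior times only, because a solution has
    time derivatives only there; continuity settles the endpoints. *)
Record trajectory (u : R -> R -> R) (x s : R) (X : R -> R) : Prop := {
  traj_start : X 0 = x;
  traj_continuous : forall t, continuous X t;
  traj_derive : forall t, 0 < t < s -> is_derive X t (u (X t) t)
}.

Unset Implicit Arguments.

Lemma trajectory_restrict u x s s' X : s' <= s -> trajectory u x s X -> trajectory u x s' X.
Proof. intros Hs [H1 H2 H3]. split; auto. intros t Ht. apply H3. lra. Qed.

Lemma lipschitz_on_bounded_set (u ux : R -> R -> R) (S N : R) :
  cts2 ux ->
  (forall x t, 0 < t < S -> is_derive (fun y => u y t) x (ux x t)) ->
  exists L, 1 <= L /\ forall x y t, Rabs x <= N -> Rabs y <= N -> 0 < t < S ->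
    Rabs (u x t - u y t) <= L * Rabs (x - y).
Proof.
  intros Hux Hd. destruct (cts2_bounded ux (Rmax N S) Hux) as [B [HB0 HB]].
  exists (B + 1). split; [lra|].
  assert (Hw : forall x y t, x <= y -> Rabs x <= N -> Rabs y <= N -> 0 < t < S ->
     Rabs (u y t - u x t) <= (B + 1) * Rabs (y - x)).
  { intros x y t Hxy Hx Hy Ht. rewrite (Rabs_pos_eq (y - x)) by lra.
    apply (increment_abs (fun z => u z t) (fun z => ux z t)); [exact Hxy| | |].
    - intros z _. eapply is_derive_continuous; now apply Hd.
    - intros z _. now apply Hd.
    - intros z Hz. apply Rabs_le_between in Hx, Hy.
      assert (Rabs (ux z t) <= B); [|lra]. apply HB.
      + apply Rle_trans with N; [apply Rabs_le; lra|apply Rmax_l].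
      + apply Rle_trans with S; [apply Rabs_le; lra|apply Rmax_r]. }
  intros x y t Hx Hy Ht. destruct (Rle_dec x y).
  - rewrite (Rabs_minus_sym (u x t)), (Rabs_minus_sym x). apply Hw; auto.
  - apply Hw; auto. lra.
Qed.

(** Cut off at distance K + 1, the field is bounded and Lipschitz and has a
    trajectory; as long as it stays within K + 1 it follows the original field,
    and the a priori bound keeps it within K. *)
Lemma trajectory_exists (u ux : R -> R -> R) (S x K : R) :
  cts2 u -> cts2 ux -> 0 < S ->
  (forall x t, 0 < t < S -> is_derive (fun y => u y t) x (ux x t)) ->
  Rabs x <= K ->
  (forall s X, 0 < s <= S -> trajectory u x s X -> Rabs (X s) <= K) ->
  exists X, trajectory u x S X.
Proof.
  intros Hu Hux HS Hd Hx Hb.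
  set (N := K + 1). assert (HN : 0 <= N) by (unfold N; pose proof (Rabs_pos x); lra).
  destruct (lipschitz_on_bounded_set u ux S N Hux Hd) as [L [HL1 HL]].
  destruct (cts2_bounded u (Rmax N S) Hu) as [V [HV0 HV]].
  assert (Hcl : forall z, Rabs (clamp (- N) N z) <= N).
  { intros z. apply Rabs_le, clamp_in. lra. }
  destruct (picard_lindelof (fun z t => u (clamp (- N) N z) t) V L S x) as [X [X0 [CX DX]]]; auto.
  - intros z t. apply (continuous_comp_2 (fun p : R * R => clamp (- N) N (fst p)) snd u).
    + apply (continuous_comp fst (clamp (- N) N)); [apply continuous_fst|apply clamp_continuous].
    + apply continuous_snd.
    + apply Hu.
  - intros z t Ht. apply HV.
    + eapply Rle_trans; [apply Hcl|apply Rmax_l].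
    + rewrite Rabs_pos_eq by lra. pose proof (Rmax_r N S). lra.
  - intros y z t Ht. eapply Rle_trans; [apply HL; auto|].
    apply Rmult_le_compat_l; [lra|]. apply clamp_lipschitz.
  - assert (Htr : forall s, s <= S -> (forall t, 0 <= t <= s -> Rabs (X t) <= K + 1) ->
       trajectory u x s X).
    { intros s Hs HX. split; auto. intros t Ht. specialize (DX t ltac:(lra)).
      specialize (HX t ltac:(lra)). apply Rabs_le_between in HX.
      rewrite clamp_id in DX; [exact DX|unfold N; lra]. }
    exists X. apply Htr; [lra|].
    intros t Ht. apply Rle_trans with K; [|lra].
    apply (bootstrap_bound (fun t => Rabs (X t)) K S); try lra.
    + intros s. apply (continuous_comp X Rabs); [apply CX|]. apply (continuous_abs (X s)).
    + rewrite X0. exact Hx.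
    + intros s Hs HXs. destruct (Req_dec s 0) as [->|]; [rewrite X0; exact Hx|].
      apply Hb; [lra|]. apply Htr; [lra|exact HXs].
Qed.

(** * Integrals over the line and the nonlocal force *)

Definition is_line (f : R -> R) (l : R) : Prop :=
  is_RInt_gen f (Rbar_locally m_infty) (Rbar_locally p_infty) l.

Lemma is_line_spec (f : R -> R) (l : R) :
  is_line f l <->
  forall e, 0 < e -> exists N, forall a b, a < - N -> N < b ->
    exists I, is_RInt f a b I /\ Rabs (I - l) < e.
Proof.
  unfold is_line, is_RInt_gen, filterlimi, filter_le, filtermapi. split.
  - intros H e He.
    destruct (H (fun y => Rabs (y - l) < e)) as [Q1 Q2 [N1 H1] [N2 H2] HQ].
    { exists (mkposreal e He). intros y Hy. exact Hy. }
    exists (Rmax (- N1) N2). intros a b Ha Hb.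
    pose_minmax.
    destruct (HQ a b) as [I [HI1 HI2]]; [apply H1; lra|apply H2; lra|].
    exists I. auto.
  - intros H P [e HP]. destruct (H e (cond_pos e)) as [N HN].
    apply (Filter_prod _ _ _ (fun a => a < - N) (fun b => N < b)).
    + exists (- N). auto.
    + exists N. auto.
    + intros a b Ha Hb. destruct (HN a b Ha Hb) as [I [HI1 HI2]].
      exists I. split; [exact HI1|]. apply HP. exact HI2.
Qed.

Lemma is_line_spec_continuous (f : R -> R) (l : R) :
  (forall x, continuous f x) ->
  (is_line f l <->
   forall e, 0 < e -> exists N, forall a b, a < - N -> N < b -> Rabs (RInt f a b - l) < e).
Proof.
  intros Hf. rewrite is_line_spec. split; intros H e He; destruct (H e He) as [N HN];
    exists N; intros a b Ha Hb.
  - destruct (HN a b Ha Hb) as [I [HI1 HI2]]. now rewrite (is_RInt_unique f a b I HI1).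
  - exists (RInt f a b). split; [|now apply HN].
    apply (@RInt_correct R_CompleteNormedModule), (@ex_RInt_continuous R_CompleteNormedModule). auto.
Qed.

Lemma is_line_unique (f : R -> R) (l l' : R) : is_line f l -> is_line f l' -> l = l'.
Proof.
  intros H H'. rewrite <- (is_RInt_gen_unique f l H). now apply is_RInt_gen_unique.
Qed.

(** m is the integral of r from - infinity to z. *)
Definition is_left_mass (r : R -> R) (z m : R) : Prop :=
  forall e, 0 < e -> exists N, forall a, a < - N -> Rabs (RInt r a z - m) < e.

Lemma cont_ex_RInt (f : R -> R) (a b : R) : (forall x, continuous f x) -> ex_RInt f a b.
Proof. intros Hf. apply (@ex_RInt_continuous R_CompleteNormedModule). auto. Qed.

Lemma RInt_split (f : R -> R) (a b c : R) : (forall x, continuous f x) ->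
  RInt f a c = RInt f a b + RInt f b c.
Proof. intros Hf. symmetry. apply (RInt_Chasles f); now apply cont_ex_RInt. Qed.

Lemma RInt_flip (f : R -> R) (a b : R) : (forall x, continuous f x) ->
  RInt f a b = - RInt f b a.
Proof. intros Hf. symmetry. apply (opp_RInt_swap f). now apply cont_ex_RInt. Qed.

Lemma RInt_mult_const (f : R -> R) (k a b : R) : (forall x, continuous f x) ->
  RInt (fun y => k * f y) a b = k * RInt f a b.
Proof. intros Hf. apply (RInt_scal f a b k). now apply cont_ex_RInt. Qed.

Lemma RInt_sub (f g : R -> R) (a b : R) :
  (forall x, continuous f x) -> (forall x, continuous g x) ->
  RInt (fun y => f y - g y) a b = RInt f a b - RInt g a b.
Proof. intros Hf Hg. apply (RInt_minus f g); now apply cont_ex_RInt. Qed.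

Lemma is_left_mass_shift (r : R -> R) (z z' m : R) : (forall x, continuous r x) ->
  is_left_mass r z m -> is_left_mass r z' (m + RInt r z z').
Proof.
  intros Hr H e He. destruct (H e He) as [N HN]. exists N. intros a Ha.
  rewrite (RInt_split r a z z') by exact Hr.
  replace (RInt r a z + RInt r z z' - (m + RInt r z z')) with (RInt r a z - m) by ring.
  now apply HN.
Qed.

Lemma is_RInt_dW (r : R -> R) (x a b : R) : (forall y, continuous r y) ->
  a <= x <= b ->
  is_RInt (fun y => dW (x - y) * r y) a b
    (RInt r x b - RInt r a x + RInt (fun y => (x - y) * r y) a b).
Proof.
  intros Hr Hx.
  assert (Hc : forall y, continuous (fun y => (x - y) * r y) y).
  { intros y. solve_continuous. }
  assert (H1 : is_RInt (fun y => dW (x - y) * r y) a x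
     (minus (RInt (fun y => (x - y) * r y) a x) (RInt r a x))).
  { apply (is_RInt_ext (fun y => minus ((x - y) * r y) (r y))).
    - rewrite Rmin_left, Rmax_right by lra. intros y Hy. unfold dW.
      rewrite sign_eq_1 by lra. unfold minus, plus, opp; simpl. ring.
    - apply (is_RInt_minus (fun y => (x - y) * r y) r);
        apply (@RInt_correct R_CompleteNormedModule), cont_ex_RInt; auto. }
  assert (H2 : is_RInt (fun y => dW (x - y) * r y) x b
     (plus (RInt (fun y => (x - y) * r y) x b) (RInt r x b))).
  { apply (is_RInt_ext (fun y => plus ((x - y) * r y) (r y))).
    - rewrite Rmin_left, Rmax_right by lra. intros y Hy. unfold dW.
      rewrite sign_eq_m1 by lra. unfold plus; simpl. ring.
    - apply (is_RInt_plus (fun y => (x - y) * r y) r);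
        apply (@RInt_correct R_CompleteNormedModule), cont_ex_RInt; auto. }
  pose proof (is_RInt_Chasles _ _ _ _ _ _ H1 H2) as H. revert H.
  rewrite (RInt_split (fun y => (x - y) * r y) a x b) by exact Hc.
  match goal with |- is_RInt _ _ _ ?u -> is_RInt _ _ _ ?v => replace v with u; [auto|] end.
  unfold plus, minus, opp, plus; simpl. ring.
Qed.

(** In a difference of two values of the force the first moment cancels; a single
    difference over a unit distance already shows that r is integrable. *)
Lemma conv_difference (r c : R -> R) : (forall y, continuous r y) ->
  (forall x, is_line (fun y => dW (x - y) * r y) (c x)) ->
  exists M, is_line r M /\
    forall x x', c x - c x' = (x - x') * M - 2 * RInt r x' x.
Proof.
  intros Hr Hc.
  assert (Key : forall x x' e, 0 < e -> exists N, forall a b, a < - N -> N < b ->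
     Rabs ((x - x') * RInt r a b - 2 * RInt r x' x - (c x - c x')) < e).
  { intros x x' e He.
    destruct (proj1 (is_line_spec _ _) (Hc x) (e / 2)) as [N1 H1]; [lra|].
    destruct (proj1 (is_line_spec _ _) (Hc x') (e / 2)) as [N2 H2]; [lra|].
    exists (Rmax (Rmax N1 N2) (Rmax (Rabs x) (Rabs x'))). intros a b Ha Hb.
    pose_minmax.
    pose proof (Rle_abs x). pose proof (Rle_abs x').
    pose proof (Rle_abs (- x)). pose proof (Rle_abs (- x')). rewrite Rabs_Ropp in *.
    destruct (H1 a b) as [I1 [HI1 HE1]]; [lra|lra|].
    destruct (H2 a b) as [I2 [HI2 HE2]]; [lra|lra|].
    assert (E1 : I1 = RInt r x b - RInt r a x + RInt (fun y => (x - y) * r y) a b).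
    { rewrite <- (is_RInt_unique _ _ _ _ HI1). apply is_RInt_unique, is_RInt_dW; auto. lra. }
    assert (E2 : I2 = RInt r x' b - RInt r a x' + RInt (fun y => (x' - y) * r y) a b).
    { rewrite <- (is_RInt_unique _ _ _ _ HI2). apply is_RInt_unique, is_RInt_dW; auto. lra. }
    assert (E3 : RInt (fun y => (x - y) * r y) a b - RInt (fun y => (x' - y) * r y) a b
       = (x - x') * RInt r a b).
    { assert (Hcx : forall x y, continuous (fun y => (x - y) * r y) y).
      { intros z y. solve_continuous. }
      rewrite <- RInt_mult_const, <- RInt_sub by auto.
      apply RInt_ext. intros y _. ringR. }
    rewrite (RInt_split r x x' b), (RInt_split r a x' x), (RInt_flip r x x') in E1 by exact Hr.
    replace ((x - x') * RInt r a b - 2 * RInt r x' x - (c x - c x'))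
      with ((I1 - c x) - (I2 - c x')) by (rewrite <- E3; lra).
    apply Rabs_def2 in HE1, HE2. apply Rabs_def1; lra. }
  set (M := c 1 - c 0 + 2 * RInt r 0 1).
  assert (HM : is_line r M).
  { apply is_line_spec_continuous; [exact Hr|]. intros e He.
    destruct (Key 1 0 e He) as [N HN]. exists N. intros a b Ha Hb.
    specialize (HN a b Ha Hb). unfold M.
    replace (RInt r a b - (c 1 - c 0 + 2 * RInt r 0 1))
      with ((1 - 0) * RInt r a b - 2 * RInt r 0 1 - (c 1 - c 0)) by ring.
    exact HN. }
  exists M. split; [exact HM|]. intros x x'.
  apply Rminus_diag_uniq, Rabs_eq_0, Rle_antisym; [|apply Rabs_pos].
  apply Rnot_lt_le. intros Hpos.
  set (d := Rabs (c x - c x' - ((x - x') * M - 2 * RInt r x' x))) in *.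
  assert (Hax : 0 < Rabs (x - x') + 1) by (pose proof (Rabs_pos (x - x')); lra).
  destruct (Key x x' (d / 2)) as [N1 H1]; [lra|].
  destruct (proj1 (is_line_spec_continuous r M Hr) HM (d / 2 / (Rabs (x - x') + 1))) as [N2 H2].
  { apply Rdiv_lt_0_compat; lra. }
  set (b := Rmax N1 N2 + 1).
  assert (Hb : N1 < b /\ N2 < b).
  { unfold b. pose_minmax. lra. }
  specialize (H1 (- b) b ltac:(lra) ltac:(lra)). specialize (H2 (- b) b ltac:(lra) ltac:(lra)).
  assert (H3 : Rabs ((x - x') * (RInt r (- b) b - M)) <= d / 2).
  { rewrite Rabs_mult.
    apply Rle_trans with ((Rabs (x - x') + 1) * (d / 2 / (Rabs (x - x') + 1))).
    - apply Rmult_le_compat; try apply Rabs_pos; lra.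
    - right. field. lra. }
  assert (d < d); [|lra].
  unfold d at 1.
  replace (c x - c x' - ((x - x') * M - 2 * RInt r x' x))
    with ((x - x') * (RInt r (- b) b - M)
          - ((x - x') * RInt r (- b) b - 2 * RInt r x' x - (c x - c x'))) by ring.
  apply Rabs_le_between in H3. apply Rabs_def2 in H1. apply Rabs_def1; lra.
Qed.

Lemma strictly_increasing_of_derive (X dX : R -> R) :
  (forall x, is_derive X x (dX x)) -> (forall x, 0 < dX x) ->
  forall a b, a < b -> X a < X b.
Proof.
  intros HX Hp a b Hab.
  destruct (MVT_gen X a b dX) as [c [_ Hc]].
  - intros; apply HX.
  - intros. apply continuity_pt_filterlim.
    eapply is_derive_continuous; apply HX.
  - specialize (Hp c). nra.
Qed.

(** In the variable y = X x the sign kernel compares labels, since X preserves the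
    order, and the linear kernel sees only the mass and the first moment. *)
Lemma conv_lagrangian (X dX r r0 : R -> R) (M m k z : R) :
  (forall x, is_derive X x (dX x)) -> (forall x, continuous dX x) -> (forall x, 0 < dX x) ->
  (forall y, exists x, X x = y) ->
  (forall y, continuous r y) -> (forall x, continuous r0 x) ->
  (forall x, r (X x) * dX x = r0 x) ->
  is_line r0 M -> is_left_mass r0 z m -> is_line (fun x => X x * r0 x) k ->
  is_line (fun y => dW (X z - y) * r y) (M - 2 * m + M * X z - k).
Proof.
  intros DX CdX PdX SX Cr Cr0 Hr HM Hm Hk.
  assert (Hinc := strictly_increasing_of_derive X dX DX PdX).
  assert (CX : forall x, continuous X x).
  { intros x. eapply is_derive_continuous; apply DX. }
  assert (CXr : forall x, continuous (fun x => X x * r0 x) x).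
  { intros x. solve_continuous. }
  assert (Hlt : forall a b, X a < X b -> a < b).
  { intros a b Hab. destruct (Rtotal_order a b) as [H|[H|H]]; [exact H|subst; lra|].
    specialize (Hinc b a H). lra. }
  assert (HS : forall phi a b, (forall y, continuous phi y) ->
     RInt (fun y => phi y * r y) (X a) (X b) = RInt (fun x => phi (X x) * r0 x) a b).
  { intros phi a b Hphi.
    rewrite <- (RInt_comp (fun y => phi y * r y) X dX a b).
    - apply RInt_ext. intros x _. rewrite <- Hr. unfold scal; simpl. unfold mult; simpl. ring.
    - intros x _. now apply (continuous_mult phi r).
    - intros x _. auto. }
  assert (HS1 : forall a b, RInt r (X a) (X b) = RInt r0 a b).
  { intros a b. rewrite (RInt_ext r (fun y => 1 * r y)) by (intros; ringR).
    rewrite (HS (fun _ => 1)) by (intros; apply continuous_const).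
    apply RInt_ext. intros. ringR. }
  apply is_line_spec. intros e He.
  set (w := 1 + Rabs (X z)). assert (Hw : 1 <= w) by (unfold w; pose proof (Rabs_pos (X z)); lra).
  assert (He4 : 0 < e / 4 / w) by (apply Rdiv_lt_0_compat; lra).
  destruct (proj1 (is_line_spec_continuous r0 M Cr0) HM _ He4) as [N1 H1].
  destruct (Hm (e / 8)) as [N2 H2]; [lra|].
  destruct (proj1 (is_line_spec_continuous _ k CXr) Hk (e / 4)) as [N3 H3]; [lra|].
  set (N := Rmax (Rmax N1 N2) (Rmax N3 (Rabs z))).
  assert (HN : N1 <= N /\ N2 <= N /\ N3 <= N /\ Rabs z <= N).
  { unfold N. pose_minmax. lra. }
  exists (Rmax (- X (- N)) (X N)). intros a' b' Ha' Hb'.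
  pose_minmax.
  destruct (SX a') as [a <-]. destruct (SX b') as [b <-].
  assert (Ha : a < - N) by (apply Hlt; lra). assert (Hb : N < b) by (apply Hlt; lra).
  destruct HN as [HN1 [HN2 [HN3 HN4]]]. apply Rabs_le_between in HN4.
  eexists. split.
  { apply is_RInt_dW; [exact Cr|]. split; left; apply Hinc; lra. }
  rewrite !HS1, (HS (fun y => X z - y)).
  2:{ intros y. solve_continuous. }
  assert (E : RInt (fun x => (X z - X x) * r0 x) a b
    = X z * RInt r0 a b - RInt (fun x => X x * r0 x) a b).
  { assert (CXz : forall x, continuous (fun x => X z * r0 x) x).
    { intros x. solve_continuous. }
    rewrite <- RInt_mult_const, <- RInt_sub by auto.
    apply RInt_ext. intros x _. ringR. }
  rewrite E. clear E.
  specialize (H1 a b ltac:(lra) ltac:(lra)). specialize (H2 a ltac:(lra)).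
  specialize (H3 a b ltac:(lra) ltac:(lra)).
  replace (RInt r0 z b) with (RInt r0 a b - RInt r0 a z)
    by (rewrite (RInt_split r0 a z b) by exact Cr0; ring).
  replace (RInt r0 a b - RInt r0 a z - RInt r0 a z +
     (X z * RInt r0 a b - RInt (fun x => X x * r0 x) a b) - (M - 2 * m + M * X z - k))
    with ((1 + X z) * (RInt r0 a b - M) - 2 * (RInt r0 a z - m)
          - (RInt (fun x => X x * r0 x) a b - k)) by ring.
  assert (G : Rabs ((1 + X z) * (RInt r0 a b - M)) <= e / 4).
  { rewrite Rabs_mult. apply Rle_trans with (w * (e / 4 / w)); [|right; field; lra].
    apply Rmult_le_compat; try apply Rabs_pos; [|lra].
    eapply Rle_trans; [apply (Rabs_triang 1 (X z))|]. rewrite Rabs_R1. unfold w. lra. }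
  change (Rabs (RInt (fun x : R => X x * r0 x) a b - k) < e / 4) in H3.
  apply Rabs_le_between in G. apply Rabs_def2 in H2, H3. apply Rabs_def1; lra.
Qed.

Lemma cauchy_at_infinity (F : R -> R) :
  (forall e, 0 < e -> exists N, forall b b', N < b -> N < b' -> Rabs (F b - F b') < e) ->
  exists l, forall e, 0 < e -> exists N, forall b, N < b -> Rabs (F b - l) < e.
Proof.
  intros H.
  destruct (proj1 (filterlim_locally_cauchy (F := Rbar_locally p_infty) F)) as [l Hl].
  - intros e. destruct (H e (cond_pos e)) as [N HN].
    exists (fun b => N < b). split; [exists N; auto|].
    intros u v Hu Hv. change (Rabs (F v - F u) < e). now apply HN.
  - exists l. intros e He.
    destruct (proj1 (filterlim_locally F l) Hl (mkposreal e He)) as [N HN].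
    exists N. intros b Hb. exact (HN b Hb).
Qed.

(** Comparison test: the integrals of f vary less than the monotone and bounded
    primitive G of the majorant. *)
Lemma half_line_dominated (f G dG : R -> R) (C : R) :
  (forall x, continuous f x) ->
  (forall x, is_derive G x (dG x)) ->
  (forall x, 0 < x -> Rabs (f x) <= dG x) ->
  (forall x, 0 <= x -> Rabs (G x) <= C) ->
  exists l, forall e, 0 < e -> exists N, forall b, N < b -> Rabs (RInt f 0 b - l) < e.
Proof.
  intros Cf DG Hf HC.
  assert (Hinc : forall a b, 0 <= a <= b -> Rabs (RInt f 0 b - RInt f 0 a) <= G b - G a).
  { intros a b Hab.
    apply (increment_dominated (fun x => RInt f 0 x) f G dG); try lra.
    - intros x _. now apply primitive_continuous.
    - intros x _. eapply is_derive_continuous, DG.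
    - intros x _. now apply is_derive_primitive.
    - intros x _. apply DG.
    - intros x Hx. apply Hf. lra. }
  apply cauchy_at_infinity. intros e He.
  destruct (completeness (fun y => exists x, 0 <= x /\ y = G x)) as [m [Hub Hlub]].
  { exists C. intros y [x [Hx ->]]. specialize (HC x Hx). apply Rabs_le_between in HC. lra. }
  { exists (G 0), 0. split; [lra|auto]. }
  destruct (classic (exists x, 0 <= x /\ m - e < G x)) as [[N [HN0 HN]]|Hno].
  - exists N.
    assert (Hw : forall a b, N < a -> a <= b -> Rabs (RInt f 0 b - RInt f 0 a) < e).
    { intros a b Ha Hab. eapply Rle_lt_trans; [apply Hinc; lra|].
      assert (G b <= m) by (apply Hub; exists b; split; [lra|auto]).
      pose proof (Hinc N a ltac:(lra)) as Hi. pose proof (Rabs_pos (RInt f 0 a - RInt f 0 N)). lra. }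
    intros b b' Hb Hb'. destruct (Rle_dec b b').
    + rewrite Rabs_minus_sym. apply Hw; lra.
    + apply Hw; lra.
  - exfalso. assert (m <= m - e); [|lra]. apply Hlub. intros y [x [Hx ->]].
    apply Rnot_lt_le. intros Hlt. apply Hno. exists x. auto.
Qed.

Lemma line_dominated (f G dG : R -> R) (C : R) :
  (forall x, continuous f x) ->
  (forall x, is_derive G x (dG x)) ->
  (forall x, Rabs (f x) <= dG (Rabs x)) ->
  (forall x, 0 <= x -> Rabs (G x) <= C) ->
  exists l, is_line f l.
Proof.
  intros Cf DG Hf HC.
  destruct (half_line_dominated f G dG C) as [l1 H1]; auto.
  { intros x Hx. rewrite <- (Rabs_pos_eq x) at 2 by lra. auto. }
  assert (Cf' : forall x, continuous (fun x => f (- x)) x).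
  { intros x. apply (continuous_comp (fun x => - x) f); [|apply Cf].
    smooth. }
  destruct (half_line_dominated (fun x => f (- x)) G dG C) as [l2 H2]; auto.
  { intros x Hx. pose proof (Hf (- x)) as H. rewrite Rabs_Ropp, (Rabs_pos_eq x) in H by lra. exact H. }
  exists (l1 + l2). apply is_line_spec_continuous; [exact Cf|]. intros e He.
  destruct (H1 (e / 2)) as [N1 HN1]; [lra|]. destruct (H2 (e / 2)) as [N2 HN2]; [lra|].
  exists (Rmax N1 N2). intros a b Ha Hb.
  pose_minmax.
  specialize (HN1 b ltac:(lra)). specialize (HN2 (- a) ltac:(lra)).
  assert (E : RInt (fun x => f (- x)) 0 (- a) = RInt f a 0).
  { assert (E0 : RInt (fun x => - 1 * f (- x)) 0 (- a) = RInt f 0 a).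
    { apply is_RInt_unique. apply (is_RInt_ext (fun x => opp (f (- x)))).
      - intros x _. unfold opp; simpl. ringR.
      - apply (is_RInt_comp_opp f). rewrite Ropp_0, Ropp_involutive.
        apply (@RInt_correct R_CompleteNormedModule). now apply cont_ex_RInt. }
    rewrite RInt_mult_const in E0 by exact Cf'.
    rewrite (RInt_flip f a 0) by exact Cf.
    assert (Hneg : forall p q : R, - 1 * p = q -> p = - q) by (intros; lra).
    exact (Hneg _ _ E0). }
  rewrite E in HN2. rewrite (RInt_split f a 0 b) by exact Cf.
  apply Rabs_def2 in HN1, HN2. apply Rabs_def1; lra.
Qed.

Lemma left_mass_exists (r : R -> R) (M : R) : (forall x, continuous r x) ->
  is_line r M -> exists m, is_left_mass r 0 m.
Proof.
  intros Cr HM.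
  destruct (cauchy_at_infinity (fun b => RInt r (- b) 0)) as [l Hl].
  - intros e He.
    destruct (proj1 (is_line_spec_continuous r M Cr) HM (e / 2)) as [N HN]; [lra|].
    exists N. intros b b' Hb Hb'. set (c := N + 1).
    pose proof (HN (- b) c ltac:(lra) ltac:(unfold c; lra)) as G1.
    pose proof (HN (- b') c ltac:(lra) ltac:(unfold c; lra)) as G2.
    rewrite (RInt_split r (- b) 0 c) in G1 by exact Cr.
    rewrite (RInt_split r (- b') 0 c) in G2 by exact Cr.
    apply Rabs_def2 in G1, G2. apply Rabs_def1; lra.
  - exists l. intros e He. destruct (Hl e He) as [N HN]. exists N. intros a Ha.
    specialize (HN (- a) ltac:(lra)). now rewrite Ropp_involutive in HN.
Qed.

(** Enlarging the interval only adds mass. *)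
Lemma RInt_positive_bound (r : R -> R) (M a b : R) :
  (forall x, continuous r x) -> (forall x, 0 < r x) -> is_line r M ->
  Rabs (RInt r a b) <= M.
Proof.
  intros Cr Pr HM.
  assert (Pos : forall a b, a <= b -> 0 <= RInt r a b).
  { intros c d Hcd. apply RInt_ge_0; [exact Hcd|now apply cont_ex_RInt|].
    intros x _. left. apply Pr. }
  assert (Hw : forall a b, a <= b -> RInt r a b <= M).
  { intros c d Hcd. apply Rnot_lt_le. intros Hlt.
    destruct (proj1 (is_line_spec_continuous r M Cr) HM (RInt r c d - M)) as [N HN]; [lra|].
    set (c' := Rmin c (- N) - 1). set (d' := Rmax d N + 1).
    assert (c' < - N /\ c' <= c /\ N < d' /\ d <= d').
    { unfold c', d'. pose_minmax. lra. }
    specialize (HN c' d' ltac:(lra) ltac:(lra)).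
    rewrite (RInt_split r c' c d'), (RInt_split r c d d') in HN by exact Cr.
    pose proof (Pos c' c ltac:(lra)). pose proof (Pos d d' ltac:(lra)).
    apply Rabs_def2 in HN. lra. }
  destruct (Rle_dec a b).
  - rewrite Rabs_pos_eq; auto.
  - rewrite (RInt_flip r a b), Rabs_Ropp, Rabs_pos_eq by auto || (apply Pos; lra).
    apply Hw. lra.
Qed.

(** * Characteristics of a solution *)

Lemma is_derive_sq_exp (f : R -> R) (c t df : R) : is_derive f t df ->
  is_derive (fun t => f t ^ 2 * exp (c * t)) t ((2 * f t * df + c * f t ^ 2) * exp (c * t)).
Proof.
  intros Hf. auto_derive; [eexists; apply Hf|].
  replace (Derive (fun x => f x) t) with df by (symmetry; apply is_derive_unique, Hf). ring.
Qed.

Set Implicit Arguments.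

(** A solution on (0, S) whose fields are extended continuously to all times, which
    avoids one-sided limits at 0 and S.  A is the force - dW * rho; it is continuous
    because the momentum equation expresses it through u and its derivatives. *)
Record flow (S B R0 M0 : R) (rho u rx rt ux ut A : R -> R -> R) : Prop := {
  fl_S : 0 < S;
  fl_rho : cts2 rho; fl_u : cts2 u; fl_rx : cts2 rx; fl_rt : cts2 rt;
  fl_ux : cts2 ux; fl_A : cts2 A;
  fl_drx : forall x t, 0 < t < S -> is_derive (fun y => rho y t) x (rx x t);
  fl_drt : forall x t, 0 < t < S -> is_derive (fun s => rho x s) t (rt x t);
  fl_dux : forall x t, 0 < t < S -> is_derive (fun y => u y t) x (ux x t);
  fl_dut : forall x t, 0 < t < S -> is_derive (fun s => u x s) t (ut x t);
  fl_mass : forall x t, 0 < t < S -> rt x t + (rx x t * u x t + rho x t * ux x t) = 0;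
  fl_momentum : forall x t, 0 < t < S -> ut x t + u x t * ux x t + u x t = A x t;
  fl_conv : forall x t, 0 < t < S -> is_line (fun y => dW (x - y) * rho y t) (- A x t);
  fl_line0 : is_line (fun y => rho y 0) M0;
  fl_pos0 : forall x, 0 < rho x 0;
  fl_bound0 : forall x, rho x 0 <= R0;
  fl_small0 : forall e, 0 < e -> exists N, forall x, N <= Rabs x -> rho x 0 <= e;
  fl_lip0 : forall x y, Rabs (u x 0 - u y 0) <= B * Rabs (x - y)
}.

Unset Implicit Arguments.

Section Flow.

Variables (S B R0 M0 : R) (rho u rx rt ux ut A : R -> R -> R).
Hypothesis HF : flow S B R0 M0 rho u rx rt ux ut A.

Let M t := integral_line (fun y => rho y t).

Let HS := fl_S HF.
Let Crho := fl_rho HF.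
Let Cu := fl_u HF.

Lemma rho_slice_continuous t x : continuous (fun y => rho y t) x.
Proof. now apply cts2_l. Qed.

Lemma mass_and_force t : 0 < t < S ->
  is_line (fun y => rho y t) (M t) /\
  forall x x', A x t - A x' t = 2 * RInt (fun y => rho y t) x' x - (x - x') * M t.
Proof.
  intros Ht.
  destruct (conv_difference (fun y => rho y t) (fun x => - A x t)) as [m [Hm Hd]].
  - apply rho_slice_continuous.
  - intros x. apply (fl_conv HF). exact Ht.
  - assert (E : M t = m) by exact (is_RInt_gen_unique _ _ Hm).
    rewrite E. split; [exact Hm|]. intros x x'. specialize (Hd x x'). lra.
Qed.

Lemma velocity_derive x s X t : s <= S -> trajectory u x s X -> 0 < t < s ->
  is_derive (fun t => u (X t) t) t (- u (X t) t + A (X t) t).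
Proof.
  intros Hs [_ _ DX] Ht.
  rewrite <- (fl_momentum HF) by lra.
  replace (- u (X t) t + (ut (X t) t + u (X t) t * ux (X t) t + u (X t) t))
    with (ux (X t) t * u (X t) t + ut (X t) t) by ring.
  apply (is_derive_along u ux X 0 S); [lra| | | |].
  - intros y r Hr. now apply (fl_dux HF).
  - apply (fl_ux HF).
  - apply (fl_dut HF). lra.
  - apply DX. lra.
Qed.

Lemma trajectory_velocity_continuous x s X t : trajectory u x s X ->
  continuous (fun t => u (X t) t) t.
Proof.
  intros [_ CX _]. apply continuous_along; [apply Cu|apply CX|apply continuous_id].
Qed.

(** The flux through the moving end vanishes. *)
Lemma partial_mass_derive x s X t : s <= S -> trajectory u x s X -> 0 < t < s ->
  is_derive (fun t => RInt (fun y => rho y t) 0 (X t)) t (rho 0 t * u 0 t).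
Proof.
  intros Hs [_ _ DX] Ht.
  assert (Cpx : forall y, continuous (fun y => rx y t * u y t + rho y t * ux y t) y).
  { intros y. apply (cts2_l (fun y t => rx y t * u y t + rho y t * ux y t)).
    pose proof (fl_rx HF). pose proof (fl_ux HF). solve_cts2. }
  assert (E : RInt (fun y => rt y t) 0 (X t) = - (rho (X t) t * u (X t) t) + rho 0 t * u 0 t).
  { assert (H : is_RInt (fun y => rx y t * u y t + rho y t * ux y t) 0 (X t)
        (minus (rho (X t) t * u (X t) t) (rho 0 t * u 0 t))).
    { apply (is_RInt_derive (fun y => rho y t * u y t)).
      - intros y _.
        apply (is_derive_mult (fun y => rho y t) (fun y => u y t) y (rx y t) (ux y t)).
        + apply (fl_drx HF). lra.
        + apply (fl_dux HF). lra.
        + intros. apply Rmult_comm.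
      - intros y _. apply Cpx. }
    rewrite (RInt_ext _ (fun y => - 1 * (rx y t * u y t + rho y t * ux y t))).
    - rewrite RInt_mult_const by exact Cpx. rewrite (is_RInt_unique _ _ _ _ H).
      unfold minus, plus, opp; simpl. ring.
    - intros y _. pose proof (fl_mass HF y (t := t) ltac:(lra)). lra. }
  replace (rho 0 t * u 0 t) with (rho (X t) t * u (X t) t + RInt (fun y => rt y t) 0 (X t))
    by (rewrite E; ring).
  apply (is_derive_along (fun x t => RInt (fun y => rho y t) 0 x) rho X 0 S); [lra| | | |].
  - intros y r _. apply (is_derive_primitive (fun y => rho y r)). apply rho_slice_continuous.
  - apply Crho.
  - apply (is_derive_RInt_time rho rt 0 S); [exact Crho| |lra|].
    + apply (fl_rt HF).
    + apply (fl_drt HF).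
  - apply DX. lra.
Qed.

Lemma mass_between_trajectories x1 x2 s X1 X2 t : s <= S ->
  trajectory u x1 s X1 -> trajectory u x2 s X2 -> 0 <= t <= s ->
  RInt (fun y => rho y t) (X1 t) (X2 t) = RInt (fun y => rho y 0) x1 x2.
Proof.
  intros Hs T1 T2 Ht.
  set (N := fun t => RInt (fun y => rho y t) 0 (X2 t) - RInt (fun y => rho y t) 0 (X1 t)).
  assert (E : forall t, RInt (fun y => rho y t) (X1 t) (X2 t) = N t).
  { intros r. unfold N. rewrite (RInt_split _ 0 (X1 r) (X2 r)) by apply rho_slice_continuous. ringR. }
  rewrite E, <- (traj_start T1), <- (traj_start T2), E.
  assert (Cphi : forall x X, trajectory u x s X -> forall r,
     continuous (fun t => RInt (fun y => rho y t) 0 (X t)) r).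
  { intros x X [_ CX _] r. apply (continuous_along (fun x t => RInt (fun y => rho y t) 0 x) X (fun t => t)).
    - apply (cts2_RInt rho Crho).
    - apply CX.
    - apply continuous_id. }
  assert (H : Rabs (N t - N 0) <= 0 * (t - 0)).
  { apply (increment_abs N (fun t => rho 0 t * u 0 t - rho 0 t * u 0 t)); [lra| | |].
    - intros r _. apply (continuous_minus (fun t => RInt (fun y => rho y t) 0 (X2 t))
        (fun t => RInt (fun y => rho y t) 0 (X1 t))); eapply Cphi; eassumption.
    - intros r Hr. apply (is_derive_minus (fun t => RInt (fun y => rho y t) 0 (X2 t))
        (fun t => RInt (fun y => rho y t) 0 (X1 t)));
        eapply partial_mass_derive; try eassumption; lra.
    - intros r _. rewrite Rminus_diag, Rabs_R0. lra. }
  rewrite Rmult_0_l in H. apply Rabs_le_between in H. lra.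
Qed.

Lemma gap_derive x1 x2 s X1 X2 t : s <= S ->
  trajectory u x1 s X1 -> trajectory u x2 s X2 -> 0 < t < s ->
  is_derive (fun t => u (X2 t) t - u (X1 t) t) t
    (- (u (X2 t) t - u (X1 t) t)
     + (- M t * (X2 t - X1 t) + 2 * RInt (fun y => rho y 0) x1 x2)).
Proof.
  intros Hs T1 T2 Ht.
  rewrite <- (mass_between_trajectories x1 x2 s X1 X2 t) by (auto; lra).
  pose proof (proj2 (mass_and_force t ltac:(lra)) (X2 t) (X1 t)) as E.
  replace (- (u (X2 t) t - u (X1 t) t)
     + (- M t * (X2 t - X1 t) + 2 * RInt (fun y => rho y t) (X1 t) (X2 t)))
    with ((- u (X2 t) t + A (X2 t) t) - (- u (X1 t) t + A (X1 t) t)) by lra.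
  apply (is_derive_minus (fun t => u (X2 t) t) (fun t => u (X1 t) t));
    eapply velocity_derive; eassumption.
Qed.

Lemma gap_position_derive x1 x2 s X1 X2 t :
  trajectory u x1 s X1 -> trajectory u x2 s X2 -> 0 < t < s ->
  is_derive (fun t => X2 t - X1 t) t (u (X2 t) t - u (X1 t) t).
Proof.
  intros T1 T2 Ht. apply (is_derive_minus X2 X1);
    eapply traj_derive; eassumption.
Qed.

Lemma gap_continuous x1 x2 s X1 X2 t :
  trajectory u x1 s X1 -> trajectory u x2 s X2 -> continuous (fun t => X2 t - X1 t) t.
Proof.
  intros T1 T2. apply (continuous_minus X2 X1); eapply traj_continuous; eassumption.
Qed.

Lemma gap_velocity_continuous x1 x2 s X1 X2 t :
  trajectory u x1 s X1 -> trajectory u x2 s X2 ->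
  continuous (fun t => u (X2 t) t - u (X1 t) t) t.
Proof.
  intros T1 T2. apply (continuous_minus (fun t => u (X2 t) t) (fun t => u (X1 t) t));
    eapply trajectory_velocity_continuous; eassumption.
Qed.

(** The mass is, up to a local term, the difference of a continuous force at two
    points. *)
Lemma mass_bounded : exists K, 2 <= K /\ forall t, 0 < t < S -> Rabs (M t) <= K.
Proof.
  set (N := Rmax 1 S).
  destruct (cts2_bounded A N (fl_A HF)) as [a [Ha0 Ha]].
  destruct (cts2_bounded rho N Crho) as [b [Hb0 Hb]].
  exists (2 * b + 2 * a + 2). split; [lra|]. intros t Ht.
  assert (HtN : Rabs t <= N) by (rewrite Rabs_pos_eq by lra; unfold N; pose proof (Rmax_r 1 S); lra).
  assert (H1N : 1 <= N) by apply Rmax_l.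
  pose proof (proj2 (mass_and_force t Ht) 1 0) as E.
  assert (H1 : Rabs (A 1 t) <= a) by (apply Ha; [rewrite Rabs_R1; lra|auto]).
  assert (H0 : Rabs (A 0 t) <= a) by (apply Ha; [rewrite Rabs_R0; lra|auto]).
  assert (H2 : Rabs (RInt (fun y => rho y t) 0 1) <= b * Rabs (1 - 0)).
  { apply abs_RInt_le_bound; [apply rho_slice_continuous|].
    rewrite Rmin_left, Rmax_right by lra. intros y Hy. apply Hb; auto.
    rewrite Rabs_pos_eq; lra. }
  rewrite Rminus_0_r, Rabs_R1 in H2.
  apply Rabs_le_between in H0, H1, H2. apply Rabs_le. lra.
Qed.

Lemma trajectory_bounded x s X : trajectory u x s X ->
  exists N, 0 <= N /\ forall t, 0 <= t <= s -> Rabs (X t) <= N.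
Proof.
  intros [_ CX _]. destruct (bounded_continuity X 0 s) as [N HN].
  { intros t _. apply CX. }
  exists (Rabs N). split; [apply Rabs_pos|]. intros t Ht. specialize (HN t Ht).
  change (norm (X t)) with (Rabs (X t)) in HN. pose proof (Rle_abs N). lra.
Qed.

(** The field is Lipschitz on the bounded set that the two trajectories visit, so
    their gap shrinks at most exponentially. *)
Lemma trajectories_ordered x1 x2 s X1 X2 : s <= S ->
  trajectory u x1 s X1 -> trajectory u x2 s X2 -> x1 < x2 ->
  exists L, 0 <= L /\ forall t, 0 <= t <= s ->
    (x2 - x1) * exp (- L * t) <= X2 t - X1 t.
Proof.
  intros Hs T1 T2 Hx.
  destruct (trajectory_bounded _ _ _ T1) as [N1 [HN1 HB1]].
  destruct (trajectory_bounded _ _ _ T2) as [N2 [HN2 HB2]].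
  destruct (lipschitz_on_bounded_set u ux S (Rmax N1 N2)) as [L [HL1 HL]].
  { apply (fl_ux HF). }
  { apply (fl_dux HF). }
  exists L. split; [lra|].
  set (D := fun t => X2 t - X1 t). set (D1 := fun t => u (X2 t) t - u (X1 t) t).
  assert (D0 : D 0 = x2 - x1).
  { unfold D. now rewrite (traj_start T1), (traj_start T2). }
  assert (CD : forall t, continuous D t) by (intros; eapply gap_continuous; eassumption).
  assert (DD : forall t, 0 < t < s -> is_derive D t (D1 t)).
  { intros. eapply gap_position_derive; eassumption. }
  assert (HD : forall t, 0 < t < s -> Rabs (D1 t) <= L * Rabs (D t)).
  { intros t Ht. apply HL; [| |lra].
    - apply Rle_trans with N2; [apply HB2; lra|apply Rmax_r].
    - apply Rle_trans with N1; [apply HB1; lra|apply Rmax_l]. }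
  assert (Hsq : forall t, 0 <= t <= s ->
    (x2 - x1) ^ 2 <= D t ^ 2 * exp (2 * L * t)).
  { intros t Ht.
    pose proof (increment_ge (fun t => D t ^ 2 * exp (2 * L * t))
      (fun t => (2 * D t * D1 t + 2 * L * D t ^ 2) * exp (2 * L * t)) 0 t 0 ltac:(lra)) as H.
    cbv beta in H. rewrite D0, Rmult_0_r, exp_0 in H.
    cut (0 * (t - 0) <= D t ^ 2 * exp (2 * L * t) - (x2 - x1) ^ 2 * 1); [lra|]. apply H.
    - intros r _. assert (continuous (fun t => exp (2 * L * t)) r) by smooth.
      simpl. solve_continuous.
    - intros r Hr. apply is_derive_sq_exp, DD. lra.
    - intros r Hr. specialize (HD r ltac:(lra)).
      apply Rmult_le_pos; [|left; apply exp_pos].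
      assert (Rabs (D r * D1 r) <= L * D r ^ 2).
      { rewrite Rabs_mult, <- (pow2_abs (D r)). pose proof (Rabs_pos (D r)). nra. }
      apply Rabs_le_between in H0. lra. }
  assert (Hne : forall t, 0 <= t <= s -> D t <> 0).
  { intros t Ht E. specialize (Hsq t Ht). rewrite E in Hsq. nra. }
  intros t Ht.
  assert (Hpos : 0 < D t).
  { apply Rnot_le_lt. intros Hle.
    destruct (IVT_gen D 0 t 0) as [r [Hr1 Hr2]].
    - intros r. apply continuity_pt_filterlim, CD.
    - rewrite D0. split; [apply Rle_trans with (D t); [apply Rmin_r|lra]|].
      apply Rle_trans with (x2 - x1); [lra|apply Rmax_l].
    - rewrite Rmin_left, Rmax_right in Hr1 by lra. apply (Hne r); [lra|exact Hr2]. }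
  specialize (Hsq t Ht).
  replace (exp (2 * L * t)) with (exp (L * t) ^ 2) in Hsq
    by (simpl; rewrite Rmult_1_r, <- exp_plus; f_equal; ring).
  rewrite <- Rpow_mult_distr in Hsq. pose proof (exp_pos (L * t)).
  assert (x2 - x1 <= D t * exp (L * t)).
  { assert (0 < D t * exp (L * t)) by now apply Rmult_lt_0_compat.
    apply Rsqr_incr_0_var; [unfold Rsqr; simpl in Hsq|]; lra. }
  replace (exp (- L * t)) with (/ exp (L * t)) by (rewrite <- exp_Ropp; f_equal; ring).
  apply Rmult_le_reg_r with (exp (L * t)); [assumption|].
  rewrite Rmult_assoc, Rinv_l by lra. unfold D in *. lra.
Qed.

Lemma initial_mass_bound x1 x2 : Rabs (RInt (fun y => rho y 0) x1 x2) <= R0 * Rabs (x2 - x1).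
Proof.
  apply abs_RInt_le_bound; [apply rho_slice_continuous|]. intros y _.
  rewrite Rabs_pos_eq.
  - apply (fl_bound0 HF).
  - left. apply (fl_pos0 HF).
Qed.

Lemma gap_forcing_bound K x1 x2 t D : 2 <= K -> Rabs (M t) <= K ->
  Rabs (- M t * D + 2 * RInt (fun y => rho y 0) x1 x2)
    <= K * (Rabs D + Rabs (RInt (fun y => rho y 0) x1 x2)).
Proof.
  intros HK HM. eapply Rle_trans; [apply Rabs_triang|].
  rewrite !Rabs_mult, Rabs_Ropp, (Rabs_pos_eq 2) by lra.
  pose proof (Rabs_pos D). pose proof (Rabs_pos (RInt (fun y => rho y 0) x1 x2)). nra.
Qed.

(** The gap is an oscillator whose stiffness is bounded and whose initial data are
    at most proportional to the distance of the labels. *)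
Lemma gap_lipschitz : exists C, 0 <= C /\ forall x1 x2 s X1 X2 t, s <= S ->
  trajectory u x1 s X1 -> trajectory u x2 s X2 -> 0 <= t <= s ->
  Rabs (X2 t - X1 t) <= C * Rabs (x2 - x1).
Proof.
  destruct mass_bounded as [K [HK2 HK]].
  set (c := (1 + B ^ 2 + R0 ^ 2) * exp ((3 + 2 * K) * S)).
  assert (Hc : 1 <= c).
  { unfold c. pose proof (pow2_ge_0 B). pose proof (pow2_ge_0 R0).
    assert (1 <= exp ((3 + 2 * K) * S)).
    { pose proof (exp_ineq1_le ((3 + 2 * K) * S)). nra. }
    nra. }
  exists c. split; [lra|]. intros x1 x2 s X1 X2 t Hs T1 T2 Ht.
  set (mu := RInt (fun y => rho y 0) x1 x2).
  destruct (oscillator_energy (fun t => X2 t - X1 t) (fun t => u (X2 t) t - u (X1 t) t)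
    (fun t => - M t * (X2 t - X1 t) + 2 * mu) K mu 0 t) as [H _]; try lra.
  - intros; eapply gap_continuous; eassumption.
  - intros; eapply gap_velocity_continuous; eassumption.
  - intros; eapply gap_position_derive; try eassumption; lra.
  - intros; eapply gap_derive; try eassumption; lra.
  - intros r Hr. apply gap_forcing_bound; [lra|apply HK; lra].
  - cbv beta in H. rewrite (traj_start T1), (traj_start T2) in H.
    assert (H1 : (u x2 0 - u x1 0) ^ 2 <= B ^ 2 * (x2 - x1) ^ 2).
    { rewrite <- (pow2_abs (u x2 0 - u x1 0)), <- (pow2_abs (x2 - x1)), <- Rpow_mult_distr.
      apply pow_incr. split; [apply Rabs_pos|apply (fl_lip0 HF)]. }
    assert (H2 : mu ^ 2 <= R0 ^ 2 * (x2 - x1) ^ 2).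
    { rewrite <- (pow2_abs mu), <- (pow2_abs (x2 - x1)), <- Rpow_mult_distr.
      apply pow_incr. split; [apply Rabs_pos|apply initial_mass_bound]. }
    assert (H3 : exp ((3 + 2 * K) * (t - 0)) <= exp ((3 + 2 * K) * S)).
    { apply exp_le. nra. }
    assert (H4 : (X2 t - X1 t) ^ 2 <= c * (x2 - x1) ^ 2).
    { pose proof (pow2_ge_0 (u (X2 t) t - u (X1 t) t)). pose proof (pow2_ge_0 mu).
      pose proof (exp_pos ((3 + 2 * K) * (t - 0))).
      pose proof (pow2_ge_0 (x2 - x1)). pose proof (pow2_ge_0 (u x2 0 - u x1 0)).
      apply Rle_trans with (((x2 - x1) ^ 2 + (u x2 0 - u x1 0) ^ 2 + mu ^ 2) *
         exp ((3 + 2 * K) * (t - 0))); [lra|].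
      replace (c * (x2 - x1) ^ 2) with (((x2 - x1) ^ 2 + B ^ 2 * (x2 - x1) ^ 2 + R0 ^ 2 * (x2 - x1) ^ 2)
        * exp ((3 + 2 * K) * S)) by (unfold c; ring).
      apply Rmult_le_compat; lra. }
    rewrite <- (Rabs_pos_eq c) by lra. rewrite <- Rabs_mult.
    apply Rsqr_le_abs_0. unfold Rsqr.
    assert (c * (x2 - x1) ^ 2 <= c * c * (x2 - x1) ^ 2)
      by (apply Rmult_le_compat_r; [apply pow2_ge_0|nra]).
    lra.
Qed.

(** A trajectory cannot leave the one from 0 by more than a bounded distance, so it
    does not escape to infinity before that one does. *)
Lemma all_trajectories_exist s X0 : 0 < s <= S -> trajectory u 0 s X0 ->
  forall x, exists X, trajectory u x s X.
Proof.
  intros Hs T0 x. destruct gap_lipschitz as [C [HC0 HC]].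
  destruct (trajectory_bounded _ _ _ T0) as [N [HN0 HN]].
  apply (trajectory_exists u ux s x (N + C * Rabs x + Rabs x)).
  - exact Cu.
  - apply (fl_ux HF).
  - lra.
  - intros y t Ht. apply (fl_dux HF). lra.
  - pose proof (Rabs_pos x). nra.
  - intros r X Hr TX.
    pose proof (HC 0 x r X0 X r ltac:(lra) (trajectory_restrict u 0 s r X0 ltac:(lra) T0) TX ltac:(lra)) as H.
    rewrite Rminus_0_r in H. specialize (HN r ltac:(lra)).
    pose proof (Rabs_triang_inv (X r) (X0 r)). pose proof (Rabs_pos x). lra.
Qed.

(** Near infinity the density is too small to stop a collapse: had the gap
    between two neighbours nearly closed at time t, it would close completely at
    some other time below s, while trajectories keep their order up to s. *)
Lemma spreading_at_infinity s (X : R -> R -> R) t : s <= S ->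
  (forall x, trajectory u x s (X x)) -> 0 < t < s ->
  exists eps N, 0 < eps /\ forall x1 x2, x1 < x2 -> N <= x1 \/ x2 <= - N ->
    eps * (x2 - x1) <= X x2 t - X x1 t.
Proof.
  intros Hs T Ht. destruct mass_bounded as [K [HK2 HK]].
  destruct (oscillator_floor K B t s) as [eps [eta [Heps [Heta Hfl]]]]; [lra|lra|].
  destruct (fl_small0 HF Heta) as [N HN].
  exists eps, (Rmax N 0). split; [exact Heps|]. intros x1 x2 Hx Hfar.
  set (mu := RInt (fun y => rho y 0) x1 x2). set (d := x2 - x1).
  assert (Hd : 0 < d) by (unfold d; lra).
  pose proof (T x1) as T1. pose proof (T x2) as T2.
  cut (eps <= / d * (X x2 t - X x1 t)).
  { intros H. apply Rmult_le_reg_l with (/ d); [now apply Rinv_0_lt_compat|].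
    replace (/ d * (eps * d)) with eps by (field; lra). exact H. }
  apply (Hfl (fun t => / d * (X x2 t - X x1 t))
             (fun t => / d * (u (X x2 t) t - u (X x1 t) t))
             (fun t => / d * (- M t * (X x2 t - X x1 t) + 2 * mu)) (/ d * mu)).
  - intros r _. apply (continuous_mult (fun _ => / d) (fun t => X x2 t - X x1 t));
      [apply continuous_const|eapply gap_continuous; eassumption].
  - intros r _. apply (continuous_mult (fun _ => / d) (fun t => u (X x2 t) t - u (X x1 t) t));
      [apply continuous_const|eapply gap_velocity_continuous; eassumption].
  - intros r Hr. apply (is_derive_scal (fun t => X x2 t - X x1 t)).
    eapply gap_position_derive; eassumption.
  - intros r Hr.
    replace (- (/ d * (u (X x2 r) r - u (X x1 r) r)) + / d * (- M r * (X x2 r - X x1 r) + 2 * mu))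
      with (/ d * (- (u (X x2 r) r - u (X x1 r) r) + (- M r * (X x2 r - X x1 r) + 2 * mu))) by ring.
    apply (is_derive_scal (fun t => u (X x2 t) t - u (X x1 t) t)).
    eapply gap_derive; eassumption.
  - intros r Hr. rewrite !Rabs_mult, <- Rmult_plus_distr_l.
    rewrite <- Rmult_assoc, (Rmult_comm K), Rmult_assoc.
    apply Rmult_le_compat_l; [apply Rabs_pos|].
    apply gap_forcing_bound; [lra|apply HK; lra].
  - intros r Hr. apply Rmult_le_pos; [left; now apply Rinv_0_lt_compat|].
    destruct (trajectories_ordered x1 x2 s _ _ Hs T1 T2 Hx) as [L [_ HL]].
    specialize (HL r Hr). pose proof (exp_pos (- L * r)). nra.
  - rewrite (traj_start T1), (traj_start T2). unfold d. field. lra.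
  - rewrite (traj_start T1), (traj_start T2), Rabs_mult.
    rewrite Rabs_pos_eq by (left; now apply Rinv_0_lt_compat).
    apply Rmult_le_reg_l with d; [exact Hd|]. rewrite <- Rmult_assoc, Rinv_r, Rmult_1_l by lra.
    pose proof (fl_lip0 HF x2 x1) as H.
    rewrite (Rabs_pos_eq (x2 - x1)) in H by lra. unfold d. lra.
  - rewrite Rabs_mult, Rabs_pos_eq by (left; now apply Rinv_0_lt_compat).
    apply Rmult_le_reg_l with d; [exact Hd|]. rewrite <- Rmult_assoc, Rinv_r, Rmult_1_l by lra.
    assert (H : Rabs mu <= eta * Rabs (x2 - x1)).
    { apply abs_RInt_le_bound; [apply rho_slice_continuous|].
      rewrite Rmin_left, Rmax_right by lra. intros y Hy.
      rewrite Rabs_pos_eq by (left; apply (fl_pos0 HF)).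
      apply HN. pose_minmax. destruct Hfar.
      - rewrite Rabs_pos_eq; lra.
      - rewrite Rabs_left1; lra. }
    rewrite (Rabs_pos_eq (x2 - x1)) in H by lra. unfold d. lra.
Qed.

(** A continuous map that spreads its arguments at infinity takes every value. *)
Lemma trajectories_cover s (X : R -> R -> R) t : s <= S ->
  (forall x, trajectory u x s (X x)) -> 0 < t < s ->
  forall y, exists x, X x t = y.
Proof.
  intros Hs T Ht y.
  destruct (spreading_at_infinity s X t Hs T Ht) as [eps [N [Heps Hsp]]].
  destruct gap_lipschitz as [C [HC0 HC]].
  set (N' := Rabs N).
  assert (HN : N <= N') by apply Rle_abs. assert (HN0 : 0 <= N') by apply Rabs_pos.
  set (b := N' + (Rabs (y - X N' t) + 1) / eps).
  set (a := - N' - (Rabs (y - X (- N') t) + 1) / eps).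
  assert (Hb : 0 < (Rabs (y - X N' t) + 1) / eps).
  { apply Rdiv_lt_0_compat; [pose proof (Rabs_pos (y - X N' t)); lra|exact Heps]. }
  assert (Ha : 0 < (Rabs (y - X (- N') t) + 1) / eps).
  { apply Rdiv_lt_0_compat; [pose proof (Rabs_pos (y - X (- N') t)); lra|exact Heps]. }
  assert (Hyb : y <= X b t).
  { pose proof (Hsp N' b ltac:(unfold b; lra) ltac:(left; lra)) as H.
    replace (eps * (b - N')) with (Rabs (y - X N' t) + 1) in H by (unfold b; field; lra).
    pose proof (Rle_abs (y - X N' t)). lra. }
  assert (Hya : X a t <= y).
  { pose proof (Hsp a (- N') ltac:(unfold a; lra) ltac:(right; lra)) as H.
    replace (eps * (- N' - a)) with (Rabs (y - X (- N') t) + 1) in H by (unfold a; field; lra).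
    pose proof (Rle_abs (- (y - X (- N') t))) as H'. rewrite Rabs_Ropp in H'. lra. }
  destruct (IVT_gen (fun x => X x t) a b y) as [x [_ Hx]].
  - intros x. apply continuity_pt_filterlim. apply filterlim_locally. intros e.
    assert (He : 0 < e / (C + 1)) by (pose proof (cond_pos e); apply Rdiv_lt_0_compat; lra).
    exists (mkposreal _ He). intros z Hz. change (Rabs (z - x) < e / (C + 1)) in Hz.
    change (Rabs (X z t - X x t) < e).
    eapply Rle_lt_trans; [apply (HC x z s); auto; lra|].
    assert (e / (C + 1) * (C + 1) = e) by (field; lra).
    pose proof (Rabs_pos (z - x)). nra.
  - split.
    + apply Rle_trans with (X a t); [apply Rmin_l|exact Hya].
    + apply Rle_trans with (X b t); [exact Hyb|apply Rmax_r].
  - exists x. exact Hx.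
Qed.

Lemma trajectories_increasing s (X : R -> R -> R) t a b : s <= S ->
  (forall x, trajectory u x s (X x)) -> 0 <= t <= s -> a < b -> X a t < X b t.
Proof.
  intros Hs T Ht Hab.
  destruct (trajectories_ordered a b s (X a) (X b) Hs (T a) (T b) Hab) as [L [_ HL]].
  specialize (HL t Ht). pose proof (exp_pos (- L * t)). nra.
Qed.

(** The mass between two trajectories is constant, and since they cover the line
    it exhausts the mass at both times. *)
Lemma mass_conserved_while_trajectories s (X : R -> R -> R) t : s <= S ->
  (forall x, trajectory u x s (X x)) -> 0 < t < s -> M t = M0.
Proof.
  intros Hs T Ht. apply Rminus_diag_uniq, Rabs_eq_0, Rle_antisym; [|apply Rabs_pos].
  apply Rnot_lt_le. intros Hpos. set (e := Rabs (M t - M0)) in *.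
  destruct (proj1 (is_line_spec_continuous _ _ (rho_slice_continuous t))
     (proj1 (mass_and_force t ltac:(lra))) (e / 2)) as [N1 H1]; [lra|].
  destruct (proj1 (is_line_spec_continuous _ _ (rho_slice_continuous 0))
     (fl_line0 HF) (e / 2)) as [N2 H2]; [lra|].
  destruct (trajectories_cover s X t Hs T Ht (- N1 - 1)) as [a Ha].
  destruct (trajectories_cover s X t Hs T Ht (N1 + 1)) as [b Hb].
  set (a' := Rmin a (- N2 - 1)). set (b' := Rmax b (N2 + 1)).
  assert (Hmono : forall p q, p <= q -> X p t <= X q t).
  { intros p q [Hpq|Hpq]; [|subst; lra]. left.
    apply (trajectories_increasing s X t p q Hs T); lra. }
  pose proof (Hmono a' a (Rmin_l _ _)). pose proof (Hmono b b' (Rmax_l _ _)).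
  assert (a' < - N2) by (unfold a'; pose proof (Rmin_r a (- N2 - 1)); lra).
  assert (N2 < b') by (unfold b'; pose proof (Rmax_r b (N2 + 1)); lra).
  specialize (H1 (X a' t) (X b' t) ltac:(lra) ltac:(lra)).
  specialize (H2 a' b' ltac:(lra) ltac:(lra)).
  rewrite (mass_between_trajectories a' b' s) in H1 by (auto; lra).
  change (Rabs (RInt (fun y : R => rho y 0) a' b' - M t) < e / 2) in H1.
  change (Rabs (RInt (fun y : R => rho y 0) a' b' - M0) < e / 2) in H2.
  assert (e < e); [|lra]. unfold e at 1. apply Rabs_def2 in H1, H2. apply Rabs_def1; lra.
Qed.

(** While the trajectory from 0 exists, any partial mass is at most M0, so the force
    along it grows at most linearly and it stays bounded. *)
Theorem trajectories_exist : forall x, exists X, trajectory u x S X.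
Proof.
  destruct mass_bounded as [K [HK2 HK]].
  destruct (cts2_bounded A S (fl_A HF)) as [a [Ha0 Ha]].
  assert (HM0 : 0 <= M0).
  { eapply Rle_trans; [apply Rabs_pos|].
    apply (RInt_positive_bound (fun y => rho y 0) M0 0 0).
    - apply rho_slice_continuous.
    - apply (fl_pos0 HF).
    - apply (fl_line0 HF). }
  set (K' := K + a + 2 * M0).
  set (c := (u 0 0 ^ 2 + 1) * exp ((3 + 2 * K') * S)).
  assert (Hc : 1 <= c).
  { unfold c. pose proof (pow2_ge_0 (u 0 0)).
    assert (1 <= exp ((3 + 2 * K') * S)).
    { pose proof (exp_ineq1_le ((3 + 2 * K') * S)). unfold K' in *. nra. }
    nra. }
  assert (T0 : exists X, trajectory u 0 S X).
  { apply (trajectory_exists u ux S 0 c).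
    - exact Cu.
    - apply (fl_ux HF).
    - exact HS.
    - apply (fl_dux HF).
    - rewrite Rabs_R0. lra.
    - intros s X0 Hs TX0.
      destruct (choice (fun x X => trajectory u x s X)) as [X T].
      { intros x. exact (all_trajectories_exist s X0 Hs TX0 x). }
      destruct (oscillator_energy X0 (fun t => u (X0 t) t) (fun t => A (X0 t) t) K' 1 0 s)
        as [H _]; try (unfold K'; lra).
      + intros t _. apply (traj_continuous TX0).
      + intros t _. eapply trajectory_velocity_continuous; eassumption.
      + apply (traj_derive TX0).
      + intros t Ht. apply (velocity_derive 0 s X0); auto; lra.
      + intros t Ht. rewrite Rabs_R1.
        destruct (trajectories_cover s X t ltac:(lra) T Ht 0) as [p Hp].
        destruct (trajectories_cover s X t ltac:(lra) T Ht (X0 t)) as [q Hq].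
        assert (HI : Rabs (RInt (fun y => rho y t) 0 (X0 t)) <= M0).
        { rewrite <- Hq, <- Hp at 1.
          rewrite (mass_between_trajectories p q s) by (auto; lra).
          apply RInt_positive_bound.
          - apply rho_slice_continuous.
          - apply (fl_pos0 HF).
          - apply (fl_line0 HF). }
        assert (HA0 : Rabs (A 0 t) <= a).
        { apply Ha; [rewrite Rabs_R0; lra|rewrite Rabs_pos_eq; lra]. }
        pose proof (proj2 (mass_and_force t ltac:(lra)) (X0 t) 0) as E.
        rewrite Rminus_0_r in E.
        assert (HXM : Rabs (X0 t * M t) <= K * Rabs (X0 t)).
        { rewrite Rabs_mult, Rmult_comm. apply Rmult_le_compat_r; [apply Rabs_pos|apply HK; lra]. }
        apply Rle_trans with (a + 2 * M0 + K * Rabs (X0 t)).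
        * apply Rabs_le_between in HI, HA0, HXM. apply Rabs_le. lra.
        * unfold K'. pose proof (Rabs_pos (X0 t)). nra.
      + rewrite (traj_start TX0) in H.
        assert (H3 : exp ((3 + 2 * K') * (s - 0)) <= exp ((3 + 2 * K') * S)).
        { apply exp_le. unfold K'. nra. }
        assert (H4 : X0 s ^ 2 <= c).
        { unfold c. pose proof (pow2_ge_0 (u 0 0)). pose proof (pow2_ge_0 (u (X0 s) s)).
          pose proof (exp_pos ((3 + 2 * K') * (s - 0))). nra. }
        apply Rabs_le. split; nra. }
  destruct T0 as [X0 T0]. apply (all_trajectories_exist S X0); [lra|exact T0].
Qed.

End Flow.

(** * The explicit motion *)

Set Implicit Arguments.

(** g is the response of y'' + y' + M y to a unit initial velocity. *)
Record impulse_response (M : R) (g dg : R -> R) : Prop := {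
  imp_derive : forall t, is_derive g t (dg t);
  imp_derive2 : forall t, is_derive dg t (- dg t - M * g t);
  imp_0 : g 0 = 0;
  imp_d0 : dg 0 = 1
}.

Unset Implicit Arguments.

Ltac use_derivatives :=
  repeat match goal with
  | H : is_derive ?f ?t ?l |- context [Derive (fun x => ?f x) ?t] =>
      replace (Derive (fun x => f x) t) with l by (symmetry; apply is_derive_unique, H)
  end.

(** The solution of y'' + y' + M y = b with y(0) = a and y'(0) = p; dg + g is the
    homogeneous solution that starts from 1 at rest. *)
Definition resp (M : R) (g dg : R -> R) (a p b t : R) : R :=
  a * (dg t + g t) + p * g t + b * ((1 - dg t - g t) / M).

Definition dresp (M : R) (g dg : R -> R) (a p b t : R) : R :=
  - M * a * g t + p * dg t + b * g t.

Section Response.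

Variables (M : R) (g dg : R -> R).
Hypothesis HM : 0 < M.
Hypothesis Hg : impulse_response M g dg.

Notation Y := (resp M g dg).
Notation dY := (dresp M g dg).

Lemma resp_derive a p b t : is_derive (Y a p b) t (dY a p b t).
Proof.
  pose proof (imp_derive Hg t) as H1. pose proof (imp_derive2 Hg t) as H2.
  unfold resp, dresp. auto_derive.
  - repeat split; eexists; eassumption.
  - use_derivatives. field. lra.
Qed.

Lemma dresp_derive a p b t :
  is_derive (dY a p b) t (- dY a p b t - M * Y a p b t + b).
Proof.
  pose proof (imp_derive Hg t) as H1. pose proof (imp_derive2 Hg t) as H2.
  unfold resp, dresp. auto_derive.
  - repeat split; eexists; eassumption.
  - use_derivatives. field. lra.
Qed.

Lemma resp_0 a p b : Y a p b 0 = a.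
Proof. unfold resp. rewrite (imp_0 Hg), (imp_d0 Hg). field. lra. Qed.

Lemma dresp_0 a p b : dY a p b 0 = p.
Proof. unfold dresp. rewrite (imp_0 Hg), (imp_d0 Hg). ring. Qed.

Lemma resp_continuous a p b t : continuous (Y a p b) t.
Proof.
  eapply is_derive_continuous; apply resp_derive.
Qed.

Lemma dresp_continuous a p b t : continuous (dY a p b) t.
Proof.
  eapply is_derive_continuous; apply dresp_derive.
Qed.

Lemma resp_unique (z z1 : R -> R) (a p b s : R) : 0 <= s ->
  (forall t, 0 <= t <= s -> continuous z t) ->
  (forall t, 0 <= t <= s -> continuous z1 t) ->
  (forall t, 0 < t < s -> is_derive z t (z1 t)) ->
  (forall t, 0 < t < s -> is_derive z1 t (- z1 t - M * z t + b)) ->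
  z 0 = a -> z1 0 = p -> z s = Y a p b s /\ z1 s = dY a p b s.
Proof.
  intros Hs Cz Cz1 Dz Dz1 z0 z10.
  destruct (oscillator_zero (fun t => z t - Y a p b t) (fun t => z1 t - dY a p b t)
    (fun t => - M * (z t - Y a p b t)) M 0 s) as [H1 H2]; try lra.
  - intros t Ht. apply (continuous_minus z (Y a p b)); [auto|apply resp_continuous].
  - intros t Ht. apply (continuous_minus z1 (dY a p b)); [auto|apply dresp_continuous].
  - intros t Ht. apply (is_derive_minus z (Y a p b)); [auto|apply resp_derive].
  - intros t Ht.
    replace (- (z1 t - dY a p b t) + - M * (z t - Y a p b t))
      with ((- z1 t - M * z t + b) - (- dY a p b t - M * Y a p b t + b)) by ring.
    apply (is_derive_minus z1 (dY a p b)); [auto|apply dresp_derive].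
  - intros t Ht. rewrite Rabs_mult, Rabs_Ropp, Rabs_pos_eq by lra. lra.
  - rewrite resp_0. lra.
  - rewrite dresp_0. lra.
Qed.

(** Without oscillation all three parts of the response are nonnegative, because
    dg + g decreases from 1. *)
Lemma resp_positive p b t : 0 <= t ->
  (forall s, 0 <= s -> 0 <= g s) -> 0 < dg t + g t -> 0 <= p -> 0 <= b ->
  0 < Y 1 p b t.
Proof.
  intros Ht Pg Pf Hp Hb.
  assert (Hf : dg t + g t <= 1).
  { pose proof (increment_le (Y 1 0 0) (dY 1 0 0) 0 t 0 Ht) as H.
    assert (Y 1 0 0 t - Y 1 0 0 0 <= 0 * (t - 0)).
    { apply H.
      - intros s _. apply resp_continuous.
      - intros s _. apply resp_derive.
      - intros s Hs. unfold dresp. specialize (Pg s ltac:(lra)). nra. }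
    rewrite resp_0 in H0. unfold resp in H0. lra. }
  specialize (Pg t Ht). unfold resp.
  assert (0 <= (1 - dg t - g t) / M) by (apply Rdiv_le_0_compat; lra).
  nra.
Qed.

End Response.

Section ResponseContinuity.

Variables (M : R) (g dg : R -> R).
Hypothesis Hg : impulse_response M g dg.
Variables a p b : R -> R.
Hypothesis Ca : forall x, continuous a x.
Hypothesis Cp : forall x, continuous p x.
Hypothesis Cb : forall x, continuous b x.

Let Cg : forall t, continuous g t.
Proof. intros t. eapply is_derive_continuous, (imp_derive Hg). Qed.

Let Cdg : forall t, continuous dg t.
Proof. intros t. eapply is_derive_continuous, (imp_derive2 Hg). Qed.

Lemma cts2_resp : cts2 (fun x t => resp M g dg (a x) (p x) (b x) t).
Proof. unfold resp, Rdiv. solve_cts2. Qed.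

Lemma cts2_dresp : cts2 (fun x t => dresp M g dg (a x) (p x) (b x) t).
Proof. unfold dresp. solve_cts2. Qed.

End ResponseContinuity.

(** Internal forces cancel, so the centre of mass moves as c + v (1 - exp (- t)).
    Relative to it the label x is an oscillator driven by the excess 2 m0 x - M of
    the mass on its left over the mass on its right. *)
Definition motion M g dg (c v : R) (u0 m0 : R -> R) (x t : R) : R :=
  c + v * (1 - exp (- t)) + resp M g dg (x - c) (u0 x - v) (2 * m0 x - M) t.

Definition motion_velocity M g dg (c v : R) (u0 m0 : R -> R) (x t : R) : R :=
  v * exp (- t) + dresp M g dg (x - c) (u0 x - v) (2 * m0 x - M) t.

Definition jacobian M g dg (du0 rho0 : R -> R) (x t : R) : R :=
  resp M g dg 1 (du0 x) (2 * rho0 x) t.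

Definition jacobian_rate M g dg (du0 rho0 : R -> R) (x t : R) : R :=
  dresp M g dg 1 (du0 x) (2 * rho0 x) t.

Section Motion.

Variables (M : R) (g dg : R -> R).
Hypothesis HM : 0 < M.
Hypothesis Hg : impulse_response M g dg.
Variables (c v : R) (u0 du0 rho0 m0 : R -> R).
Hypothesis Du0 : forall x, is_derive u0 x (du0 x).
Hypothesis Dm0 : forall x, is_derive m0 x (rho0 x).

Notation X := (motion M g dg c v u0 m0).
Notation V := (motion_velocity M g dg c v u0 m0).
Notation J := (jacobian M g dg du0 rho0).
Notation J1 := (jacobian_rate M g dg du0 rho0).

Lemma motion_derive_x x t : is_derive (fun x => X x t) x (J x t).
Proof.
  pose proof (Du0 x) as H1. pose proof (Dm0 x) as H2.
  unfold motion, jacobian, resp. auto_derive.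
  - repeat split; eexists; eassumption.
  - use_derivatives. field. lra.
Qed.

Lemma motion_velocity_derive_x x t : is_derive (fun x => V x t) x (J1 x t).
Proof.
  pose proof (Du0 x) as H1. pose proof (Dm0 x) as H2.
  unfold motion_velocity, jacobian_rate, dresp. auto_derive.
  - repeat split; eexists; eassumption.
  - use_derivatives. ring.
Qed.

Lemma motion_derive_t x t : is_derive (X x) t (V x t).
Proof.
  unfold motion, motion_velocity.
  apply (is_derive_plus (fun t => c + v * (1 - exp (- t)))).
  - auto_derive; [auto|]. ring.
  - now apply resp_derive.
Qed.

Lemma motion_velocity_derive_t x t :
  is_derive (V x) t
    (- V x t - (M - 2 * m0 x + M * X x t - M * (c + v * (1 - exp (- t))))).
Proof.
  unfold motion, motion_velocity.
  match goal with |- is_derive _ _ ?l => replace l with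
    (- v * exp (- t) + (- dresp M g dg (x - c) (u0 x - v) (2 * m0 x - M) t
      - M * resp M g dg (x - c) (u0 x - v) (2 * m0 x - M) t + (2 * m0 x - M))) by ring end.
  apply (is_derive_plus (fun t => v * exp (- t))).
  - auto_derive; [auto|]. ring.
  - now apply dresp_derive.
Qed.

Lemma jacobian_derive_t x t : is_derive (J x) t (J1 x t).
Proof. now apply resp_derive. Qed.

Lemma motion_0 x : X x 0 = x.
Proof. unfold motion. rewrite resp_0, Ropp_0, exp_0 by auto. ring. Qed.

Lemma motion_velocity_0 x : V x 0 = u0 x.
Proof. unfold motion_velocity. rewrite dresp_0, Ropp_0, exp_0 by auto. ring. Qed.

Lemma jacobian_0 x : J x 0 = 1.
Proof. unfold jacobian. now apply resp_0. Qed.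

Lemma resp_difference a p b a' p' b' t :
  resp M g dg a p b t - resp M g dg a' p' b' t = resp M g dg (a - a') (p - p') (b - b') t.
Proof. unfold resp. field. lra. Qed.

Hypothesis Crho0 : forall x, continuous rho0 x.
Hypothesis Cdu0 : forall x, continuous du0 x.

Lemma cts2_jacobian : cts2 J.
Proof.
  apply (cts2_resp M g dg Hg (fun _ => 1) du0 (fun x => 2 * rho0 x)); intros; solve_continuous.
Qed.

Lemma cts2_jacobian_rate : cts2 J1.
Proof.
  apply (cts2_dresp M g dg Hg (fun _ => 1) du0 (fun x => 2 * rho0 x)); intros; solve_continuous.
Qed.

Lemma cts2_motion : cts2 X.
Proof.
  assert (Cu0 : forall x, continuous u0 x) by (intros; eapply is_derive_continuous, Du0).
  assert (Cm0 : forall x, continuous m0 x) by (intros; eapply is_derive_continuous, Dm0).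
  apply cts2_plus; [solve_cts2|].
  apply (cts2_resp M g dg Hg (fun x => x - c) (fun x => u0 x - v) (fun x => 2 * m0 x - M));
    intros; solve_continuous.
Qed.

Lemma cts2_motion_velocity : cts2 V.
Proof.
  assert (Cu0 : forall x, continuous u0 x) by (intros; eapply is_derive_continuous, Du0).
  assert (Cm0 : forall x, continuous m0 x) by (intros; eapply is_derive_continuous, Dm0).
  apply cts2_plus; [solve_cts2|].
  apply (cts2_dresp M g dg Hg (fun x => x - c) (fun x => u0 x - v) (fun x => 2 * m0 x - M));
    intros; solve_continuous.
Qed.

Hypothesis Lrho0 : is_line rho0 M.
Hypothesis Lc : is_line (fun x => x * rho0 x) (M * c).
Hypothesis Lv : is_line (fun x => u0 x * rho0 x) (M * v).
Hypothesis Hm0 : forall z, is_left_mass rho0 z (m0 z).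

Lemma RInt_rho0 a b : RInt rho0 a b = m0 b - m0 a.
Proof.
  apply is_RInt_unique. apply (is_RInt_derive m0 rho0); auto.
Qed.

(** The forces - sgn between pairs of particles add up to zero: (2 m - M) dm is the differential of m^2 - M m, which
    vanishes at both ends m = 0 and m = M. *)
Lemma self_force_balance : is_line (fun x => (2 * m0 x - M) * rho0 x) 0.
Proof.
  assert (Cm0 : forall x, continuous m0 x).
  { intros x. eapply is_derive_continuous; apply Dm0. }
  assert (HI : forall a b, is_RInt (fun x => (2 * m0 x - M) * rho0 x) a b
     ((m0 b ^ 2 - M * m0 b) - (m0 a ^ 2 - M * m0 a))).
  { intros a b. apply (is_RInt_derive (fun x => m0 x ^ 2 - M * m0 x)).
    - intros x _. pose proof (Dm0 x) as H. auto_derive; [repeat split; eexists; eassumption|].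
      use_derivatives. ring.
    - intros x _. solve_continuous. }
  apply is_line_spec. intros e He.
  set (d := Rmin 1 (e / 4 / (M + 1))).
  assert (Hd : 0 < d /\ d <= 1 /\ d * (M + 1) <= e / 4).
  { unfold d. assert (0 < e / 4 / (M + 1)) by (apply Rdiv_lt_0_compat; lra).
    split; [apply Rmin_glb_lt; lra|]. split; [apply Rmin_l|].
    pose proof (Rmin_r 1 (e / 4 / (M + 1))).
    assert (e / 4 / (M + 1) * (M + 1) = e / 4) by (field; lra). nra. }
  destruct (proj1 (is_line_spec_continuous rho0 M Crho0) Lrho0 (d / 2)) as [N1 H1]; [lra|].
  destruct (Hm0 0 (d / 2)) as [N2 H2]; [lra|].
  exists (Rmax N1 N2). intros a b Ha Hb.
  pose_minmax.
  eexists. split; [apply HI|].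
  specialize (H1 a b ltac:(lra) ltac:(lra)). specialize (H2 a ltac:(lra)).
  rewrite RInt_rho0 in H1, H2.
  assert (Ga : Rabs (m0 a) <= d) by (apply Rabs_def2 in H2; apply Rabs_le; lra).
  assert (Gb : Rabs (m0 b - M) <= d).
  { apply Rabs_def2 in H1, H2. apply Rabs_le; lra. }
  apply Rabs_le_between in Ga, Gb.
  replace (m0 b ^ 2 - M * m0 b - (m0 a ^ 2 - M * m0 a) - 0)
    with ((m0 b - M) * (m0 b - M) + M * (m0 b - M) - m0 a * m0 a + M * m0 a) by ring.
  assert ((m0 b - M) * (m0 b - M) <= d) by nra.
  assert (m0 a * m0 a <= d) by nra.
  pose proof (Rle_0_sqr (m0 b - M)). pose proof (Rle_0_sqr (m0 a)). unfold Rsqr in *.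
  apply Rabs_def1; nra.
Qed.

Lemma is_line_plus f1 f2 l1 l2 : is_line f1 l1 -> is_line f2 l2 ->
  is_line (fun x => f1 x + f2 x) (l1 + l2).
Proof. intros H1 H2. exact (is_RInt_gen_plus f1 f2 l1 l2 H1 H2). Qed.

Lemma is_line_scal f k l : is_line f l -> is_line (fun x => k * f x) (k * l).
Proof. intros H. exact (is_RInt_gen_scal f k l H). Qed.

Lemma is_line_ext f1 f2 l : (forall x, f1 x = f2 x) -> is_line f1 l -> is_line f2 l.
Proof.
  intros E H. apply (is_RInt_gen_ext f1 f2); [|exact H].
  apply filter_forall. intros ab x _. apply E.
Qed.

(** By the choice of c and v and by the balance of the internal forces, the motion
    relative to the centre has mean zero. *)
Lemma motion_first_moment t :
  is_line (fun x => X x t * rho0 x) (M * (c + v * (1 - exp (- t)))).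
Proof.
  set (K := c + v * (1 - exp (- t))).
  set (f := dg t + g t).
  pose proof (is_line_scal _ (K - f * c - g t * v) _ Lrho0) as H0.
  pose proof (is_line_scal _ f _ Lc) as H1.
  pose proof (is_line_scal _ (g t) _ Lv) as H2.
  pose proof (is_line_scal _ ((1 - f) / M) _ self_force_balance) as H3.
  pose proof (is_line_plus _ _ _ _ (is_line_plus _ _ _ _ (is_line_plus _ _ _ _ H0 H1) H2) H3) as H.
  match type of H with is_line _ ?l => replace l with (M * K) in H by (field; lra) end.
  revert H. apply is_line_ext. intros x. unfold motion, resp, K, f. field. lra.
Qed.

End Motion.

(** * Initial data *)

Set Implicit Arguments.

(** M, c and v are the mass, the centre of mass and the mean velocity of the data. *)
Record cauchy_data (delta B R0 M c v : R) (rho0 drho0 u0 du0 m0 : R -> R) : Prop := {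
  cd_delta : 0 < delta;
  cd_pos : forall x, 0 < rho0 x;
  cd_drho : forall x, is_derive rho0 x (drho0 x);
  cd_drho_continuous : forall x, continuous drho0 x;
  cd_du : forall x, is_derive u0 x (du0 x);
  cd_du_continuous : forall x, continuous du0 x;
  cd_du_bound : forall x, Rabs (du0 x) <= B;
  cd_decay : forall x, Rpower (1 + x ^ 2) ((2 + delta) / 2) * rho0 x <= R0;
  cd_mass : is_line rho0 M;
  cd_center : is_line (fun x => x * rho0 x) (M * c);
  cd_momentum : is_line (fun x => u0 x * rho0 x) (M * v);
  cd_left_mass : forall z, is_left_mass rho0 z (m0 z);
  cd_dm : forall x, is_derive m0 x (rho0 x)
}.

Unset Implicit Arguments.

Section Data.

Variables (delta : R) (rho0 : R -> R) (R0 : R).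
Hypothesis delta_pos : 0 < delta.
Hypothesis rho0_pos : forall x, 0 < rho0 x.
Hypothesis decay : forall x, Rpower (1 + x ^ 2) ((2 + delta) / 2) * rho0 x <= R0.

Lemma decay_quadratic x : (1 + x ^ 2) * rho0 x <= R0.
Proof.
  eapply Rle_trans; [|apply (decay x)].
  apply Rmult_le_compat_r; [left; apply rho0_pos|].
  pose proof (pow2_ge_0 x).
  rewrite <- (Rpower_1 (1 + x ^ 2)) at 1 by lra.
  destruct (Req_dec (x ^ 2) 0) as [E|E].
  - rewrite E, Rplus_0_r. unfold Rpower. rewrite ln_1, !Rmult_0_r. lra.
  - apply Rle_Rpower; lra.
Qed.

Lemma density_bounded x : rho0 x <= R0.
Proof.
  pose proof (decay_quadratic x). pose proof (pow2_ge_0 x). pose proof (rho0_pos x). nra.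
Qed.

Lemma density_vanishes e : 0 < e -> exists N, forall x, N <= Rabs x -> rho0 x <= e.
Proof.
  intros He. exists (Rabs R0 / e + 1). intros x Hx.
  pose proof (decay_quadratic x) as H. rewrite <- (pow2_abs x) in H.
  pose proof (Rle_abs R0). pose proof (rho0_pos x).
  assert (Rabs R0 / e * e = Rabs R0) by (field; lra).
  assert (0 <= Rabs R0 / e) by (apply Rdiv_le_0_compat; [apply Rabs_pos|lra]).
  apply Rnot_lt_le. intros Hlt.
  assert (Rabs R0 / e < 1 + Rabs x ^ 2) by nra.
  assert (Rabs R0 / e * e < (1 + Rabs x ^ 2) * rho0 x) by nra. lra.
Qed.

(** The decay gives the majorant C R0 (1 / (1 + x^2) + |x| (1 + x^2)^(-1 - delta / 2)),
    which has an elementary bounded primitive on the half-line. *)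
Lemma weighted_integrable (f : R -> R) (C : R) :
  (forall x, continuous f x) -> (forall x, Rabs (f x) <= C * (1 + Rabs x) * rho0 x) ->
  exists l, is_line f l.
Proof.
  intros Cf Hf.
  assert (HC : 0 <= C).
  { specialize (Hf 0). rewrite Rabs_R0 in Hf. pose proof (Rabs_pos (f 0)). pose proof (rho0_pos 0).
    apply Rnot_lt_le. intros Hlt. nra. }
  assert (HR0 : 0 < R0) by (eapply Rlt_le_trans; [apply (rho0_pos 0)|apply density_bounded]).
  set (P := fun x => exp (- (delta / 2) * ln (1 + x ^ 2))).
  apply (line_dominated f (fun x => C * R0 * (atan x - P x / delta))
    (fun x => C * R0 * (/ (1 + x ^ 2) + x * P x / (1 + x ^ 2))) (C * R0 * (PI / 2 + / delta))); auto.
  - intros x. pose proof (pow2_ge_0 x). unfold P. auto_derive.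
    + simpl in *. lra.
    + change (x ^ 2) with (x * (x * 1)) in *. field. split; lra.
  - intros x. eapply Rle_trans; [apply Hf|].
    pose proof (pow2_ge_0 x). pose proof (Rabs_pos x).
    rewrite pow2_abs. set (w := 1 + x ^ 2) in *.
    assert (Hw : 1 <= w) by (unfold w; lra).
    assert (HP : P (Rabs x) = / Rpower w ((2 + delta) / 2) * w).
    { unfold P. rewrite pow2_abs. fold w. unfold Rpower. rewrite <- exp_Ropp.
      rewrite <- (exp_ln w) at 3 by lra. rewrite <- exp_plus. f_equal. field. }
    assert (Hp : 0 < Rpower w ((2 + delta) / 2)) by apply exp_pos.
    rewrite HP.
    replace (C * R0 * (/ w + Rabs x * (/ Rpower w ((2 + delta) / 2) * w) / w))
      with (C * (R0 / w + Rabs x * (R0 / Rpower w ((2 + delta) / 2)))) by (field; split; lra).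
    rewrite Rmult_assoc. apply Rmult_le_compat_l; [exact HC|].
    assert (G1 : rho0 x <= R0 / w).
    { apply Rmult_le_reg_r with w; [lra|]. unfold Rdiv. rewrite Rmult_assoc, Rinv_l, Rmult_1_r by lra.
      rewrite Rmult_comm. apply decay_quadratic. }
    assert (G2 : rho0 x <= R0 / Rpower w ((2 + delta) / 2)).
    { apply Rmult_le_reg_r with (Rpower w ((2 + delta) / 2)); [exact Hp|]. unfold Rdiv at 2.
      rewrite Rmult_assoc, Rinv_l, Rmult_1_r by lra. rewrite Rmult_comm. apply decay. }
    nra.
  - intros x Hx. rewrite Rabs_mult, Rabs_pos_eq by nra.
    apply Rmult_le_compat_l; [nra|].
    pose proof (atan_bound x) as [A1 A2]. pose proof (pow2_ge_0 x).
    assert (HP : 0 < P x <= 1).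
    { split; [apply exp_pos|]. unfold P. apply Rle_trans with (exp 0); [|rewrite exp_0; lra].
      assert (0 <= ln (1 + x ^ 2)) by (rewrite <- ln_1; apply ln_le; lra).
      apply exp_le. nra. }
    assert (0 < P x / delta <= / delta).
    { assert (0 < / delta) by now apply Rinv_0_lt_compat. unfold Rdiv. split; nra. }
    apply Rabs_le. lra.
Qed.

End Data.

Lemma cauchy_data_exists (delta B R0 : R) (rho0 u0 : R -> R) :
  class_C1 rho0 -> class_C1 u0 -> (forall x, 0 < rho0 x) -> 0 < delta ->
  (forall x, Rabs (Derive u0 x) <= B) ->
  (forall x, Rpower (1 + x ^ 2) ((2 + delta) / 2) * rho0 x <= R0) ->
  0 < integral_line rho0 /\ exists c v m0,
  cauchy_data delta B R0 (integral_line rho0) c v rho0 (Derive rho0) u0 (Derive u0) m0.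
Proof.
  intros [Dr Cdr] [Du Cdu] Pr Hd HB HR.
  assert (Cr : forall x, continuous rho0 x) by (intros; now apply (@ex_derive_continuous R_AbsRing R_NormedModule)).
  assert (Cu : forall x, continuous u0 x) by (intros; now apply (@ex_derive_continuous R_AbsRing R_NormedModule)).
  destruct (weighted_integrable delta rho0 R0 Hd Pr HR rho0 1 Cr) as [M HM].
  { intros x. pose proof (Rabs_pos x). pose proof (Pr x). rewrite Rabs_pos_eq by lra. nra. }
  assert (EM : integral_line rho0 = M) by exact (is_RInt_gen_unique _ _ HM).
  rewrite EM.
  assert (PM : 0 < M).
  { apply Rlt_le_trans with (RInt rho0 0 1).
    - apply RInt_gt_0; [lra| |]; auto.
    - eapply Rle_trans; [apply Rle_abs|]. now apply RInt_positive_bound. }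
  split; [exact PM|].
  destruct (weighted_integrable delta rho0 R0 Hd Pr HR (fun x => x * rho0 x) 1) as [l1 H1].
  { intros x. solve_continuous. }
  { intros x. pose proof (Rabs_pos x). pose proof (Pr x). rewrite Rabs_mult, (Rabs_pos_eq (rho0 x)) by lra. nra. }
  assert (B0 : 0 <= B) by (eapply Rle_trans; [apply Rabs_pos|apply (HB 0)]).
  destruct (weighted_integrable delta rho0 R0 Hd Pr HR (fun x => u0 x * rho0 x) (Rabs (u0 0) + B)) as [l2 H2].
  { intros x. solve_continuous. }
  { intros x. pose proof (Pr x). rewrite Rabs_mult, (Rabs_pos_eq (rho0 x)) by lra.
    apply Rmult_le_compat_r; [lra|].
    assert (Hl : Rabs (u0 x - u0 0) <= B * Rabs (x - 0)).
    { destruct (Rle_dec 0 x).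
      - rewrite (Rabs_pos_eq (x - 0)) by lra.
        apply (increment_abs u0 (Derive u0)); auto. intros; now apply Derive_correct.
      - rewrite Rabs_minus_sym, (Rabs_left1 (x - 0)) by lra.
        replace (- (x - 0)) with (0 - x) by ring.
        apply (increment_abs u0 (Derive u0)); auto; [lra|]. intros; now apply Derive_correct. }
    rewrite Rminus_0_r in Hl. pose proof (Rabs_triang_inv (u0 x) (u0 0)).
    pose proof (Rabs_pos (u0 0)). pose proof (Rabs_pos x). nra. }
  destruct (left_mass_exists rho0 M Cr HM) as [m Hm].
  exists (l1 / M), (l2 / M), (fun z => m + RInt rho0 0 z).
  split; auto.
  - intros x. now apply Derive_correct.
  - intros x. now apply Derive_correct.
  - replace (M * (l1 / M)) with l1 by (field; lra). exact H1.
  - replace (M * (l2 / M)) with l2 by (field; lra). exact H2.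
  - intros z. now apply is_left_mass_shift.
  - intros x. replace (rho0 x) with (0 + rho0 x) by ring.
    apply (is_derive_plus (fun _ => m)); [apply @is_derive_const|now apply is_derive_primitive].
Qed.

(** * Solutions follow the explicit motion *)

Definition follows_motion M g dg c v (rho0 u0 du0 m0 : R -> R) (rho u : R -> R -> R) (t : R) : Prop :=
  (forall x, u (motion M g dg c v u0 m0 x t) t = motion_velocity M g dg c v u0 m0 x t) /\
  (forall x, rho (motion M g dg c v u0 m0 x t) t * jacobian M g dg du0 rho0 x t = rho0 x) /\
  (forall x, 0 < jacobian M g dg du0 rho0 x t) /\
  (forall y, exists x, motion M g dg c v u0 m0 x t = y).

(** The gaps solve the oscillator equation with the conserved mass, so the
    trajectories differ from the explicit motion by a displacement common to all
    labels.  A common displacement does not alter the force, hence it solves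
    w'' + w' = 0 from zero data and vanishes. *)
Lemma flow_follows_motion (delta S B R0 M c v : R) g dg (rho0 drho0 u0 du0 m0 : R -> R)
  (rho u rx rt ux ut A : R -> R -> R) :
  0 < M -> impulse_response M g dg ->
  cauchy_data delta B R0 M c v rho0 drho0 u0 du0 m0 ->
  flow S B R0 M rho u rx rt ux ut A ->
  (forall x, rho x 0 = rho0 x) -> (forall x, u x 0 = u0 x) ->
  forall t, 0 < t < S -> follows_motion M g dg c v rho0 u0 du0 m0 rho u t.
Proof.
  intros HM Hg HD HF Er Eu.
  set (X := motion M g dg c v u0 m0). set (V := motion_velocity M g dg c v u0 m0).
  assert (Crho0 : forall x, continuous rho0 x) by (intros x; eapply is_derive_continuous; apply (cd_drho HD)).
  destruct (choice (fun x X => trajectory u x S X)) as [Y T].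
  { intros x. eapply trajectories_exist; eassumption. }
  assert (HS := fl_S HF).
  assert (EI : forall a b, RInt (fun y => rho y 0) a b = m0 b - m0 a).
  { intros a b. rewrite (RInt_ext _ rho0) by (intros; apply Er).
    eapply RInt_rho0; [apply (cd_dm HD)|exact Crho0]. }
  assert (EM : forall t, 0 < t < S -> integral_line (fun y => rho y t) = M).
  { intros t Ht. eapply mass_conserved_while_trajectories; try eassumption. lra. }
  assert (E1 : forall x1 x2 t, 0 <= t <= S -> Y x2 t - Y x1 t = X x2 t - X x1 t).
  { intros x1 x2 t Ht.
    destruct (resp_unique M g dg HM Hg (fun t => Y x2 t - Y x1 t)
      (fun t => u (Y x2 t) t - u (Y x1 t) t)
      (x2 - x1) (u0 x2 - u0 x1) (2 * (m0 x2 - m0 x1)) t) as [H _]; try lra.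
    - intros r _. eapply gap_continuous; eauto.
    - intros r _. eapply gap_velocity_continuous; eauto.
    - intros r Hr. eapply (gap_position_derive u x1 x2 S); eauto; lra.
    - intros r Hr. rewrite <- EI, <- (EM r) by lra.
      match goal with |- is_derive _ _ ?l => replace l with
        (- (u (Y x2 r) r - u (Y x1 r) r) + (- integral_line (fun y => rho y r) * (Y x2 r - Y x1 r)
           + 2 * RInt (fun y => rho y 0) x1 x2)) by ring end.
      eapply (gap_derive S B R0 M rho u rx rt ux ut A HF x1 x2 S); eauto; lra.
    - now rewrite (traj_start (T x1)), (traj_start (T x2)).
    - now rewrite (traj_start (T x1)), (traj_start (T x2)), !Eu.
    - rewrite H. unfold X, motion.
      match goal with |- _ = ?a + ?p - (?a + ?q) => replace (a + p - (a + q)) with (p - q) by ring end.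
      rewrite (resp_difference M g dg HM). f_equal; ring. }
  assert (DX : forall x t, is_derive (fun x => X x t) x (jacobian M g dg du0 rho0 x t)).
  { intros. apply motion_derive_x; [exact HM|apply (cd_du HD)|apply (cd_dm HD)]. }
  assert (CJ : forall x t, continuous (fun x => jacobian M g dg du0 rho0 x t) x).
  { intros x t. apply (cts2_l (jacobian M g dg du0 rho0)), cts2_jacobian; auto.
    apply (cd_du_continuous HD). }
  assert (DY : forall x t, 0 <= t <= S -> is_derive (fun x => Y x t) x (jacobian M g dg du0 rho0 x t)).
  { intros x t Ht.
    apply (is_derive_ext (fun x => X x t + (Y 0 t - X 0 t))).
    - intros z. specialize (E1 0 z t Ht). simpl in *. lra.
    - replace (jacobian M g dg du0 rho0 x t) with (jacobian M g dg du0 rho0 x t + 0) by ring.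
      apply (is_derive_plus (fun x => X x t)); [apply DX|apply @is_derive_const]. }
  assert (Crho : forall t y, continuous (fun y => rho y t) y) by (intros; apply cts2_l, (fl_rho HF)).
  assert (ErJ : forall x t, 0 <= t <= S -> rho (Y x t) t * jacobian M g dg du0 rho0 x t = rho0 x).
  { intros x t Ht.
    assert (H1 : is_derive (fun x => RInt (fun y => rho y t) (Y 0 t) (Y x t)) x
       (scal (jacobian M g dg du0 rho0 x t) (rho (Y x t) t))).
    { apply (is_derive_comp (fun z => RInt (fun y => rho y t) (Y 0 t) z) (fun x => Y x t)).
      - apply (is_derive_primitive (fun y => rho y t)). apply Crho.
      - now apply DY. }
    assert (H2 : is_derive (fun x => RInt (fun y => rho y t) (Y 0 t) (Y x t)) x (rho x 0)).
    { apply (is_derive_ext (fun x => RInt (fun y => rho y 0) 0 x)).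
      - intros z. symmetry.
        apply (mass_between_trajectories S B R0 M rho u rx rt ux ut A HF 0 z S); auto; lra.
      - apply (is_derive_primitive (fun y => rho y 0)). apply Crho. }
    pose proof (is_derive_unique _ _ _ H1) as U1. rewrite (is_derive_unique _ _ _ H2), Er in U1.
    unfold scal in U1; simpl in U1. unfold mult in U1; simpl in U1. rewrite U1. ring. }
  assert (PJ : forall x t, 0 <= t <= S -> 0 < jacobian M g dg du0 rho0 x t).
  { intros x t Ht.
    assert (Hne : jacobian M g dg du0 rho0 x t <> 0).
    { intros E. specialize (ErJ x t Ht). rewrite E, Rmult_0_r in ErJ. pose proof (cd_pos HD x). lra. }
    assert (Hge : 0 <= jacobian M g dg du0 rho0 x t); [|lra].
    assert (pr : derivable (fun x => Y x t)).
    { intros z. exists (jacobian M g dg du0 rho0 z t). apply is_derive_Reals. now apply DY. }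
    replace (jacobian M g dg du0 rho0 x t) with (derive_pt (fun x => Y x t) x (pr x)).
    - apply nonneg_derivative_0. intros a b [Hab|Hab]; [|subst; lra]. left.
      apply (trajectories_increasing S B R0 M rho u rx rt ux ut A HF S); auto; lra.
    - apply derive_pt_eq_0. apply is_derive_Reals. now apply DY. }
  assert (EA : forall z t, 0 < t < S ->
    A (Y z t) t = - (M - 2 * m0 z + M * X z t - M * (c + v * (1 - exp (- t))))).
  { intros z t Ht.
    set (w := Y 0 t - X 0 t).
    assert (HY : forall x, Y x t = X x t + w) by (intros x; specialize (E1 0 x t ltac:(lra)); unfold w; lra).
    assert (Hk : is_line (fun x => Y x t * rho0 x) (M * (c + v * (1 - exp (- t))) + w * M)).
    { apply (is_line_ext (fun x => X x t * rho0 x + w * rho0 x)).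
      - intros x. rewrite HY. ring.
      - apply is_line_plus; [|apply is_line_scal, (cd_mass HD)].
        eapply motion_first_moment; try eassumption; apply HD. }
    pose proof (conv_lagrangian (fun x => Y x t) (fun x => jacobian M g dg du0 rho0 x t)
      (fun y => rho y t) rho0 M (m0 z)
      (M * (c + v * (1 - exp (- t))) + w * M) z) as H.
    assert (HL : is_line (fun y => dW (Y z t - y) * rho y t)
      (M - 2 * m0 z + M * Y z t - (M * (c + v * (1 - exp (- t))) + w * M))).
    { apply H; auto.
      - intros x. apply DY. lra.
      - intros x. apply PJ. lra.
      - apply (trajectories_cover S B R0 M rho u rx rt ux ut A HF S Y t); auto; lra.
      - intros x. apply ErJ. lra.
      - apply (cd_mass HD).
      - apply (cd_left_mass HD). }
    pose proof (is_line_unique _ _ _ HL (fl_conv HF (Y z t) Ht)) as E.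
    rewrite HY in E at 1. lra. }
  assert (EY : forall x t, 0 <= t < S -> Y x t = X x t /\ u (Y x t) t = V x t).
  { intros x t Ht.
    destruct (oscillator_zero (fun t => Y x t - X x t) (fun t => u (Y x t) t - V x t)
      (fun _ => 0) 0 0 t) as [H1 H2]; try lra.
    - intros r _. apply (continuous_minus (Y x) (X x)); [apply (traj_continuous (T x))|].
      eapply is_derive_continuous. apply motion_derive_t; auto.
    - intros r _. apply (continuous_minus (fun t => u (Y x t) t) (V x)).
      + eapply trajectory_velocity_continuous; eauto.
      + eapply is_derive_continuous. apply motion_velocity_derive_t; auto.
    - intros r Hr. apply (is_derive_minus (Y x) (X x)); [apply (traj_derive (T x)); lra|].
      apply motion_derive_t; auto.
    - intros r Hr.
      replace (- (u (Y x r) r - V x r) + 0)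
        with ((- u (Y x r) r + A (Y x r) r)
          - (- V x r - (M - 2 * m0 x + M * X x r - M * (c + v * (1 - exp (- r))))))
        by (rewrite EA by lra; ring).
      apply (is_derive_minus (fun t => u (Y x t) t) (V x)).
      + eapply (velocity_derive S B R0 M rho u rx rt ux ut A HF x S); auto; lra.
      + apply motion_velocity_derive_t; auto.
    - intros r _. rewrite Rabs_R0. lra.
    - unfold X. rewrite (traj_start (T x)), motion_0 by auto. ring.
    - unfold V. rewrite (traj_start (T x)), motion_velocity_0, Eu by auto. ring. }
  intros t Ht. unfold follows_motion. fold X V. repeat split.
  - intros x. destruct (EY x t ltac:(lra)) as [<- <-]. reflexivity.
  - intros x. destruct (EY x t ltac:(lra)) as [<- _]. apply ErJ. lra.
  - intros x. apply PJ. lra.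
  - intros y. destruct (trajectories_cover S B R0 M rho u rx rt ux ut A HF S Y t ltac:(lra) T Ht y) as [x Hx].
    exists x. destruct (EY x t ltac:(lra)) as [<- _]. exact Hx.
Qed.

Definition freeze (S : R) (f : R -> R -> R) (x t : R) : R := f x (clamp 0 S t).

Lemma freeze_id S f x t : 0 <= t <= S -> freeze S f x t = f x t.
Proof. intros Ht. unfold freeze. now rewrite clamp_id. Qed.

Lemma freeze_cts2 (T : Rbar) (S : R) (f : R -> R -> R) :
  0 < S -> Rbar_lt S T ->
  continuous_on (strip T) (fun p => f (fst p) (snd p)) -> cts2 (freeze S f).
Proof.
  intros HS HT Hf x t. unfold freeze.
  assert (Hin : forall y s, strip T (y, clamp 0 S s)).
  { intros y s. unfold strip; simpl. pose proof (clamp_in 0 S s ltac:(lra)).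
    split; [lra|]. apply (Rbar_le_lt_trans (Finite (clamp 0 S s)) (Finite S) T); [simpl; lra|exact HT]. }
  specialize (Hf (x, clamp 0 S t) (Hin x t)). simpl in Hf.
  set (m := fun p : R * R => (fst p, clamp 0 S (snd p))).
  apply (filterlim_comp _ _ _ m (fun p => f (fst p) (snd p)) _
    (within (strip T) (locally (x, clamp 0 S t)))); [|exact Hf].
  intros P HP. unfold within in HP. unfold filtermap.
  assert (Cm : continuous m (x, t)).
  { apply (continuous_comp_2 fst (fun p : R * R => clamp 0 S (snd p)) (fun a b => (a, b))).
    - apply continuous_fst.
    - apply (continuous_comp snd (clamp 0 S)); [apply continuous_snd|apply clamp_continuous].
    - apply (continuous_ext (fun p => p)); [now intros []|apply continuous_id]. }
  specialize (Cm _ HP). unfold filtermap in Cm. simpl in Cm.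
  revert Cm. apply filter_imp. intros p Hp. apply Hp. apply Hin.
Qed.

Lemma freeze_derive_x S f x t l : 0 <= t <= S ->
  is_derive (fun y => f y t) x l -> is_derive (fun y => freeze S f y t) x l.
Proof.
  intros Ht H. apply (is_derive_ext (fun y => f y t)); [|exact H].
  intros y. symmetry. now apply freeze_id.
Qed.

Lemma freeze_derive_t S f x t l : 0 < t < S ->
  is_derive (fun s => f x s) t l -> is_derive (fun s => freeze S f x s) t l.
Proof.
  intros Ht H. apply (is_derive_ext_loc (fun s => f x s)); [|exact H].
  assert (He : 0 < Rmin t (S - t)) by (apply Rmin_glb_lt; lra).
  exists (mkposreal _ He). intros s Hs. change (Rabs (s - t) < Rmin t (S - t)) in Hs.
  pose_minmax. apply Rabs_def2 in Hs.
  symmetry. apply freeze_id. lra.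
Qed.

Lemma solution_flow (delta B R0 M c v : R) (rho0 drho0 u0 du0 m0 : R -> R)
  (T : Rbar) (rho u : R -> R -> R) (S : R) :
  cauchy_data delta B R0 M c v rho0 drho0 u0 du0 m0 ->
  solution delta rho0 u0 T rho u -> 0 < S -> Rbar_lt S T ->
  exists rx rt ux ut A, flow S B R0 M (freeze S rho) (freeze S u) rx rt ux ut A.
Proof.
  intros HD Hsol HS HT.
  destruct (sol_rho_C1 _ _ _ _ _ _ Hsol) as [rx [rt [Dr [Cr [Crx Crt]]]]].
  destruct (sol_u_C1 _ _ _ _ _ _ Hsol) as [ux [ut [Du [Cu [Cux Cut]]]]].
  assert (HtT : forall t, t < S -> Rbar_lt t T).
  { intros t Ht. apply (Rbar_lt_trans (Finite t) (Finite S) T); [exact Ht|exact HT]. }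
  assert (Cr0 : forall x, continuous rho0 x) by (intros x; eapply is_derive_continuous, (cd_drho HD)).
  assert (E0 : forall x, freeze S rho x 0 = rho0 x).
  { intros x. rewrite freeze_id by lra. apply (sol_rho_init _ _ _ _ _ _ Hsol). }
  exists (freeze S rx), (freeze S rt), (freeze S ux), (freeze S ut),
    (fun x t => freeze S ut x t + freeze S u x t * freeze S ux x t + freeze S u x t).
  assert (C1 := freeze_cts2 T S rho HS HT Cr).
  assert (C2 := freeze_cts2 T S u HS HT Cu).
  assert (C3 := freeze_cts2 T S rx HS HT Crx).
  assert (C4 := freeze_cts2 T S rt HS HT Crt).
  assert (C5 := freeze_cts2 T S ux HS HT Cux).
  assert (C6 := freeze_cts2 T S ut HS HT Cut).
  split; auto.
  - apply cts2_plus; [apply cts2_plus; [auto|now apply cts2_mult]|auto].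
  - intros x t Ht. rewrite (freeze_id S rx) by lra. apply freeze_derive_x; [lra|]. apply Dr; [lra|].
    apply HtT; lra.
  - intros x t Ht. rewrite (freeze_id S rt) by lra. apply freeze_derive_t; [lra|]. apply Dr; [lra|].
    apply HtT; lra.
  - intros x t Ht. rewrite (freeze_id S ux) by lra. apply freeze_derive_x; [lra|]. apply Du; [lra|].
    apply HtT; lra.
  - intros x t Ht. rewrite (freeze_id S ut) by lra. apply freeze_derive_t; [lra|]. apply Du; [lra|].
    apply HtT; lra.
  - intros x t Ht. rewrite !freeze_id by lra.
    pose proof (sol_mass _ _ _ _ _ _ Hsol x t ltac:(lra) (HtT t ltac:(lra))) as H.
    destruct (Dr x t ltac:(lra) (HtT t ltac:(lra))) as [D1 D2].
    destruct (Du x t ltac:(lra) (HtT t ltac:(lra))) as [D3 D4].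
    replace (Derive (fun s => rho x s) t) with (rt x t) in H
      by (symmetry; apply is_derive_unique, D2).
    replace (Derive (fun y => rho y t * u y t) x) with (rx x t * u x t + rho x t * ux x t) in H.
    2:{ symmetry. apply is_derive_unique.
        apply (is_derive_mult (fun y => rho y t) (fun y => u y t)); auto. intros; apply Rmult_comm. }
    exact H.
  - intros x t Ht.
    assert (HtT' : Rbar_lt t T) by (apply HtT; lra).
    pose proof (sol_momentum _ _ _ _ _ _ Hsol x t ltac:(lra) HtT') as H.
    destruct (Du x t ltac:(lra) HtT') as [D3 D4].
    replace (Derive (fun s => u x s) t) with (ut x t) in H
      by (symmetry; apply is_derive_unique, D4).
    replace (Derive (fun y => u y t) x) with (ux x t) in H
      by (symmetry; apply is_derive_unique, D3).
    rewrite !(freeze_id S _ x t) by lra. rewrite H, Ropp_involutive.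
    apply (is_line_ext (fun y => dW (x - y) * rho y t)).
    + intros y. now rewrite freeze_id by lra.
    + apply (RInt_gen_correct (fun y => dW (x - y) * rho y t)).
      apply (sol_conv _ _ _ _ _ _ Hsol); [lra|exact HtT'].
  - apply (is_line_ext rho0); [intros; symmetry; apply E0|apply (cd_mass HD)].
  - intros x. rewrite E0. apply (cd_pos HD).
  - intros x. rewrite E0. apply (density_bounded delta rho0 R0 (cd_delta HD) (cd_pos HD) (cd_decay HD)).
  - intros e He. destruct (density_vanishes delta rho0 R0 (cd_delta HD) (cd_pos HD) (cd_decay HD) e He)
      as [N HN].
    exists N. intros x Hx. rewrite E0. auto.
  - intros x y. rewrite !freeze_id, !(sol_u_init _ _ _ _ _ _ Hsol) by lra.
    assert (Hw : forall x y, x <= y -> Rabs (u0 y - u0 x) <= B * (y - x)).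
    { intros a b Hab. apply (increment_abs u0 du0); auto.
      - intros z _. eapply is_derive_continuous, (cd_du HD).
      - intros z _. apply (cd_du HD).
      - intros z _. apply (cd_du_bound HD). }
    destruct (Rle_dec x y).
    + rewrite Rabs_minus_sym, (Rabs_left1 (x - y)) by lra.
      replace (- (x - y)) with (y - x) by ring. now apply Hw.
    + rewrite (Rabs_pos_eq (x - y)) by lra. apply Hw. lra.
Qed.

Lemma between_real_and_Rbar (t : R) (T : Rbar) : Rbar_lt t T -> exists S : R, t < S /\ Rbar_lt S T.
Proof.
  destruct T as [T| |]; simpl; intros H; try easy.
  - exists ((t + T) / 2). simpl. lra.
  - exists (t + 1). simpl. split; [lra|auto].
Qed.

Lemma solution_follows_motion (delta B R0 M c v : R) (g dg rho0 drho0 u0 du0 m0 : R -> R)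
  (T : Rbar) (rho u : R -> R -> R) :
  0 < M -> impulse_response M g dg ->
  cauchy_data delta B R0 M c v rho0 drho0 u0 du0 m0 ->
  solution delta rho0 u0 T rho u ->
  forall t : R, 0 < t -> Rbar_lt t T -> follows_motion M g dg c v rho0 u0 du0 m0 rho u t.
Proof.
  intros HM Hg HD Hsol t Ht HtT.
  destruct (between_real_and_Rbar t T HtT) as [S [HS1 HS2]].
  destruct (solution_flow delta B R0 M c v rho0 drho0 u0 du0 m0 T rho u S HD Hsol ltac:(lra) HS2)
    as [rx [rt [ux [ut [A HF]]]]].
  destruct (flow_follows_motion delta S B R0 M c v g dg rho0 drho0 u0 du0 m0 _ _ rx rt ux ut A
    HM Hg HD HF) with (t := t) as [H1 [H2 [H3 H4]]].
  - intros x. rewrite freeze_id by lra. apply (sol_rho_init _ _ _ _ _ _ Hsol).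
  - intros x. rewrite freeze_id by lra. apply (sol_u_init _ _ _ _ _ _ Hsol).
  - lra.
  - split; [|split; [|split]]; auto.
    + intros x. rewrite <- H1. now rewrite freeze_id by lra.
    + intros x. rewrite <- (H2 x). now rewrite freeze_id by lra.
Qed.

(** * The minimum of the Jacobian *)

Lemma ln_le_iff a b : 0 < a -> 0 < b -> (ln a <= ln b <-> a <= b).
Proof.
  intros Ha Hb. split; intros H.
  - apply Rnot_lt_le. intros Hlt. apply ln_increasing in Hlt; lra.
  - now apply ln_le.
Qed.

Section Overdamped.

Variable M : R.
Hypothesis HM : 0 < M < 1 / 4.

Let s := sqrt (1 - 4 * M).
Let a := (1 - s) / 2.
Let b := (1 + s) / 2.

Lemma overdamped_rates : 0 < s < 1 /\ 0 < a < b /\ a * b = M /\ a + s = b /\ a + b = 1.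
Proof.
  assert (Hs2 : s * s = 1 - 4 * M) by (unfold s; apply sqrt_sqrt; lra).
  assert (Hs : 0 < s) by (unfold s; apply sqrt_lt_R0; lra).
  assert (s < 1) by nra.
  unfold a, b. repeat split; try lra.
Qed.

Definition overdamped_impulse (t : R) : R := (exp (- a * t) - exp (- b * t)) / s.
Definition overdamped_impulse' (t : R) : R := (b * exp (- b * t) - a * exp (- a * t)) / s.

Notation g := overdamped_impulse.
Notation dg := overdamped_impulse'.

Lemma overdamped_impulse_response : impulse_response M g dg.
Proof.
  destruct overdamped_rates as [Hs [Hab [HabM [Has Hsum]]]].
  unfold overdamped_impulse, overdamped_impulse'. split.
  - intros t. auto_derive; [lra|]. field. lra.
  - intros t. auto_derive; [lra|]. rewrite <- HabM.
    replace (exp (- b * t)) with (exp (- b * t) * (a + b)) at 2 by (rewrite Hsum; ring).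
    replace (exp (- a * t)) with (exp (- a * t) * (a + b)) at 2 by (rewrite Hsum; ring).
    field. lra.
  - rewrite !Rmult_0_r, exp_0. field. lra.
  - rewrite !Rmult_0_r, exp_0. rewrite <- Has. field. lra.
Qed.

Variables p r : R.
Hypothesis Hr : 0 < r.

Let q := M - 2 * r.
Let Y := resp M g dg 1 p (2 * r).

Lemma overdamped_resp t :
  Y t = 2 * r / M + ((q + a * p) / a * exp (- a * t) - (q + b * p) / b * exp (- b * t)) / s.
Proof.
  destruct overdamped_rates as [Hs [Hab [HabM [Has Hsum]]]].
  unfold Y, resp, overdamped_impulse, overdamped_impulse', q.
  generalize (exp (- a * t)) (exp (- b * t)). intros ea eb.
  assert (Eb : b = 1 - a) by lra. assert (Es : s = 1 - 2 * a) by lra.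
  rewrite <- HabM, Es, Eb. field. repeat split; lra.
Qed.

(** If A = - (a p + q) and - p are positive, so is B = - (b p + q).  The response is
    2 r / M - (A / a exp (- a t) - B / b exp (- b t)) / s.  It is smallest when
    A exp (- a t) = B exp (- b t), with the value (2 r - A exp (- a t)) / M, which
    is not positive exactly if (B / 2 r)^a <= (A / 2 r)^b. *)
Lemma subcritical_iff :
  subcritical_condition M p r <-> exists t, 0 <= t /\ Y t <= 0.
Proof.
  destruct overdamped_rates as [Hs [Hab [HabM [Has Hsum]]]].
  assert (El1 : lambda1 M = 2 * a / M) by (unfold lambda1, a; fold s; field; lra).
  assert (El2 : lambda2 M = 2 * b / M) by (unfold lambda2, b; fold s; field; lra).
  assert (E1 : p + lambda2 M * (M / 2 - r) = (a * p + q) / a).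
  { rewrite El2. unfold q. rewrite <- HabM at 1. field. lra. }
  assert (E2 : M / 2 * lambda2 M * p + M - 2 * r = b * p + q) by (rewrite El2; unfold q; field; lra).
  assert (E3 : M / 2 * lambda1 M * p + M - 2 * r = a * p + q) by (rewrite El1; unfold q; field; lra).
  assert (Hexp : forall t, 0 <= t -> exp (- b * t) <= exp (- a * t)).
  { intros t Ht. apply exp_le. nra. }
  assert (Hinv : / b < / a) by (apply Rinv_lt_contravar; nra).
  assert (Hinvb : 0 < / b) by (apply Rinv_0_lt_compat; lra).
  assert (Hdiff : forall t, 0 <= t -> 0 <= exp (- a * t) / a - exp (- b * t) / b).
  { intros t Ht. specialize (Hexp t Ht). pose proof (exp_pos (- b * t)). unfold Rdiv. nra. }
  assert (HrM : 0 < 2 * r / M) by (apply Rdiv_lt_0_compat; lra).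
  (* the response stays above min (1, 2 r / M) unless p < 0 and a p + q < 0 *)
  destruct (Rlt_dec p 0) as [Hp|Hp].
  2:{ split.
    - intros [H _]. exfalso. pose proof (Rmax_l p (p + lambda2 M * (M / 2 - r))). lra.
    - intros [t [Ht HY]]. exfalso.
      apply (Rle_not_lt _ _ HY), resp_positive; try lra; [apply overdamped_impulse_response| |].
      + intros x Hx. apply Rdiv_le_0_compat; [specialize (Hexp x Hx)|]; lra.
      + replace (dg t + g t) with ((b * exp (- a * t) - a * exp (- b * t)) / s).
        * specialize (Hexp t Ht). pose proof (exp_pos (- b * t)). apply Rdiv_lt_0_compat; nra.
        * unfold overdamped_impulse, overdamped_impulse'.
          replace b with (1 - a) at 1 by lra. replace a with (1 - b) at 3 by lra. field. lra. }
  destruct (Rlt_dec (a * p + q) 0) as [HA|HA].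
  2:{ split.
    - intros [H _]. exfalso. rewrite E1 in H. pose proof (Rmax_r p ((a * p + q) / a)).
      assert (0 <= (a * p + q) / a) by (apply Rdiv_le_0_compat; lra). lra.
    - intros [t [Ht HY]]. exfalso. rewrite overdamped_resp in HY.
      assert (E : 2 * r / M + ((q + a * p) / a * exp (- a * t) - (q + b * p) / b * exp (- b * t)) / s
        = 2 * r / M + (a * p + q) * (exp (- a * t) / a - exp (- b * t) / b) / s
          + (- p) * exp (- b * t) / b).
      { rewrite <- Has. field. repeat split; lra. }
      rewrite E in HY. specialize (Hdiff t Ht).
      assert (0 <= (a * p + q) * (exp (- a * t) / a - exp (- b * t) / b) / s).
      { apply Rdiv_le_0_compat; [|lra]. apply Rmult_le_pos; lra. }
      assert (0 <= (- p) * exp (- b * t) / b).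
      { apply Rdiv_le_0_compat; [|lra]. pose proof (exp_pos (- b * t)). nra. }
      lra. }
  set (A := - (a * p + q)). set (B := - (b * p + q)).
  assert (PA : 0 < A) by (unfold A; lra).
  assert (PB : A < B) by (unfold A, B; nra).
  set (ts := ln (B / A) / s).
  assert (Hts : 0 < ts).
  { apply Rdiv_lt_0_compat; [|lra]. rewrite ln_div by lra.
    assert (ln A < ln B) by (apply ln_increasing; lra). lra. }
  assert (Hbal : A * exp (- a * ts) = B * exp (- b * ts)).
  { rewrite <- (exp_ln A) at 1 by lra. rewrite <- (exp_ln B) at 1 by lra. rewrite <- !exp_plus.
    f_equal. assert (s * ts = ln B - ln A) by (unfold ts; rewrite ln_div by lra; field; lra).
    rewrite <- Has. lra. }
  assert (EY : forall t, Y t = 2 * r / M - (A / a * exp (- a * t) - B / b * exp (- b * t)) / s).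
  { intros t. rewrite overdamped_resp. unfold A, B. field. lra. }
  assert (EYs : Y ts = (2 * r - A * exp (- a * ts)) / M).
  { rewrite EY. replace (B / b * exp (- b * ts)) with (B * exp (- b * ts) / b) by (field; lra).
    rewrite <- Hbal, <- HabM. rewrite <- Has. field. repeat split; lra. }
  assert (Hmin : forall t, Y ts <= Y t).
  { intros t. rewrite EYs, EY.
    set (tau := t - ts).
    replace (exp (- a * t)) with (exp (- a * ts) * exp (- a * tau))
      by (rewrite <- exp_plus; f_equal; unfold tau; ring).
    replace (exp (- b * t)) with (exp (- b * ts) * exp (- b * tau))
      by (rewrite <- exp_plus; f_equal; unfold tau; ring).
    replace (B / b * (exp (- b * ts) * exp (- b * tau)))
      with (B * exp (- b * ts) * (exp (- b * tau) / b)) by (field; lra).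
    rewrite <- Hbal.
    assert (Hphi : exp (- a * tau) / a - exp (- b * tau) / b <= / a - / b).
    { set (phi := fun t => exp (- a * t) / a - exp (- b * t) / b).
      assert (phi0 : phi 0 = / a - / b) by (unfold phi; rewrite !Rmult_0_r, exp_0; field; lra).
      assert (Cphi : forall t, continuous phi t) by (intros x; unfold phi; smooth; lra).
      assert (Dphi : forall t, is_derive phi t (exp (- b * t) - exp (- a * t))).
      { intros x. unfold phi. auto_derive; [lra|]. field. lra. }
      change (phi tau <= / a - / b). destruct (Rle_dec 0 tau) as [Ht|Ht].
      - pose proof (increment_le phi (fun t => exp (- b * t) - exp (- a * t)) 0 tau 0 Ht) as H.
        assert (phi tau - phi 0 <= 0 * (tau - 0)); [|lra]. apply H; auto.
        intros x Hx. specialize (Hexp x ltac:(lra)). lra.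
      - pose proof (increment_ge phi (fun t => exp (- b * t) - exp (- a * t)) tau 0 0 ltac:(lra)) as H.
        assert (0 * (0 - tau) <= phi 0 - phi tau); [|lra]. apply H; auto.
        intros x Hx. assert (exp (- a * x) <= exp (- b * x)) by (apply exp_le; nra). lra. }
    assert (Hsa : (/ a - / b) / s = / M) by (rewrite <- HabM, <- Has; field; repeat split; lra).
    assert (PE : 0 < A * exp (- a * ts)) by (apply Rmult_lt_0_compat; [lra|apply exp_pos]).
    replace (2 * r / M - (A / a * (exp (- a * ts) * exp (- a * tau)) -
       A * exp (- a * ts) * (exp (- b * tau) / b)) / s)
      with (2 * r / M - A * exp (- a * ts) * ((exp (- a * tau) / a - exp (- b * tau) / b) / s))
      by (field; repeat split; lra).
    replace ((2 * r - A * exp (- a * ts)) / M) with (2 * r / M - A * exp (- a * ts) * / M) by (field; lra).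
    rewrite <- Hsa.
    assert ((exp (- a * tau) / a - exp (- b * tau) / b) / s <= (/ a - / b) / s).
    { apply Rmult_le_compat_r; [left; apply Rinv_0_lt_compat; lra|exact Hphi]. }
    nra. }
  assert (Hcond : Y ts <= 0 <-> a * ln (B / (2 * r)) <= b * ln (A / (2 * r))).
  { rewrite EYs.
    assert (H1 : (2 * r - A * exp (- a * ts)) / M <= 0 <-> 2 * r <= A * exp (- a * ts)).
    { split; intros H.
      - apply Rnot_lt_le. intros Hlt.
        assert (0 < (2 * r - A * exp (- a * ts)) / M) by (apply Rdiv_lt_0_compat; lra). lra.
      - unfold Rdiv. assert (0 < / M) by (apply Rinv_0_lt_compat; lra). nra. }
    rewrite H1, <- (ln_le_iff (2 * r) (A * exp (- a * ts))); [|lra|apply Rmult_lt_0_compat; [lra|apply exp_pos]].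
    rewrite (ln_mult A), ln_exp by (lra || apply exp_pos). rewrite !ln_div by lra.
    assert (Hst : s * ts = ln B - ln A) by (unfold ts; rewrite ln_div by lra; field; lra).
    assert (Hst2 : s * (- a * ts) = - a * (ln B - ln A)) by (rewrite <- Hst; ring).
    split; intros H.
    - assert (s * ln (2 * r) <= s * (ln A + - a * ts)) by (apply Rmult_le_compat_l; lra).
      rewrite <- Has. nra.
    - apply Rmult_le_reg_l with s; [lra|]. rewrite <- Has in H. nra. }
  assert (Hbases : Rpower (Rabs ((M / 2 * lambda2 M * p + M - 2 * r) / (2 * r))) (lambda1 M)
     <= Rpower (Rabs ((M / 2 * lambda1 M * p + M - 2 * r) / (2 * r))) (lambda2 M)
     <-> a * ln (B / (2 * r)) <= b * ln (A / (2 * r))).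
  { rewrite E2, E3.
    replace (Rabs ((b * p + q) / (2 * r))) with (B / (2 * r)).
    2:{ rewrite Rabs_left; [unfold B; field; lra|].
        replace ((b * p + q) / (2 * r)) with (- (B / (2 * r))) by (unfold B; field; lra).
        assert (0 < B / (2 * r)) by (apply Rdiv_lt_0_compat; lra). lra. }
    replace (Rabs ((a * p + q) / (2 * r))) with (A / (2 * r)).
    2:{ rewrite Rabs_left; [unfold A; field; lra|].
        replace ((a * p + q) / (2 * r)) with (- (A / (2 * r))) by (unfold A; field; lra).
        assert (0 < A / (2 * r)) by (apply Rdiv_lt_0_compat; lra). lra. }
    unfold Rpower. rewrite <- ln_le_iff by apply exp_pos. rewrite !ln_exp, El1, El2.
    replace (2 * a / M * ln (B / (2 * r))) with (2 / M * (a * ln (B / (2 * r)))) by (field; lra).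
    replace (2 * b / M * ln (A / (2 * r))) with (2 / M * (b * ln (A / (2 * r)))) by (field; lra).
    assert (0 < 2 / M) by (apply Rdiv_lt_0_compat; lra).
    split; intros H0; [apply Rmult_le_reg_l with (2 / M); lra|apply Rmult_le_compat_l; lra]. }
  unfold subcritical_condition. rewrite Hbases, <- Hcond. split.
  - intros [_ H]. exists ts. split; [lra|exact H].
  - intros [t [Ht HY]]. split; [|eapply Rle_trans; [apply Hmin|exact HY]].
    apply Rmax_lub_lt; [exact Hp|]. rewrite E1.
    replace ((a * p + q) / a) with (- (A / a)) by (unfold A; field; lra).
    assert (0 < A / a) by (apply Rdiv_lt_0_compat; lra). lra.
Qed.

End Overdamped.

Definition critical_impulse (t : R) : R := t * exp (- t / 2).
Definition critical_impulse' (t : R) : R := (1 - t / 2) * exp (- t / 2).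

Lemma critical_impulse_response : impulse_response (1 / 4) critical_impulse critical_impulse'.
Proof.
  unfold critical_impulse, critical_impulse'. split.
  - intros t. auto_derive; [auto|]. unfold Rdiv. field.
  - intros t. auto_derive; [auto|]. unfold Rdiv. field.
  - ring.
  - replace (- 0 / 2) with 0 by field. rewrite exp_0. field.
Qed.

(** The response 8 r + (1 - 8 r + k t) exp (- t / 2), with p and k negative, is
    smallest at t = 2 p / k, with the value 8 r + 2 k exp (- p / k). *)
Lemma critical_iff p r : 0 < r ->
  critical_condition (1 / 4) p r <->
  exists t, 0 <= t /\ resp (1 / 4) critical_impulse critical_impulse' 1 p (2 * r) t <= 0.
Proof.
  intros Hr. set (Y := resp (1 / 4) critical_impulse critical_impulse' 1 p (2 * r)).
  set (k := p + (1 - 8 * r) / 2).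
  assert (EY : forall t, Y t = 8 * r + (1 - 8 * r + k * t) * exp (- t / 2)).
  { intros t. unfold Y, resp, critical_impulse, critical_impulse', k. field. }
  assert (Ek : 1 / 4 * p + 1 / 4 / 2 - r = k / 4) by (unfold k; field).
  unfold critical_condition. rewrite Ek.
  destruct (Rlt_dec p 0) as [Hp|Hp].
  2:{ split.
    - intros [H _]. exfalso. pose proof (Rmax_l p (k / 4)). lra.
    - intros [t [Ht HY]]. exfalso.
      apply (Rle_not_lt _ _ HY), resp_positive; try lra; [apply critical_impulse_response| |].
      + intros x Hx. pose proof (exp_pos (- x / 2)). unfold critical_impulse. nra.
      + pose proof (exp_pos (- t / 2)). unfold critical_impulse, critical_impulse'. nra. }
  destruct (Rlt_dec k 0) as [Hk|Hk].
  2:{ split.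
    - intros [H _]. exfalso. pose proof (Rmax_r p (k / 4)). lra.
    - intros [t [Ht HY]]. exfalso. rewrite EY in HY. pose proof (exp_pos (- t / 2)).
      assert (0 <= 1 - 8 * r) by (unfold k in Hk; lra).
      assert (0 <= (1 - 8 * r + k * t) * exp (- t / 2)).
      { apply Rmult_le_pos; [|lra]. assert (0 <= k * t) by (apply Rmult_le_pos; lra). lra. }
      lra. }
  set (ts := 2 * p / k).
  assert (Hts : 0 < ts).
  { unfold ts. replace (2 * p / k) with ((- 2 * p) / (- k)) by (field; lra).
    apply Rdiv_lt_0_compat; lra. }
  assert (Hkts : k * ts = 2 * p) by (unfold ts; field; lra).
  assert (EYs : Y ts = 8 * r + 2 * k * exp (- (p / k))).
  { rewrite EY. replace (- ts / 2) with (- (p / k)) by (unfold ts; field; lra).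
    rewrite Hkts. unfold k. field. }
  assert (Hmin : forall t, Y ts <= Y t).
  { intros t. rewrite EYs, EY. set (tau := t - ts).
    replace (exp (- t / 2)) with (exp (- (p / k)) * exp (- tau / 2))
      by (rewrite <- exp_plus; f_equal; unfold tau, ts; field; lra).
    assert (E : 1 - 8 * r + k * t = k * (2 + tau)).
    { unfold tau. rewrite Rmult_plus_distr_l, Rmult_minus_distr_l, Hkts. unfold k. field. }
    rewrite E.
    assert (Hf : (1 + tau / 2) * exp (- tau / 2) <= 1).
    { replace 1 with (exp (tau / 2) * exp (- tau / 2)) at 2
        by (rewrite <- exp_plus, <- exp_0; f_equal; field).
      apply Rmult_le_compat_r; [left; apply exp_pos|]. apply exp_ineq1_le. }
    pose proof (exp_pos (- (p / k))).
    assert (0 < - (2 * k * exp (- (p / k)))) by nra.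
    replace (k * (2 + tau) * (exp (- (p / k)) * exp (- tau / 2)))
      with ((2 * k * exp (- (p / k))) * ((1 + tau / 2) * exp (- tau / 2))) by field.
    nra. }
  assert (Hcond : Y ts <= 0 <-> ln (- (k / 4 / r)) >= 1 / 4 * p / (k / 4)).
  { rewrite EYs.
    replace (1 / 4 * p / (k / 4)) with (p / k) by (field; lra).
    replace (- (k / 4 / r)) with (- k / (4 * r)) by (field; lra).
    assert (Hpos : 0 < - k / (4 * r)) by (apply Rdiv_lt_0_compat; lra).
    assert (Hex : exp (p / k) * exp (- (p / k)) = 1) by (rewrite <- exp_plus, <- exp_0; f_equal; ring).
    pose proof (exp_pos (p / k)). pose proof (exp_pos (- (p / k))).
    assert (Hkr : - k / (4 * r) * (4 * r) = - k) by (field; lra).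
    assert (Hl : ln (- k / (4 * r)) >= p / k <-> exp (p / k) <= - k / (4 * r)).
    { rewrite <- (ln_le_iff (exp (p / k))), ln_exp by auto. split; [apply Rge_le|apply Rle_ge]. }
    rewrite Hl. split; intros H1.
    - apply Rmult_le_reg_r with (4 * r); [lra|]. rewrite Hkr. nra.
    - assert (exp (p / k) * (4 * r) <= - k).
      { rewrite <- Hkr. apply Rmult_le_compat_r; lra. }
      nra. }
  rewrite <- Hcond. split.
  - intros [_ H]. exists ts. split; [lra|exact H].
  - intros [t [Ht HY]]. split; [apply Rmax_lub_lt; lra|].
    eapply Rle_trans; [apply Hmin|exact HY].
Qed.

Section Invariants.

Variables (M : R) (g dg : R -> R).
Hypothesis HM : 0 < M.
Hypothesis Hg : impulse_response M g dg.
Variables p r : R.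

Let Y := resp M g dg 1 p (2 * r).
Let dY := dresp M g dg 1 p (2 * r).
Let y t := Y t - 2 * r / M.
Let y0 := 1 - 2 * r / M.

(** The form factors as (y' - k1 y) (y' - k2 y) over the characteristic exponents;
    the factors are pure exponentials, and k1 + k2 = -1. *)
Lemma spiral_invariant t : 0 <= t ->
  exp t * (dY t ^ 2 + dY t * y t + M * y t ^ 2) = p ^ 2 + p * y0 + M * y0 ^ 2.
Proof.
  intros Ht.
  assert (D : forall t, is_derive (fun t => exp t * (dY t ^ 2 + dY t * y t + M * y t ^ 2)) t 0).
  { intros x. unfold y.
    assert (H1 : is_derive Y x (dY x)) by now apply resp_derive.
    assert (H2 : is_derive dY x (- dY x - M * Y x + 2 * r)) by now apply dresp_derive.
    clearbody Y dY. auto_derive; [repeat split; eexists; eassumption|].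
    use_derivatives. field. lra. }
  assert (C : forall t, continuous (fun t => exp t * (dY t ^ 2 + dY t * y t + M * y t ^ 2)) t).
  { intros x. eapply is_derive_continuous, D. }
  pose proof (increment_le _ (fun _ => 0) 0 t 0 Ht (fun x _ => C x) (fun x _ => D x)) as H1.
  pose proof (increment_ge _ (fun _ => 0) 0 t 0 Ht (fun x _ => C x) (fun x _ => D x)) as H2.
  specialize (H1 ltac:(intros; lra)). specialize (H2 ltac:(intros; lra)).
  cbv beta in H1, H2.
  assert (E0 : exp 0 * (dY 0 ^ 2 + dY 0 * y 0 + M * y 0 ^ 2) = p ^ 2 + p * y0 + M * y0 ^ 2).
  { unfold y, Y, dY, y0. rewrite resp_0, dresp_0, exp_0 by auto. ring. }
  lra.
Qed.

Lemma energy_decreases t1 t2 : t1 <= t2 ->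
  dY t2 ^ 2 + M * y t2 ^ 2 <= dY t1 ^ 2 + M * y t1 ^ 2.
Proof.
  intros Ht.
  assert (D : forall t, is_derive (fun t => dY t ^ 2 + M * y t ^ 2) t (- 2 * dY t ^ 2)).
  { intros x. unfold y.
    assert (H1 : is_derive Y x (dY x)) by now apply resp_derive.
    assert (H2 : is_derive dY x (- dY x - M * Y x + 2 * r)) by now apply dresp_derive.
    clearbody Y dY. auto_derive; [repeat split; eexists; eassumption|].
    use_derivatives. field. lra. }
  pose proof (increment_le (fun t => dY t ^ 2 + M * y t ^ 2) (fun t => - 2 * dY t ^ 2) t1 t2 0 Ht) as H.
  cut (dY t2 ^ 2 + M * y t2 ^ 2 - (dY t1 ^ 2 + M * y t1 ^ 2) <= 0 * (t2 - t1)); [lra|].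
  apply H.
  - intros x _. eapply is_derive_continuous, D.
  - intros x _. apply D.
  - intros x _. pose proof (pow2_ge_0 (dY x)). lra.
Qed.

End Invariants.

Section Underdamped.

Variable M : R.
Hypothesis HM : 1 / 4 < M.

Let w := sqrt (M - 1 / 4).

Lemma frequency_square : 0 < w /\ w * w = M - 1 / 4.
Proof. unfold w. split; [apply sqrt_lt_R0; lra|apply sqrt_sqrt; lra]. Qed.

Definition underdamped_impulse (t : R) : R := exp (- t / 2) * sin (w * t) / w.
Definition underdamped_impulse' (t : R) : R :=
  exp (- t / 2) * (cos (w * t) - sin (w * t) / (2 * w)).

Notation g := underdamped_impulse.
Notation dg := underdamped_impulse'.

Lemma underdamped_impulse_response : impulse_response M g dg.
Proof.
  destruct frequency_square as [Hw Hw2].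
  assert (EM : M = w * w + 1 / 4) by lra.
  unfold underdamped_impulse, underdamped_impulse'. split.
  - intros t. auto_derive; [auto|]. unfold Rdiv. field. lra.
  - intros t. auto_derive; [auto|]. rewrite EM. unfold Rdiv. field. lra.
  - rewrite Rmult_0_r, sin_0. field. lra.
  - rewrite Rmult_0_r, sin_0, cos_0. replace (- 0 / 2) with 0 by field. rewrite exp_0. field. lra.
Qed.

Variables p r : R.
Hypothesis Hr : 0 < r.

Let q := M - 2 * r.
Let z := p / 2 + q.
Let Y := resp M g dg 1 p (2 * r).
Let dY := dresp M g dg 1 p (2 * r).
Let T := tstar M p r.
Let y0 := 1 - 2 * r / M.

Lemma underdamped_velocity t :
  dY t = exp (- t / 2) * (p * cos (w * t) - z / w * sin (w * t)).
Proof.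
  destruct frequency_square as [Hw _].
  unfold dY, dresp, underdamped_impulse, underdamped_impulse', z, q. field. lra.
Qed.

Lemma tstar_phase :
  w * T = if Req_dec_T (p + 2 * M - 4 * r) 0 then
     if Rlt_dec p 0 then PI / 2 else 3 * PI / 2
   else beta M p r + atan (p * w / z).
Proof.
  destruct frequency_square as [Hw _].
  unfold T, tstar. fold w. rewrite <- Rmult_assoc, Rinv_r, Rmult_1_l by lra.
  destruct (Req_dec_T (p + 2 * M - 4 * r) 0) as [E|E]; [reflexivity|].
  do 2 f_equal. unfold z, q. field. lra.
Qed.

Lemma cos_sin_atan x : 0 < cos (atan x) /\ sin (atan x) = cos (atan x) * x.
Proof.
  assert (H : 0 < cos (atan x)) by (pose proof (atan_bound x); apply cos_gt_0; lra).
  split; [exact H|]. rewrite <- (tan_atan x) at 3. unfold tan. field. lra.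
Qed.

(** The phase chosen by the case analysis on beta is the one in (0, 2 PI] at
    which the velocity changes sign from negative to positive. *)
Lemma phase_spec : ~ (p = 0 /\ q <= 0) ->
  exists k, 0 < k /\ sin (w * T) = - k * (p * w) /\ cos (w * T) = - k * z /\
    0 < w * T <= 2 * PI.
Proof.
  intros Hne. destruct frequency_square as [Hw _]. pose proof PI_RGT_0 as HPI.
  rewrite tstar_phase. destruct (Req_dec_T (p + 2 * M - 4 * r) 0) as [E|E].
  - assert (Ez : z = 0) by (unfold z, q; lra).
    destruct (Rlt_dec p 0) as [Hp|Hp].
    + exists (/ (- (p * w))). rewrite sin_PI2, cos_PI2, Ez.
      assert (0 < - (p * w)) by nra.
      split; [now apply Rinv_0_lt_compat|]. repeat split; try lra. field. nra.
    + assert (Hp' : 0 < p).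
      { destruct (Req_dec p 0) as [E0|]; [|lra]. exfalso. apply Hne. unfold q. lra. }
      exists (/ (p * w)). replace (3 * PI / 2) with (3 * (PI / 2)) by field.
      rewrite sin_3PI2, cos_3PI2 || (replace (3 * (PI / 2)) with (PI / 2 + PI) by field; rewrite neg_sin, neg_cos, sin_PI2, cos_PI2).
      rewrite Ez. assert (0 < p * w) by nra.
      split; [now apply Rinv_0_lt_compat|]. repeat split; try lra. field. nra.
  - assert (Hz : z <> 0) by (unfold z, q; lra).
    destruct (cos_sin_atan (p * w / z)) as [Hc Hs].
    pose proof (atan_bound (p * w / z)) as Hb.
    unfold beta. destruct (Rlt_dec p (Rmin 0 (4 * (r - M / 2)))) as [H1|H1].
    + pose_minmax.
      assert (Hz' : z < 0) by (unfold z, q; lra).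
      assert (Hq : 0 < p * w / z).
      { replace (p * w / z) with ((- p * w) / (- z)) by (field; lra). apply Rdiv_lt_0_compat; nra. }
      rewrite Rplus_0_l. exists (cos (atan (p * w / z)) / (- z)).
      split; [apply Rdiv_lt_0_compat; lra|]. rewrite Hs.
      pose proof (atan_increasing 0 _ Hq) as Ha. rewrite atan_0 in Ha.
      repeat split; try lra; field; lra.
    + destruct (Rlt_dec (4 * (r - M / 2)) p) as [H2|H2].
      * assert (Hz' : 0 < z).
        { assert (-2 * q < p) by (unfold q; lra).
          assert (0 <= p \/ p < 0) as [|] by lra; unfold z; [|lra].
          destruct (Rle_dec 0 q); [|lra].
          destruct (Req_dec p 0); [|lra]. assert (q <> 0); [|lra].
          intros Eq. apply Hne. lra. }
        exists (cos (atan (p * w / z)) / z).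
        split; [apply Rdiv_lt_0_compat; lra|].
        rewrite Rplus_comm, neg_sin, neg_cos, Hs. repeat split; try lra; field; lra.
      * assert (Hp : 0 < p /\ z < 0).
        { assert (p <= -2 * q) by (unfold q; lra).
          assert (Hp0 : 0 <= p).
          { apply Rnot_lt_le. intros Hlt. apply H1. unfold Rmin.
            destruct (Rle_dec 0 (4 * (r - M / 2))); [lra|].
            unfold q in *. destruct (Req_dec p (4 * (r - M / 2))); [|lra].
            exfalso. apply E. lra. }
          assert (Hp1 : 0 < p).
          { destruct (Req_dec p 0); [|lra]. exfalso. apply Hne. lra. }
          unfold z in *. lra. }
        assert (Hq : p * w / z < 0).
        { replace (p * w / z) with (- ((p * w) / (- z))) by (field; lra).
          assert (0 < (p * w) / (- z)) by (apply Rdiv_lt_0_compat; nra). lra. }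
        pose proof (atan_increasing _ 0 Hq) as Ha. rewrite atan_0 in Ha.
        exists (cos (atan (p * w / z)) / (- z)).
        split; [apply Rdiv_lt_0_compat; lra|].
        rewrite Rplus_comm.
        replace (2 * PI) with (PI + PI) by ring. rewrite <- Rplus_assoc.
        rewrite !neg_sin, !neg_cos, Hs. repeat split; try lra; field; lra.
Qed.

(** Completing the square in the initial value of the invariant form. *)
Lemma supercritical_condition_energy :
  supercritical_condition M p r <->
  4 * r ^ 2 / M * exp T <= p ^ 2 + p * y0 + M * y0 ^ 2.
Proof.
  unfold supercritical_condition. fold T.
  assert (E1 : (p + (M / 2 - r) / M) ^ 2 = p ^ 2 + p * y0 + M * y0 ^ 2 - (M - 1 / 4) * y0 ^ 2).
  { unfold y0. field. lra. }
  assert (E2 : (M - 1 / 4) * (4 * r ^ 2 / M ^ 2 * (M * exp T / (M - 1 / 4) - 1) + (4 * r - M) / M)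
    = 4 * r ^ 2 / M * exp T - (M - 1 / 4) * y0 ^ 2).
  { unfold y0. field. lra. }
  rewrite E1, E2. split; intros H; lra.
Qed.

(** At T the velocity vanishes, so the invariant form gives the depth of this
    minimum.  Before T the response decreases, possibly after an increase from its
    initial value 1; after T the energy is too small for a deeper minimum. *)
Lemma supercritical_iff :
  supercritical_condition M p r <-> exists t, 0 <= t /\ Y t <= 0.
Proof.
  destruct frequency_square as [Hw Hw2]. pose proof PI_RGT_0 as HPI.
  assert (Hg := underdamped_impulse_response).
  assert (PM : 0 < M) by lra.
  rewrite supercritical_condition_energy.
  assert (HrM : 0 < 2 * r / M) by (apply Rdiv_lt_0_compat; lra).
  assert (Eq0 : q = M * y0) by (unfold q, y0; field; lra).
  assert (E4 : 4 * r ^ 2 / M = M * (2 * r / M) ^ 2) by (field; lra).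
  destruct (classic (p = 0 /\ q <= 0)) as [[Ep Eq]|Hne].
  - (* a start from rest, not above the equilibrium: the energy never suffices
       to go further down than the starting point *)
    assert (Hy0 : y0 <= 0) by nra.
    assert (HT : 0 <= T).
    { apply Rmult_le_reg_l with w; [exact Hw|]. rewrite Rmult_0_r, tstar_phase, Ep.
      destruct (Req_dec_T (0 + 2 * M - 4 * r) 0) as [E|E].
      - destruct (Rlt_dec 0 0); lra.
      - replace (0 * w / z) with 0 by (unfold Rdiv; ring). rewrite atan_0. unfold beta.
        destruct (Rlt_dec 0 (Rmin 0 (4 * (r - M / 2)))); [lra|].
        destruct (Rlt_dec (4 * (r - M / 2)) 0); lra. }
    split.
    + intros H. exfalso. rewrite Ep, E4 in H.
      assert (1 <= exp T) by (rewrite <- exp_0; now apply exp_le).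
      assert (y0 ^ 2 < (2 * r / M) ^ 2) by (unfold y0 in *; nra).
      pose proof (pow2_ge_0 (2 * r / M)).
      assert (M * (2 * r / M) ^ 2 <= M * (2 * r / M) ^ 2 * exp T).
      { rewrite <- (Rmult_1_r (M * (2 * r / M) ^ 2)) at 1. apply Rmult_le_compat_l; nra. }
      nra.
    + intros [t [Ht HY]]. exfalso.
      pose proof (energy_decreases M g dg PM Hg p r 0 t Ht) as H. fold Y dY in H.
      replace (dY 0) with 0 in H by (unfold dY; rewrite dresp_0; auto).
      replace (Y 0) with 1 in H by (unfold Y; rewrite resp_0; auto).
      fold y0 in H. pose proof (pow2_ge_0 (dY t)).
      assert ((Y t - 2 * r / M) ^ 2 <= y0 ^ 2) by nra.
      unfold y0 in *. nra.
  - destruct (phase_spec Hne) as [k [Hk [Hsin [Hcos Hphase]]]].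
    assert (Ep : p = - sin (w * T) / (k * w)) by (rewrite Hsin; field; lra).
    assert (Ez : z = - cos (w * T) / k) by (rewrite Hcos; field; lra).
    assert (HdY : forall t, dY t = exp (- t / 2) / (k * w) * sin (w * t - w * T)).
    { intros t. rewrite underdamped_velocity, Ez, Ep at 1. rewrite sin_minus. field. lra. }
    assert (Hkw : 0 < k * w) by nra.
    assert (HT : 0 < T).
    { apply Rmult_lt_reg_l with w; lra. }
    assert (DY : forall t, is_derive Y t (dY t)) by (intros; now apply resp_derive).
    assert (CY : forall t, continuous Y t) by (intros; now apply resp_continuous).
    assert (Hfac : forall t, 0 < exp (- t / 2) / (k * w)).
    { intros t. apply Rdiv_lt_0_compat; [apply exp_pos|exact Hkw]. }
    set (y := fun t => Y t - 2 * r / M).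
    assert (HdT : dY T = 0) by (rewrite HdY, Rminus_diag, sin_0; ring).
    (* at T the velocity vanishes while it increases, so the restoring force is
       positive and the position lies below the equilibrium *)
    assert (HyT : y T < 0).
    { assert (Hacc : is_derive dY T (- dY T - M * Y T + 2 * r)) by now apply dresp_derive.
      assert (Hacc' : is_derive dY T (exp (- T / 2) / k)).
      { apply (is_derive_ext (fun t => exp (- t / 2) / (k * w) * sin (w * t - w * T))).
        - intros t. symmetry. apply HdY.
        - auto_derive; [auto|]. rewrite Rplus_opp_r, sin_0, cos_0. unfold Rdiv. field. lra. }
      pose proof (is_derive_unique _ _ _ Hacc) as U. rewrite (is_derive_unique _ _ _ Hacc'), HdT in U.
      assert (0 < exp (- T / 2) / k) by (apply Rdiv_lt_0_compat; [apply exp_pos|exact Hk]).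
      unfold y. assert (2 * r / M * M = 2 * r) by (field; lra). nra. }
    assert (Hlate : forall t, T <= t -> Y T <= Y t).
    { intros t Ht. pose proof (energy_decreases M g dg PM Hg p r T t Ht) as H. fold Y dY in H.
      rewrite HdT in H. pose proof (pow2_ge_0 (dY t)). unfold y in HyT.
      assert ((Y t - 2 * r / M) ^ 2 <= (Y T - 2 * r / M) ^ 2) by nra.
      apply Rnot_lt_le. intros Hlt. nra. }
    assert (Hmid : forall t, 0 <= t <= T -> T - PI / w <= t -> Y T <= Y t).
    { intros t Ht Htm.
      pose proof (increment_le Y dY t T 0 ltac:(lra)) as H.
      assert (Y T - Y t <= 0 * (T - t)); [|lra]. apply H; auto.
      intros x Hx. rewrite HdY.
      assert (0 <= sin (w * T - w * x)).
      { apply sin_ge_0; [nra|].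
        assert (w * (PI / w) = PI) by (field; lra). nra. }
      replace (w * x - w * T) with (- (w * T - w * x)) by ring. rewrite sin_neg.
      specialize (Hfac x). nra. }
    assert (Hearly : forall t, 0 <= t -> t <= T - PI / w -> 1 <= Y t).
    { intros t Ht Htm.
      pose proof (increment_ge Y dY 0 t 0 ltac:(lra)) as H.
      assert (0 * (t - 0) <= Y t - Y 0).
      { apply H; auto. intros x Hx. rewrite HdY.
        assert (0 <= sin (w * x - w * T + 2 * PI)).
        { assert (w * (PI / w) = PI) by (field; lra).
          apply sin_ge_0; nra. }
        rewrite sin_plus, sin_2PI, cos_2PI, Rmult_1_r, Rmult_0_r, Rplus_0_r in H0.
        specialize (Hfac x). nra. }
      replace (Y 0) with 1 in H0 by (unfold Y; rewrite resp_0; auto). lra. }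
    assert (Hmin : forall t, 0 <= t -> Y t <= 0 -> Y T <= 0).
    { intros t Ht HY. destruct (Rle_dec T t) as [H1|H1].
      - specialize (Hlate t H1). lra.
      - destruct (Rle_dec (T - PI / w) t) as [H2|H2].
        + specialize (Hmid t ltac:(lra) H2). lra.
        + specialize (Hearly t Ht ltac:(lra)). lra. }
    assert (Hiff : 4 * r ^ 2 / M * exp T <= p ^ 2 + p * y0 + M * y0 ^ 2 <-> Y T <= 0).
    { pose proof (spiral_invariant M g dg PM Hg p r T ltac:(lra)) as H. fold Y dY y0 in H.
      rewrite HdT in H. rewrite <- H, E4. unfold y in HyT.
      pose proof (exp_pos T).
      assert (Hsq : (2 * r / M) ^ 2 <= (Y T - 2 * r / M) ^ 2 <-> Y T <= 0).
      { split; intros H1; [apply Rnot_lt_le; intros Hlt; nra|nra]. }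
      rewrite <- Hsq. split; intros H1.
      - assert (0 < M * exp T) by nra.
        apply Rmult_le_reg_l with (M * exp T); [assumption|]. lra.
      - assert (0 < M * exp T) by nra.
        apply (Rmult_le_compat_l (M * exp T)) in H1; lra. }
    rewrite Hiff. split.
    + intros H. exists T. lra.
    + intros [t [Ht HY]]. now apply (Hmin t).
Qed.

End Underdamped.

(** * The global solution *)

Ltac rewrite_derive D :=
  match type of D with
  | is_derive ?f ?x ?l =>
      match goal with
      | |- context [Derive ?h x] =>
          replace (Derive h x) with l by (symmetry; exact (is_derive_unique h x l D))
      end
  end.

(** If l is the derivative of f at s0, the difference quotient extended by l is
    continuous there, and conversely. *)
Definition slope (f : R -> R) (s0 l s : R) : R :=
  if Req_dec_T s s0 then l else (f s - f s0) / (s - s0).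

Lemma slope_spec f s0 l s : f s - f s0 = slope f s0 l s * (s - s0).
Proof.
  unfold slope. destruct (Req_dec_T s s0) as [->|H]; [ring|]. field. lra.
Qed.

Lemma slope_continuous (f : R -> R) (s0 l : R) : is_derive f s0 l -> continuous (slope f s0 l) s0.
Proof.
  intros H. apply is_derive_Reals in H. apply filterlim_locally. intros e.
  destruct (H e (cond_pos e)) as [d Hd]. exists d. intros s Hs.
  change (Rabs (s - s0) < d) in Hs. change (Rabs (slope f s0 l s - slope f s0 l s0) < e).
  unfold slope. destruct (Req_dec_T s0 s0) as [_|]; [|easy].
  destruct (Req_dec_T s s0) as [->|Hne].
  - rewrite Rminus_diag, Rabs_R0. apply cond_pos.
  - specialize (Hd (s - s0) ltac:(lra) Hs). now replace (s0 + (s - s0)) with s in Hd by ringR.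
Qed.

Lemma is_derive_of_slope (f phi : R -> R) (s0 : R) :
  continuous phi s0 -> locally s0 (fun s => f s - f s0 = phi s * (s - s0)) ->
  is_derive f s0 (phi s0).
Proof.
  intros Hc [d1 H1]. apply is_derive_Reals. intros e He.
  destruct (proj1 (filterlim_locally phi (phi s0)) Hc (mkposreal e He)) as [d2 H2].
  assert (Hd : 0 < Rmin d1 d2) by (apply Rmin_glb_lt; apply cond_pos).
  exists (mkposreal _ Hd). intros h Hh0 Hh. simpl in Hh.
  pose_minmax.
  rewrite (H1 (s0 + h)).
  - replace (phi (s0 + h) * (s0 + h - s0) / h) with (phi (s0 + h)) by (field; auto).
    apply (H2 (s0 + h)). change (Rabs (s0 + h - s0) < d2). replace (s0 + h - s0) with h by ring. lra.
  - change (Rabs (s0 + h - s0) < d1). replace (s0 + h - s0) with h by ring. lra.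
Qed.

(** The mean value theorem in x writes the increment of h as a multiple of s - s0
    whose factor is continuous at s0. *)
Lemma implicit_derive (G Gx : R -> R -> R) (h : R -> R) (s0 Gs : R) :
  locally s0 (fun s => forall x, is_derive (fun x => G x s) x (Gx x s)) ->
  continuous (fun p : R * R => Gx (fst p) (snd p)) (h s0, s0) ->
  Gx (h s0) s0 <> 0 ->
  is_derive (G (h s0)) s0 Gs ->
  continuous h s0 ->
  locally s0 (fun s => G (h s) s = G (h s0) s0) ->
  is_derive h s0 (- Gs / Gx (h s0) s0).
Proof.
  intros HGx CGx Hne HGs Ch Heq.
  assert (Hxi : forall s, exists xi, Rabs (xi - h s0) <= Rabs (h s - h s0) /\
     ((forall x, is_derive (fun x => G x s) x (Gx x s)) ->
       G (h s) s - G (h s0) s = Gx xi s * (h s - h s0))).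
  { intros s. destruct (classic (forall x, is_derive (fun x => G x s) x (Gx x s))) as [H|H].
    - destruct (MVT_gen (fun x => G x s) (h s0) (h s) (fun x => Gx x s)) as [xi [Hx1 Hx2]].
      + intros; apply H.
      + intros x _. apply continuity_pt_filterlim. apply (is_derive_continuous (fun x => G x s) x _ (H x)).
      + exists xi. split; [|auto]. revert Hx1. unfold Rmin, Rmax, Rabs.
        destruct (Rle_dec (h s0) (h s)), (Rcase_abs (xi - h s0)), (Rcase_abs (h s - h s0)); lra.
    - exists (h s0). split; [rewrite Rminus_diag, Rabs_R0; apply Rabs_pos|tauto]. }
  apply choice in Hxi. destruct Hxi as [xi Hxi].
  assert (xi0 : xi s0 = h s0).
  { destruct (Hxi s0) as [H _]. rewrite Rminus_diag, Rabs_R0 in H.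
    pose proof (Rabs_pos (xi s0 - h s0)). apply Rminus_diag_uniq, Rabs_eq_0. lra. }
  assert (Cxi : continuous xi s0).
  { apply filterlim_locally. intros e.
    destruct (proj1 (filterlim_locally h (h s0)) Ch e) as [d Hd]. exists d. intros s Hs.
    specialize (Hd s Hs). change (Rabs (h s - h s0) < e) in Hd.
    change (Rabs (xi s - xi s0) < e). rewrite xi0. destruct (Hxi s) as [H _]. lra. }
  set (den := fun s => Gx (xi s) s).
  assert (Cden : continuous den s0).
  { apply (continuous_along Gx xi (fun s => s)); [now rewrite xi0|exact Cxi|apply continuous_id]. }
  assert (Hden0 : den s0 <> 0) by (unfold den; now rewrite xi0).
  set (phi := fun s => - slope (G (h s0)) s0 Gs s * / den s).
  replace (- Gs / Gx (h s0) s0) with (phi s0).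
  2:{ unfold phi, den. rewrite xi0. unfold slope. destruct (Req_dec_T s0 s0); [|easy].
      unfold Rdiv. ring. }
  apply is_derive_of_slope.
  - apply (continuous_mult (fun s => - slope (G (h s0)) s0 Gs s) (fun s => / den s)).
    + apply (continuous_opp (slope (G (h s0)) s0 Gs)). now apply slope_continuous.
    + apply (continuous_comp den Rinv); [exact Cden|]. now apply continuous_Rinv.
  - assert (Hnz : locally s0 (fun s => den s <> 0)).
    { apply (Cden (fun z => z <> 0)). assert (Hp : 0 < Rabs (den s0)) by now apply Rabs_pos_lt.
      exists (mkposreal _ Hp). intros z Hz. change (Rabs (z - den s0) < Rabs (den s0)) in Hz.
      intros E. rewrite E, Rminus_0_l, Rabs_Ropp in Hz. lra. }
    generalize (filter_and _ _ HGx (filter_and _ _ Heq Hnz)). apply filter_imp.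
    intros s [H1 [H2 H3]]. destruct (Hxi s) as [_ H]. specialize (H H1).
    rewrite H2 in H. pose proof (slope_spec (G (h s0)) s0 Gs s) as Hsl.
    unfold phi. fold (den s) in H.
    replace (- slope (G (h s0)) s0 Gs s * / den s * (s - s0))
      with (- (slope (G (h s0)) s0 Gs s * (s - s0)) * / den s) by ring.
    rewrite <- Hsl. replace (- (G (h s0) s - G (h s0) s0)) with (den s * (h s - h s0)) by lra.
    field. exact H3.
Qed.

Section GlobalSolution.

Variables (delta B R0 M c v : R) (g dg rho0 drho0 u0 du0 ddu0 m0 : R -> R).
Hypothesis HM : 0 < M.
Hypothesis Hg : impulse_response M g dg.
Hypothesis HD : cauchy_data delta B R0 M c v rho0 drho0 u0 du0 m0.
Hypothesis Dddu : forall x, is_derive du0 x (ddu0 x).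
Hypothesis Cddu : forall x, continuous ddu0 x.

Notation X := (motion M g dg c v u0 m0).
Notation V := (motion_velocity M g dg c v u0 m0).
Notation J := (jacobian M g dg du0 rho0).
Notation J1 := (jacobian_rate M g dg du0 rho0).

Hypothesis PJ : forall x t, 0 <= t -> 0 < J x t.

Let Crho0 : forall x, continuous rho0 x.
Proof. intros x. eapply is_derive_continuous, (cd_drho HD). Qed.

Let Cdu0 : forall x, continuous du0 x.
Proof. apply (cd_du_continuous HD). Qed.

Let CJ : cts2 J.
Proof. now apply cts2_jacobian. Qed.

Let CJ1 : cts2 J1.
Proof. now apply cts2_jacobian_rate. Qed.

Let CX : cts2 X.
Proof. apply (cts2_motion M g dg Hg c v u0 du0 rho0 m0); apply HD. Qed.

Let CV : cts2 V.
Proof. apply (cts2_motion_velocity M g dg Hg c v u0 du0 rho0 m0); apply HD. Qed.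

Lemma motion_derive_label x t : is_derive (fun x => X x t) x (J x t).
Proof. apply motion_derive_x; [exact HM|apply (cd_du HD)|apply (cd_dm HD)]. Qed.

(** Far out the density is negligible, and a nearly homogeneous response that stays
    nonnegative beyond time t cannot be small at time t. *)
Lemma jacobian_bounded_below t : 0 <= t -> exists k, 0 < k /\ forall x, k <= J x t.
Proof.
  intros Ht. destruct Ht as [Ht|<-].
  2:{ exists 1. split; [lra|]. intros x. rewrite jacobian_0 by auto. lra. }
  destruct (oscillator_floor (M + 2) B t (t + 1)) as [eps [eta [Heps [Heta Hfl]]]]; [lra|lra|].
  destruct (density_vanishes delta rho0 R0 (cd_delta HD) (cd_pos HD) (cd_decay HD) eta Heta) as [N HN].
  assert (Hfar : forall x, N <= Rabs x -> eps <= J x t).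
  { intros x Hx. apply (Hfl (J x) (J1 x) (fun t => - M * J x t + 2 * rho0 x) (rho0 x)).
    - intros s _. now apply resp_continuous.
    - intros s _. now apply dresp_continuous.
    - intros s _. now apply jacobian_derive_t.
    - intros s _. replace (- J1 x s + (- M * J x s + 2 * rho0 x))
        with (- J1 x s - M * J x s + 2 * rho0 x) by ring.
      now apply dresp_derive.
    - intros s _. eapply Rle_trans; [apply Rabs_triang|].
      rewrite !Rabs_mult, Rabs_Ropp, (Rabs_pos_eq M), (Rabs_pos_eq 2) by lra.
      pose proof (Rabs_pos (J x s)). pose proof (Rabs_pos (rho0 x)). nra.
    - intros s Hs. left. apply PJ. lra.
    - now apply jacobian_0.
    - unfold jacobian_rate. rewrite dresp_0 by auto. apply (cd_du_bound HD).
    - rewrite Rabs_pos_eq by (left; apply (cd_pos HD)). now apply HN. }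
  destruct (continuity_ab_min (fun x => J x t) (- Rabs N) (Rabs N)) as [xm [Hmin _]].
  { pose proof (Rabs_pos N). lra. }
  { intros x _. apply continuity_pt_filterlim. apply (cts2_l J), CJ. }
  exists (Rmin eps (J xm t)). split; [apply Rmin_glb_lt; [lra|apply PJ; lra]|].
  intros x. destruct (Rle_dec N (Rabs x)) as [H|H].
  - eapply Rle_trans; [apply Rmin_l|now apply Hfar].
  - eapply Rle_trans; [apply Rmin_r|]. apply Hmin.
    assert (Rabs x <= Rabs N) by (pose proof (Rle_abs N); lra).
    now apply Rabs_le_between.
Qed.

Lemma motion_increasing t x1 x2 : 0 <= t -> x1 < x2 -> X x1 t < X x2 t.
Proof.
  intros Ht. apply (strictly_increasing_of_derive (fun x => X x t) (fun x => J x t)).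
  - intros x. apply motion_derive_label.
  - intros x. now apply PJ.
Qed.

Lemma motion_onto t y : 0 <= t -> exists x, X x t = y.
Proof.
  intros Ht. destruct (jacobian_bounded_below t Ht) as [k [Hk HJ]].
  assert (HX : forall a b, a <= b -> k * (b - a) <= X b t - X a t).
  { intros a b Hab. apply (increment_ge (fun x => X x t) (fun x => J x t)); auto.
    - intros x _. eapply is_derive_continuous, motion_derive_label.
    - intros x _. apply motion_derive_label. }
  set (d := Rabs (y - X 0 t) / k).
  assert (Hd : 0 <= d) by (apply Rdiv_le_0_compat; [apply Rabs_pos|lra]).
  assert (Hkd : k * d = Rabs (y - X 0 t)) by (unfold d; field; lra).
  pose proof (HX 0 d Hd) as H1. pose proof (HX (- d) 0 ltac:(lra)) as H2.
  pose proof (Rle_abs (y - X 0 t)). pose proof (Rle_abs (- (y - X 0 t))). rewrite Rabs_Ropp in *.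
  destruct (IVT_gen (fun x => X x t) (- d) d y) as [x [_ Hx]].
  - intros x. apply continuity_pt_filterlim. apply (cts2_l X), CX.
  - split.
    + apply Rle_trans with (X (- d) t); [apply Rmin_l|lra].
    + apply Rle_trans with (X d t); [lra|apply Rmax_r].
  - now exists x.
Qed.

Lemma label_map_exists : exists L : R -> R -> R, forall y t, 0 <= t -> X (L y t) t = y.
Proof.
  destruct (choice (fun (p : R * R) x => 0 <= snd p -> X x (snd p) = fst p)) as [L HL].
  - intros [y t]. simpl. destruct (Rle_dec 0 t) as [Ht|Ht].
    + destruct (motion_onto t y Ht) as [x Hx]. now exists x.
    + exists 0. tauto.
  - exists (fun y t => L (y, t)). intros y t Ht. apply (HL (y, t)). exact Ht.
Qed.

Variable L : R -> R -> R.
Hypothesis HL : forall y t, 0 <= t -> X (L y t) t = y.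

Lemma motion_lt_inv t x1 x2 : 0 <= t -> X x1 t < X x2 t -> x1 < x2.
Proof.
  intros Ht H. destruct (Rtotal_order x1 x2) as [E|[E|E]]; [exact E|subst; lra|].
  pose proof (motion_increasing t x2 x1 Ht E). lra.
Qed.

Lemma label_of_motion x t : 0 <= t -> L (X x t) t = x.
Proof.
  intros Ht. pose proof (HL (X x t) t Ht) as H.
  destruct (Rtotal_order (L (X x t) t) x) as [E|[E|E]]; [|exact E|];
    apply (motion_increasing t _ _ Ht) in E; lra.
Qed.

(** As the motion preserves the order of labels, its continuity in time at the two
    labels L y t - e and L y t + e traps the labels of nearby points. *)
Lemma label_near y t e : 0 <= t -> 0 < e ->
  locally (y, t) (fun p : R * R => 0 <= snd p -> Rabs (L (fst p) (snd p) - L y t) < e).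
Proof.
  intros Ht He. set (x := L y t).
  assert (Ha : X (x - e) t < y) by (rewrite <- (HL y t Ht); apply motion_increasing; auto; fold x; lra).
  assert (Hb : y < X (x + e) t) by (rewrite <- (HL y t Ht) at 1; apply motion_increasing; auto; fold x; lra).
  assert (Hgap : forall z, cts2 (fun y s => y - X z s)).
  { intros z. apply cts2_minus; [solve_cts2|].
    apply (cts2_snd (X z)). intros s. apply (cts2_r X z s CX). }
  assert (H1 : locally (y, t) (fun p : R * R => 0 < fst p - X (x - e) (snd p))).
  { apply (Hgap (x - e) y t (fun z => 0 < z)). simpl. apply (open_gt 0). lra. }
  assert (H2 : locally (y, t) (fun p : R * R => fst p - X (x + e) (snd p) < 0)).
  { apply (Hgap (x + e) y t (fun z => z < 0)). simpl. apply (open_lt 0). lra. }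
  generalize (filter_and _ _ H1 H2). apply filter_imp. intros [y' s] [G1 G2] Hs. simpl in *.
  rewrite <- (HL y' s Hs) in G1, G2.
  assert (x - e < L y' s) by (apply (motion_lt_inv s); auto; lra).
  assert (L y' s < x + e) by (apply (motion_lt_inv s); auto; lra).
  apply Rabs_def1; lra.
Qed.

Lemma transport_continuous (phi : R -> R -> R) :
  (forall x t, 0 <= t -> continuous (fun p : R * R => phi (fst p) (snd p)) (x, t)) ->
  continuous_on (strip p_infty) (fun p => phi (L (fst p) (snd p)) (snd p)).
Proof.
  intros Hphi [y t] [Ht _]. simpl in Ht. simpl.
  set (m := fun p : R * R => (L (fst p) (snd p), snd p)).
  apply (filterlim_comp _ _ _ m (fun p => phi (fst p) (snd p)) _ (locally (L y t, t)));
    [|exact (Hphi (L y t) t Ht)].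
  intros P [e HP]. unfold filtermap, within.
  pose proof (label_near y t e Ht (cond_pos e)) as H1.
  assert (H2 : locally (y, t) (fun p : R * R => ball t e (snd p))).
  { exists e. intros p [_ Hp]. exact Hp. }
  generalize (filter_and _ _ H1 H2). apply filter_imp. intros p [G1 G2] [Hp _].
  apply HP. split; [exact (G1 Hp)|exact G2].
Qed.

Lemma transport_slice_continuous (phi : R -> R -> R) (y t : R) : 0 <= t ->
  continuous (fun x => phi x t) (L y t) -> continuous (fun y => phi (L y t) t) y.
Proof.
  intros Ht Hphi. apply (continuous_comp (fun y => L y t) (fun x => phi x t)); [|exact Hphi].
  apply filterlim_locally. intros e. destruct (label_near y t e Ht (cond_pos e)) as [d Hd].
  exists d. intros z Hz. apply (Hd (z, t)); [|exact Ht]. split; [exact Hz|apply ball_center].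
Qed.

Lemma label_time_continuous y t : 0 < t -> continuous (fun s => L y s) t.
Proof.
  intros Ht. apply filterlim_locally. intros e.
  destruct (label_near y t e ltac:(lra) (cond_pos e)) as [d Hd].
  assert (Hm : 0 < Rmin d t) by (apply Rmin_glb_lt; [apply cond_pos|lra]).
  exists (mkposreal _ Hm). intros s Hs. change (Rabs (s - t) < Rmin d t) in Hs.
  pose_minmax.
  apply (Hd (y, s)); [split; [apply ball_center|change (Rabs (s - t) < d); lra]|].
  apply Rabs_def2 in Hs. simpl. lra.
Qed.

Lemma label_derive_x y t : 0 <= t -> is_derive (fun y => L y t) y (/ J (L y t) t).
Proof.
  intros Ht. pose proof (PJ (L y t) t Ht) as Hp.
  replace (/ J (L y t) t) with (- (- 1) / J (L y t) t) by (field; lra).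
  apply (implicit_derive (fun x s => X x t - s) (fun x _ => J x t) (fun y => L y t) y (- 1)).
  - apply filter_forall. intros s x.
    replace (J x t) with (J x t - 0) by ring.
    apply (is_derive_minus (fun x => X x t) (fun _ => s)); [apply motion_derive_label|apply @is_derive_const].
  - apply (cts2_fst (fun x => J x t)). intros x. apply (cts2_l J), CJ.
  - lra.
  - auto_derive; [auto|]. ring.
  - apply (transport_slice_continuous (fun x _ => x)); [exact Ht|apply continuous_id].
  - apply filter_forall. intros s. rewrite !HL by exact Ht. ring.
Qed.

Lemma label_derive_t y t : 0 < t ->
  is_derive (fun s => L y s) t (- V (L y t) t / J (L y t) t).
Proof.
  intros Ht. pose proof (PJ (L y t) t ltac:(lra)) as Hp.
  apply (implicit_derive X J (fun s => L y s) t (V (L y t) t)).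
  - apply filter_forall. intros s x. apply motion_derive_label.
  - apply CJ.
  - lra.
  - now apply motion_derive_t.
  - now apply label_time_continuous.
  - exists (mkposreal t Ht). intros s Hs. change (Rabs (s - t) < t) in Hs. apply Rabs_def2 in Hs.
    rewrite !HL; lra.
Qed.

(** The label of a point has the derivatives 1 / J in space and - V / J in time. *)
Lemma transport_derive (phi phix phit : R -> R -> R) y t : 0 < t ->
  (forall x s, 0 < s -> is_derive (fun x => phi x s) x (phix x s)) ->
  (forall x s, 0 < s -> is_derive (fun s => phi x s) s (phit x s)) ->
  (forall x s, 0 <= s -> continuous (fun p : R * R => phix (fst p) (snd p)) (x, s)) ->
  is_derive (fun y => phi (L y t) t) y (phix (L y t) t / J (L y t) t) /\
  is_derive (fun s => phi (L y s) s) t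
    (phit (L y t) t - phix (L y t) t * V (L y t) t / J (L y t) t).
Proof.
  intros Ht Dx Dt Cx. pose proof (PJ (L y t) t ltac:(lra)) as Hp. split.
  - replace (phix (L y t) t / J (L y t) t) with (scal (/ J (L y t) t) (phix (L y t) t))
      by (unfold scal; simpl; unfold mult; simpl; field; lra).
    apply (is_derive_comp (fun x => phi x t) (fun y => L y t)); [now apply Dx|].
    apply label_derive_x. lra.
  - replace (phit (L y t) t - phix (L y t) t * V (L y t) t / J (L y t) t)
      with (phix (L y t) t * (- V (L y t) t / J (L y t) t) + phit (L y t) t) by (field; lra).
    apply (is_derive_along phi phix (fun s => L y s) 0 (t + 1)); [lra| | | |].
    + intros z s Hs. apply Dx. lra.
    + apply Cx. lra.
    + now apply Dt.
    + now apply label_derive_t.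
Qed.

Lemma continuous_divide (f h : R * R -> R) p :
  continuous f p -> continuous h p -> h p <> 0 -> continuous (fun p => f p / h p) p.
Proof.
  intros Hf Hh Hne. apply (continuous_mult f (fun p => / h p)); [exact Hf|].
  apply (continuous_comp h Rinv); [exact Hh|]. now apply continuous_Rinv.
Qed.

Lemma transport_C1 (phi phix phit : R -> R -> R) :
  (forall x s, 0 < s -> is_derive (fun x => phi x s) x (phix x s)) ->
  (forall x s, 0 < s -> is_derive (fun s => phi x s) s (phit x s)) ->
  (forall x s, 0 <= s -> continuous (fun p : R * R => phi (fst p) (snd p)) (x, s)) ->
  (forall x s, 0 <= s -> continuous (fun p : R * R => phix (fst p) (snd p)) (x, s)) ->
  (forall x s, 0 <= s -> continuous (fun p : R * R => phit (fst p) (snd p)) (x, s)) ->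
  C1_strip p_infty (fun y t => phi (L y t) t).
Proof.
  intros Dx Dt C0 Cx Ct.
  exists (fun y t => phix (L y t) t / J (L y t) t),
    (fun y t => phit (L y t) t - phix (L y t) t * V (L y t) t / J (L y t) t).
  split; [|split; [|split]].
  - intros y t Ht _. now apply transport_derive.
  - now apply transport_continuous.
  - apply (transport_continuous (fun x t => phix x t / J x t)).
    intros x t Ht. apply continuous_divide; [now apply Cx|apply CJ|].
    simpl. pose proof (PJ x t Ht). lra.
  - apply (transport_continuous (fun x t => phit x t - phix x t * V x t / J x t)).
    intros x t Ht. apply (continuous_minus (fun p : R * R => phit (fst p) (snd p))
      (fun p : R * R => phix (fst p) (snd p) * V (fst p) (snd p) / J (fst p) (snd p))); [now apply Ct|].
    apply continuous_divide; [|apply CJ|simpl; pose proof (PJ x t Ht); lra].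
    apply (continuous_mult (fun p : R * R => phix (fst p) (snd p))
      (fun p : R * R => V (fst p) (snd p))); [now apply Cx|apply CV].
Qed.

Definition density_label (x t : R) : R := rho0 x / J x t.

Definition jacobian_x (x t : R) : R := resp M g dg 0 (ddu0 x) (2 * drho0 x) t.

Definition density_label_x (x t : R) : R :=
  (drho0 x * J x t - rho0 x * jacobian_x x t) / (J x t * J x t).

Definition density_label_t (x t : R) : R := - (rho0 x * J1 x t) / (J x t * J x t).

Definition acceleration (x t : R) : R :=
  - V x t - (M - 2 * m0 x + M * X x t - M * (c + v * (1 - exp (- t)))).

Lemma jacobian_derive_x x t : is_derive (fun x => J x t) x (jacobian_x x t).
Proof.
  pose proof (Dddu x) as H1. pose proof (cd_drho HD x) as H2.
  unfold jacobian, jacobian_x, resp. auto_derive.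
  - repeat split; eexists; eassumption.
  - use_derivatives. field. lra.
Qed.

Lemma density_label_derive_x x t : 0 <= t ->
  is_derive (fun x => density_label x t) x (density_label_x x t).
Proof.
  intros Ht. pose proof (PJ x t Ht) as Hp. unfold density_label, density_label_x.
  replace ((drho0 x * J x t - rho0 x * jacobian_x x t) / (J x t * J x t))
    with ((drho0 x * J x t - rho0 x * jacobian_x x t) / J x t ^ 2) by (field; lra).
  apply (is_derive_div rho0 (fun x => J x t)); [apply (cd_drho HD)|apply jacobian_derive_x|lra].
Qed.

Lemma density_label_derive_t x t : 0 <= t ->
  is_derive (fun t => density_label x t) t (density_label_t x t).
Proof.
  intros Ht. pose proof (PJ x t Ht) as Hp. unfold density_label, density_label_t.
  replace (- (rho0 x * J1 x t) / (J x t * J x t))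
    with ((0 * J x t - rho0 x * J1 x t) / J x t ^ 2) by (field; lra).
  apply (is_derive_div (fun _ => rho0 x) (J x)); [apply @is_derive_const|now apply jacobian_derive_t|lra].
Qed.

Lemma density_label_continuous x t : 0 <= t ->
  continuous (fun p : R * R => density_label (fst p) (snd p)) (x, t).
Proof.
  intros Ht. apply continuous_divide; [|apply CJ|simpl; pose proof (PJ x t Ht); lra].
  now apply (cts2_fst rho0).
Qed.

Lemma density_label_x_continuous x t : 0 <= t ->
  continuous (fun p : R * R => density_label_x (fst p) (snd p)) (x, t).
Proof.
  intros Ht. assert (Cdr := cd_drho_continuous HD).
  assert (CJx : cts2 jacobian_x).
  { apply (cts2_resp M g dg Hg (fun _ => 0) ddu0 (fun x => 2 * drho0 x)); intros; solve_continuous. }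
  apply continuous_divide; [| |simpl; pose proof (PJ x t Ht); nra].
  - apply (cts2_minus (fun x s => drho0 x * J x s) (fun x s => rho0 x * jacobian_x x s)); solve_cts2.
  - now apply (cts2_mult J J).
Qed.

Lemma density_C1 : C1_strip p_infty (fun y t => density_label (L y t) t).
Proof.
  apply (transport_C1 density_label density_label_x density_label_t).
  - intros x s Hs. apply density_label_derive_x. lra.
  - intros x s Hs. apply density_label_derive_t. lra.
  - apply density_label_continuous.
  - apply density_label_x_continuous.
  - intros x s Hs.
    apply continuous_divide; [| |simpl; pose proof (PJ x s Hs); nra].
    + apply (cts2_opp (fun x s => rho0 x * J1 x s)). solve_cts2.
    + now apply (cts2_mult J J).
Qed.

Lemma cts2_acceleration : cts2 acceleration.
Proof.
  assert (Cm0 : forall x, continuous m0 x) by (intros; eapply is_derive_continuous, (cd_dm HD)).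
  unfold acceleration. solve_cts2.
Qed.

Lemma velocity_derive_label x t : is_derive (fun x => V x t) x (J1 x t).
Proof. apply motion_velocity_derive_x; [apply (cd_du HD)|apply (cd_dm HD)]. Qed.

Lemma velocity_C1 : C1_strip p_infty (fun y t => V (L y t) t).
Proof.
  apply (transport_C1 V J1 acceleration).
  - intros x s _. apply velocity_derive_label.
  - intros x s _. now apply motion_velocity_derive_t.
  - intros x s _. apply CV.
  - intros x s _. apply CJ1.
  - intros x s _. apply cts2_acceleration.
Qed.

Lemma transported_conv x t : 0 <= t ->
  is_line (fun y => dW (X x t - y) * density_label (L y t) t)
    (M - 2 * m0 x + M * X x t - M * (c + v * (1 - exp (- t)))).
Proof.
  intros Ht.
  apply (conv_lagrangian (fun x => X x t) (fun x => J x t) (fun y => density_label (L y t) t) rho0).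
  - intros z. apply motion_derive_label.
  - intros z. apply (cts2_l J), CJ.
  - intros z. now apply PJ.
  - intros y. now apply motion_onto.
  - intros y. apply transport_slice_continuous; [exact Ht|].
    eapply is_derive_continuous. now apply density_label_derive_x.
  - exact Crho0.
  - intros z. rewrite label_of_motion by exact Ht. unfold density_label.
    pose proof (PJ z t Ht). field. lra.
  - apply (cd_mass HD).
  - apply (cd_left_mass HD).
  - eapply motion_first_moment; try eassumption; apply HD.
Qed.

Lemma linear_growth (F dF : R -> R) (k : R) :
  (forall x, is_derive F x (dF x)) -> (forall x, Rabs (dF x) <= k) ->
  exists C, 1 <= C /\ forall x, Rabs (F x) <= C * (1 + Rabs x).
Proof.
  intros D Hk. assert (k0 : 0 <= k) by (eapply Rle_trans; [apply Rabs_pos|apply (Hk 0)]).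
  exists (Rabs (F 0) + k + 1). pose proof (Rabs_pos (F 0)). split; [lra|]. intros x.
  assert (H1 : Rabs (F x - F 0) <= k * Rabs x).
  { destruct (Rle_dec 0 x).
    - rewrite (Rabs_pos_eq x) by lra. replace x with (x - 0) at 2 by ring.
      apply (increment_abs F dF); auto. intros z _. eapply is_derive_continuous, D.
    - rewrite Rabs_minus_sym, (Rabs_left1 x) by lra. replace (- x) with (0 - x) by ring.
      apply (increment_abs F dF); auto; [lra|]. intros z _. eapply is_derive_continuous, D. }
  pose proof (Rabs_triang_inv (F x) (F 0)). pose proof (Rabs_pos x). nra.
Qed.

Lemma jacobians_bounded t : exists k, forall x, Rabs (J x t) <= k /\ Rabs (J1 x t) <= k.
Proof.
  assert (Hb : forall a1 a2 a3, exists k, forall x, Rabs (1 * a1 + du0 x * a2 + 2 * rho0 x * a3) <= k).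
  { intros a1 a2 a3. exists (Rabs a1 + B * Rabs a2 + 2 * R0 * Rabs a3). intros x.
    pose proof (cd_du_bound HD x) as H1.
    pose proof (density_bounded delta rho0 R0 (cd_delta HD) (cd_pos HD) (cd_decay HD) x) as H2.
    pose proof (cd_pos HD x) as H3.
    eapply Rle_trans; [apply Rabs_triang|]. apply Rplus_le_compat.
    - eapply Rle_trans; [apply Rabs_triang|]. rewrite Rmult_1_l, Rabs_mult.
      apply Rplus_le_compat_l. apply Rmult_le_compat_r; [apply Rabs_pos|exact H1].
    - rewrite Rabs_mult, (Rabs_pos_eq (2 * rho0 x)) by lra.
      apply Rmult_le_compat_r; [apply Rabs_pos|lra]. }
  destruct (Hb (dg t + g t) (g t) ((1 - dg t - g t) / M)) as [k1 H1].
  destruct (Hb (- M * g t) (dg t) (g t)) as [k2 H2].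
  exists (Rmax k1 k2). intros x. split.
  - eapply Rle_trans; [apply H1|apply Rmax_l].
  - eapply Rle_trans; [|apply Rmax_r]. unfold jacobian_rate, dresp.
    replace (- M * 1 * g t) with (1 * (- M * g t)) by ring. apply H2.
Qed.

Lemma motion_growth t : exists C, 1 <= C /\
  forall x, Rabs (X x t) <= C * (1 + Rabs x) /\ Rabs (V x t) <= C * (1 + Rabs x).
Proof.
  destruct (jacobians_bounded t) as [k Hk].
  destruct (linear_growth (fun x => X x t) (fun x => J x t) k) as [C1 [H1 H1']].
  { intros x. apply motion_derive_label. } { intros x. apply Hk. }
  destruct (linear_growth (fun x => V x t) (fun x => J1 x t) k) as [C2 [H2 H2']].
  { intros x. apply velocity_derive_label. } { intros x. apply Hk. }
  exists (Rmax C1 C2). pose_minmax. split; [lra|].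
  intros x. specialize (H1' x). specialize (H2' x). pose proof (Rabs_pos x). split; nra.
Qed.

Lemma density_bounded_by_datum t : 0 <= t ->
  exists k, 0 < k /\ forall x, 0 < density_label x t <= k * rho0 x.
Proof.
  intros Ht. destruct (jacobian_bounded_below t Ht) as [k [Hk HJ]].
  exists (/ k). split; [now apply Rinv_0_lt_compat|]. intros x.
  pose proof (cd_pos HD x). specialize (HJ x). unfold density_label. split.
  - apply Rdiv_lt_0_compat; lra.
  - unfold Rdiv. rewrite Rmult_comm. apply Rmult_le_compat_r; [lra|].
    apply Rinv_le_contravar; lra.
Qed.

Lemma weighted_density_vanishes e : 0 < e ->
  exists N, forall x, N <= Rabs x -> rho0 x * (1 + Rabs x) ^ 2 <= e.
Proof.
  intros He. assert (HR0 : 0 < R0).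
  { eapply Rlt_le_trans; [apply (cd_pos HD 0)|].
    apply (density_bounded delta rho0 R0 (cd_delta HD) (cd_pos HD) (cd_decay HD)). }
  pose proof (cd_delta HD) as Hdel.
  (* since rho0 (1 + |x|)^2 <= 2 R0 (1 + x^2)^(- delta / 2), it suffices that
     1 + x^2 >= A *)
  set (A := exp (2 / delta * ln (2 * R0 / e))).
  assert (HA : 0 < A) by apply exp_pos.
  exists (A + 1). intros x Hx.
  pose proof (cd_decay HD x) as H. pose proof (cd_pos HD x) as Hp.
  rewrite <- (pow2_abs x) in H. set (ax := Rabs x) in *.
  set (W := 1 + ax ^ 2) in *.
  assert (HW : A <= W) by (unfold W; nra).
  assert (HW1 : 1 <= W) by (unfold W; pose proof (pow2_ge_0 ax); lra).
  replace ((2 + delta) / 2) with (1 + delta / 2) in H by field.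
  rewrite Rpower_plus, Rpower_1 in H by lra.
  assert (HP : 2 * R0 / e <= Rpower W (delta / 2)).
  { rewrite <- (exp_ln (2 * R0 / e)) by (apply Rdiv_lt_0_compat; lra).
    unfold Rpower. apply exp_le.
    apply Rle_trans with (delta / 2 * ln A).
    - unfold A. rewrite ln_exp. right. field. lra.
    - apply Rmult_le_compat_l; [lra|]. apply ln_le_iff; lra. }
  assert (Hsq : (1 + ax) ^ 2 <= 2 * W) by (unfold W; pose proof (pow2_ge_0 (1 - ax)); lra).
  assert (H2 : rho0 x * W * (2 * R0 / e) <= R0).
  { apply Rle_trans with (rho0 x * W * Rpower W (delta / 2)); [|lra].
    apply Rmult_le_compat_l; [nra|exact HP]. }
  assert (H3 : rho0 x * W * 2 <= e).
  { apply Rmult_le_reg_r with (R0 / e); [apply Rdiv_lt_0_compat; lra|].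
    replace (e * (R0 / e)) with R0 by (field; lra).
    replace (rho0 x * W * 2 * (R0 / e)) with (rho0 x * W * (2 * R0 / e)) by (field; lra). exact H2. }
  nra.
Qed.

(** Position and velocity grow at most linearly with the label, and the density
    decays faster than the inverse square of the label. *)
Lemma momentum_vanishes t i : 0 <= t -> i = 1%nat \/ i = 2%nat ->
  forall e, 0 < e -> exists N, forall y, N <= Rabs y ->
    Rabs (density_label (L y t) t * Rabs (V (L y t) t) ^ i) < e.
Proof.
  intros Ht Hi e He.
  destruct (motion_growth t) as [C [HC1 HC]].
  destruct (density_bounded_by_datum t Ht) as [k [Hk Hden]].
  destruct (weighted_density_vanishes (e / 2 / (k * C ^ 2))) as [N HN].
  { repeat apply Rdiv_lt_0_compat; try lra. apply Rmult_lt_0_compat; [lra|apply pow_lt; lra]. }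
  exists (C * (1 + Rabs N)). intros y Hy. set (x := L y t).
  assert (Hyx : y = X x t) by (symmetry; now apply HL).
  destruct (HC x) as [HCX HCV]. rewrite <- Hyx in HCX.
  assert (HNx : N <= Rabs x).
  { apply Rle_trans with (Rabs N); [apply Rle_abs|].
    apply Rmult_le_reg_l with C; lra. }
  specialize (HN x HNx). destruct (Hden x) as [Hd0 Hd].
  set (U := C * (1 + Rabs x)).
  assert (HU1 : 1 <= U) by (unfold U; pose proof (Rabs_pos x); nra).
  assert (HV : Rabs (V x t) ^ i <= U ^ 2).
  { pose proof (Rabs_pos (V x t)). fold U in HCV.
    destruct Hi as [-> | ->]; simpl; nra. }
  assert (HV0 : 0 <= Rabs (V x t) ^ i) by (apply pow_le, Rabs_pos).
  rewrite Rabs_pos_eq by (apply Rmult_le_pos; lra).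
  apply Rle_lt_trans with (k * rho0 x * U ^ 2).
  - apply Rmult_le_compat; lra.
  - apply Rle_lt_trans with (e / 2); [|lra].
    replace (k * rho0 x * U ^ 2) with (k * C ^ 2 * (rho0 x * (1 + Rabs x) ^ 2)) by (unfold U; ring).
    assert (HkC : 0 < k * C ^ 2) by (apply Rmult_lt_0_compat; [lra|apply pow_lt; lra]).
    replace (e / 2) with (k * C ^ 2 * (e / 2 / (k * C ^ 2))) by (field; split; lra).
    apply Rmult_le_compat_l; lra.
Qed.

Lemma density_decays t : 0 <= t ->
  exists C, forall y, y <> 0 -> density_label (L y t) t <= C / Rpower (Rabs y) (2 + delta).
Proof.
  intros Ht. pose proof (cd_delta HD) as Hdel.
  destruct (motion_growth t) as [C [HC1 HC]].
  destruct (density_bounded_by_datum t Ht) as [k [Hk Hden]].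
  set (d := (2 + delta) / 2).
  exists (k * R0 * Rpower (2 * C ^ 2) d). intros y Hy. set (x := L y t).
  assert (Hyx : y = X x t) by (symmetry; now apply HL).
  destruct (HC x) as [HCX _]. rewrite <- Hyx in HCX. destruct (Hden x) as [_ Hd].
  assert (Hay : 0 < Rabs y) by now apply Rabs_pos_lt.
  pose proof (pow2_ge_0 x) as Hx2.
  assert (HC2 : 0 < C ^ 2) by (apply pow_lt; lra).
  assert (Hy2 : Rabs y ^ 2 <= 2 * C ^ 2 * (1 + x ^ 2)).
  { apply Rle_trans with ((C * (1 + Rabs x)) ^ 2); [apply pow_incr; lra|].
    rewrite <- (pow2_abs x), Rpow_mult_distr.
    pose proof (pow2_ge_0 (1 - Rabs x)). nra. }
  assert (HP : Rpower (Rabs y) (2 + delta) <= Rpower (2 * C ^ 2) d * Rpower (1 + x ^ 2) d).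
  { rewrite Rpower_mult_distr by lra.
    replace (Rpower (Rabs y) (2 + delta)) with (Rpower (Rabs y ^ 2) d).
    - apply Rle_Rpower_l; [unfold d; lra|]. split; [now apply pow_lt|exact Hy2].
    - rewrite <- (Rpower_pow 2) by exact Hay. rewrite Rpower_mult. f_equal.
      unfold d. simpl. field. }
  pose proof (cd_decay HD x) as Hdec. fold d in Hdec.
  assert (PP : 0 < Rpower (Rabs y) (2 + delta)) by apply exp_pos.
  assert (P1 : 0 < Rpower (2 * C ^ 2) d) by apply exp_pos.
  apply Rmult_le_reg_r with (Rpower (Rabs y) (2 + delta)); [exact PP|].
  unfold Rdiv. rewrite (Rmult_assoc _ (/ _)), Rinv_l, Rmult_1_r by lra.
  pose proof (cd_pos HD x) as Hp.
  apply Rle_trans with (k * rho0 x * (Rpower (2 * C ^ 2) d * Rpower (1 + x ^ 2) d)).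
  - apply Rmult_le_compat; try lra. left. apply Hden.
  - replace (k * rho0 x * (Rpower (2 * C ^ 2) d * Rpower (1 + x ^ 2) d))
      with (k * Rpower (2 * C ^ 2) d * (Rpower (1 + x ^ 2) d * rho0 x)) by ring.
    replace (k * R0 * Rpower (2 * C ^ 2) d) with (k * Rpower (2 * C ^ 2) d * R0) by ring.
    apply Rmult_le_compat_l; [nra|exact Hdec].
Qed.

(** In the continuity equation the rate of J in rho_t cancels against u_y = J_t / J;
    the momentum equation is the equation of the explicit motion. *)
Theorem global_solution :
  solution delta rho0 u0 p_infty (fun y t => density_label (L y t) t) (fun y t => V (L y t) t).
Proof.
  assert (L0 : forall y, L y 0 = y).
  { intros y. pose proof (HL y 0 ltac:(lra)) as H. now rewrite motion_0 in H by auto. }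
  assert (Ddens : forall y t, 0 < t -> _) by
    (intros y t Ht; exact (transport_derive density_label density_label_x density_label_t y t Ht
      (fun x s Hs => density_label_derive_x x s (Rlt_le _ _ Hs))
      (fun x s Hs => density_label_derive_t x s (Rlt_le _ _ Hs))
      density_label_x_continuous)).
  assert (Dvel : forall y t, 0 < t -> _) by
    (intros y t Ht; exact (transport_derive V J1 acceleration y t Ht
      (fun x s _ => velocity_derive_label x s)
      (fun x s _ => motion_velocity_derive_t M g dg HM Hg c v u0 m0 x s)
      (fun x s _ => CJ1 x s))).
  split.
  - simpl. auto.
  - apply density_C1.
  - apply velocity_C1.
  - intros x. rewrite L0. unfold density_label. rewrite jacobian_0 by auto. field.
  - intros x. rewrite L0. now apply motion_velocity_0.
  - intros y t Ht _. destruct (motion_onto t y Ht) as [x <-].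
    eexists. now apply transported_conv.
  - intros y t Ht _. pose proof (PJ (L y t) t ltac:(lra)) as Hp.
    destruct (Ddens y t Ht) as [D1 D2]. destruct (Dvel y t Ht) as [D3 D4].
    rewrite_derive D2.
    pose proof (is_derive_mult _ _ _ _ _ D1 D3 Rmult_comm) as D5.
    rewrite_derive D5. unfold plus, mult; simpl. unfold density_label_t, density_label. field. lra.
  - intros y t Ht _. pose proof (PJ (L y t) t ltac:(lra)) as Hp.
    destruct (Dvel y t Ht) as [D3 D4].
    rewrite_derive D4. rewrite_derive D3.
    assert (E : dW_conv (fun y t => density_label (L y t) t) y t =
      M - 2 * m0 (L y t) + M * X (L y t) t - M * (c + v * (1 - exp (- t)))).
    { unfold dW_conv, integral_line. apply is_RInt_gen_unique.
      pose proof (transported_conv (L y t) t ltac:(lra)) as H. rewrite HL in H by lra. rewrite HL by lra. exact H. }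
    rewrite E. unfold acceleration. field. lra.
  - intros t i Ht _ Hi. split; apply is_lim_spec; intros e;
      destruct (momentum_vanishes t i Ht Hi e (cond_pos e)) as [N HN].
    + exists (- Rabs N). intros y Hy. rewrite Rminus_0_r. apply HN.
      rewrite Rabs_left1 by (pose proof (Rabs_pos N); lra). pose proof (Rle_abs N). lra.
    + exists (Rabs N). intros y Hy. rewrite Rminus_0_r. apply HN.
      rewrite Rabs_pos_eq by (pose proof (Rabs_pos N); lra). pose proof (Rle_abs N). lra.
  - intros t Ht _. now apply density_decays.
Qed.

End GlobalSolution.

(** * Breakdown *)

Lemma impulse_positive_early M g dg : impulse_response M g dg ->
  forall s, 0 < s -> exists t, 0 < t <= s /\ 0 < g t.
Proof.
  intros Hg s Hs. pose proof (imp_derive Hg 0) as H. rewrite (imp_d0 Hg) in H.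
  apply is_derive_Reals in H. destruct (H (1 / 2)) as [d Hd]; [lra|].
  set (t := Rmin (d / 2) s).
  assert (Ht : 0 < t /\ t <= d / 2 /\ t <= s).
  { pose proof (cond_pos d). unfold t.
    split; [apply Rmin_glb_lt; lra|]. split; [apply Rmin_l|apply Rmin_r]. }
  exists t. split; [lra|].
  specialize (Hd t ltac:(lra)). rewrite (Rabs_pos_eq t) in Hd by lra.
  specialize (Hd ltac:(pose proof (cond_pos d); lra)).
  rewrite Rplus_0_l, (imp_0 Hg), Rminus_0_r in Hd. apply Rabs_def2 in Hd.
  assert (g t / t * t = g t) by (field; lra). nra.
Qed.

(** Since the density at a positive time is C^1 and carries du0 through the
    Jacobian, the mere existence of a classical solution forces u0 to be C^2. *)
Lemma velocity_datum_C2 (delta B R0 M c v : R) (g dg rho0 drho0 u0 du0 m0 : R -> R)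
  (T : Rbar) (rho u : R -> R -> R) :
  0 < M -> impulse_response M g dg ->
  cauchy_data delta B R0 M c v rho0 drho0 u0 du0 m0 ->
  solution delta rho0 u0 T rho u ->
  exists ddu0, (forall x, is_derive du0 x (ddu0 x)) /\ forall x, continuous ddu0 x.
Proof.
  intros HM Hg HD Hsol.
  destruct (between_real_and_Rbar 0 T (sol_lifespan_pos _ _ _ _ _ _ Hsol)) as [S [HS HST]].
  destruct (impulse_positive_early M g dg Hg (S / 2) ltac:(lra)) as [t [Ht Hgt]].
  assert (HtT : Rbar_lt t T) by (apply (Rbar_lt_trans (Finite t) (Finite S) T); [simpl; lra|exact HST]).
  destruct (solution_follows_motion delta B R0 M c v g dg rho0 drho0 u0 du0 m0 T rho u
    HM Hg HD Hsol t ltac:(lra) HtT) as [_ [H2 [H3 _]]].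
  destruct (sol_rho_C1 _ _ _ _ _ _ Hsol) as [rx [rt [Dr [_ [Crx _]]]]].
  assert (Drx : forall y, is_derive (fun y => rho y t) y (rx y t)) by (intros y; apply Dr; [lra|exact HtT]).
  assert (Crxt : forall y, continuous (fun y => rx y t) y).
  { intros y. apply (continuous_ext (fun y => freeze S rx y t)).
    - intros z. apply freeze_id. lra.
    - apply cts2_l, (freeze_cts2 T); auto. }
  set (X := fun x => motion M g dg c v u0 m0 x t) in *.
  set (J := fun x => jacobian M g dg du0 rho0 x t) in *.
  assert (DX : forall x, is_derive X x (J x)).
  { intros x. apply motion_derive_x; [exact HM|apply (cd_du HD)|apply (cd_dm HD)]. }
  assert (Crho0 : forall x, continuous rho0 x) by (intros x; eapply is_derive_continuous, (cd_drho HD)).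
  assert (CJ : forall x, continuous J x).
  { intros x. apply (cts2_l (jacobian M g dg du0 rho0)), cts2_jacobian; auto.
    apply (cd_du_continuous HD). }
  set (rX := fun x => rho (X x) t).
  assert (HRJ : forall x, rX x * J x = rho0 x) by (intros x; apply H2).
  assert (PR : forall x, 0 < rX x).
  { intros x. pose proof (HRJ x) as E. pose proof (H3 x) as P. pose proof (cd_pos HD x).
    change (0 < J x) in P. nra. }
  assert (DR : forall x, is_derive rX x (J x * rx (X x) t)).
  { intros x. apply (is_derive_comp (fun y => rho y t) X); [apply Drx|apply DX]. }
  set (h := (1 - dg t - g t) / M).
  assert (Edu : forall x, du0 x = (rho0 x / rX x - (dg t + g t) - 2 * rho0 x * h) / g t).
  { intros x. replace (rho0 x / rX x) with (J x).
    - unfold J, jacobian, resp, h. field. lra.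
    - rewrite <- HRJ. field. pose proof (PR x). lra. }
  exists (fun x => ((drho0 x * rX x - rho0 x * (J x * rx (X x) t)) / (rX x * rX x) - 2 * drho0 x * h) / g t).
  split.
  - intros x. apply (is_derive_ext (fun x => (rho0 x / rX x - (dg t + g t) - 2 * rho0 x * h) / g t)).
    + intros z. symmetry. apply Edu.
    + pose proof (cd_drho HD x) as D1. pose proof (DR x) as D2. pose proof (PR x).
      clearbody rX h. auto_derive.
      * repeat split; try (eexists; eassumption). lra.
      * use_derivatives. field. lra.
  - intros x.
    assert (CR : forall x, continuous rX x) by (intros z; eapply is_derive_continuous, DR).
    assert (CX : forall x, continuous X x) by (intros z; eapply is_derive_continuous, DX).
    assert (Cd := cd_drho_continuous HD).
    assert (CrX : forall x, continuous (fun x => rx (X x) t) x).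
    { intros z. apply (continuous_comp X (fun y => rx y t)); auto. }
    assert (Ci : continuous (fun x => / (rX x * rX x)) x).
    { apply (continuous_comp (fun x => rX x * rX x) Rinv); [solve_continuous|].
      apply continuous_Rinv. pose proof (PR x). nra. }
    unfold Rdiv. solve_continuous.
Qed.

(** The Jacobian is positive during the life span of a solution.  If it is
    positive at all times, the global solution extends the given one, which
    excludes a finite maximal life span. *)
Theorem breakdown_iff_jacobian_vanishes (delta B R0 M c v : R)
  (g dg rho0 drho0 u0 du0 m0 : R -> R) (Tstar : Rbar) (rho u : R -> R -> R) :
  0 < M -> impulse_response M g dg ->
  cauchy_data delta B R0 M c v rho0 drho0 u0 du0 m0 ->
  maximal_solution delta rho0 u0 Tstar rho u ->
  (finite_time_breakdown Tstar <->
   exists x t, 0 <= t /\ jacobian M g dg du0 rho0 x t <= 0).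
Proof.
  intros HM Hg HD [Hsol Hmax].
  assert (Hrep := solution_follows_motion delta B R0 M c v g dg rho0 drho0 u0 du0 m0 Tstar rho u HM Hg HD Hsol).
  split.
  - intros Hfin. apply NNPP. intros Hno.
    assert (PJ : forall x t, 0 <= t -> 0 < jacobian M g dg du0 rho0 x t).
    { intros x t Ht. apply Rnot_le_lt. intros Hle. apply Hno. now exists x, t. }
    destruct (velocity_datum_C2 delta B R0 M c v g dg rho0 drho0 u0 du0 m0 Tstar rho u HM Hg HD Hsol)
      as [ddu0 [Dddu Cddu]].
    destruct (label_map_exists delta B R0 M c v g dg rho0 drho0 u0 du0 m0 HM Hg HD PJ) as [L HL].
    pose proof (global_solution delta B R0 M c v g dg rho0 drho0 u0 du0 ddu0 m0 HM Hg HD Dddu Cddu PJ L HL)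
      as Hglob.
    apply (Hmax p_infty _ _ Hfin Hglob). intros y t Ht HtT.
    destruct Ht as [Ht|<-].
    + destruct (Hrep t Ht HtT) as [H1 [H2 [H3 _]]].
      specialize (H1 (L y t)). specialize (H2 (L y t)). specialize (H3 (L y t)).
      rewrite HL in H1, H2 by lra. split; [|now symmetry].
      unfold density_label. rewrite <- H2. field. lra.
    + rewrite (sol_rho_init _ _ _ _ _ _ Hsol), (sol_u_init _ _ _ _ _ _ Hsol).
      rewrite (sol_rho_init _ _ _ _ _ _ Hglob), (sol_u_init _ _ _ _ _ _ Hglob). auto.
  - intros [x [t [Ht HJ]]]. unfold finite_time_breakdown.
    destruct Tstar as [T| |]; simpl; auto.
    destruct Ht as [Ht|<-].
    + destruct (Hrep t Ht I) as [_ [_ [H3 _]]]. specialize (H3 x). lra.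
    + rewrite jacobian_0 in HJ by auto. lra.
Qed.

Theorem theorem5p2
  (rho0 u0 : R -> R) (delta : R)
  (rho0_C1 : class_C1 rho0) (u0_C1 : class_C1 u0)
  (rho0_pos : forall x, 0 < rho0 x)
  (delta_pos : 0 < delta)
  (du0_bounded : exists B, forall x, Rabs (Derive u0 x) <= B)
  (rho0_decay : exists B, forall x,
     Rabs (Rpower (1 + x ^ 2) ((2 + delta) / 2) * rho0 x) <= B)
  (M0 : R) (M0_def : M0 = integral_line rho0)
  (rho u : R -> R -> R) (Tstar : Rbar)
  (sol : maximal_solution delta rho0 u0 Tstar rho u) :
  (M0 < 1 / 4 ->
     (finite_time_breakdown Tstar <->
      exists x, subcritical_condition M0 (Derive u0 x) (rho0 x))) /\
  (M0 = 1 / 4 ->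
     (finite_time_breakdown Tstar <->
      exists x, critical_condition M0 (Derive u0 x) (rho0 x))) /\
  (M0 > 1 / 4 ->
     (finite_time_breakdown Tstar <->
      exists x, supercritical_condition M0 (Derive u0 x) (rho0 x))).
Proof.
  destruct du0_bounded as [B HB]. destruct rho0_decay as [R0 HR0].
  destruct (cauchy_data_exists delta B R0 rho0 u0 rho0_C1 u0_C1 rho0_pos delta_pos HB)
    as [HM [c [v [m0 HD]]]].
  { intros x. eapply Rle_trans; [apply Rle_abs|apply HR0]. }
  rewrite <- M0_def in HM, HD.
  assert (Hbd : forall g dg (C : R -> R -> Prop), impulse_response M0 g dg ->
     (forall p r, 0 < r -> C p r <-> exists t, 0 <= t /\ resp M0 g dg 1 p (2 * r) t <= 0) ->
     (finite_time_breakdown Tstar <-> exists x, C (Derive u0 x) (rho0 x))).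
  { intros g dg C Hg HC.
    rewrite (breakdown_iff_jacobian_vanishes delta B R0 M0 c v g dg rho0 (Derive rho0) u0 (Derive u0)
      m0 Tstar rho u HM Hg HD sol).
    split; intros [x Hx]; exists x; revert Hx; apply HC; auto. }
  split; [|split]; intros Hcase.
  - apply (Hbd (overdamped_impulse M0) (overdamped_impulse' M0)).
    + apply overdamped_impulse_response. lra.
    + intros p r Hr. apply subcritical_iff; lra.
  - rewrite Hcase in *. apply (Hbd critical_impulse critical_impulse').
    + apply critical_impulse_response.
    + apply critical_iff.
  - apply (Hbd (underdamped_impulse M0) (underdamped_impulse' M0)).
    + apply underdamped_impulse_response. lra.
    + intros p r Hr. apply supercritical_iff; lra.
Qed.
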